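(* Let $k_1=k_2=k_3,\lambda_1,\lambda_2,f$ be positive constants, $0<\theta_0<\pi/2$, and let $q=\frac{2\pi n_0}{h}$ for a fixed positive integer $n_0$. The Euler–Lagrange system (EL) of the context exhibits a pitchfork bifurcation at $d=-2\lambda_2q^4\cos^4\theta_0$ and $(\theta\equiv0,\delta\rho\equiv0)$ in $W_\theta\times V$. More precisely, there exist positive numbers $\epsilon,\delta$ and two smooth maps $$t\in(-\delta,\delta)\mapsto d(t)+2\lambda_2q^4\cos^4\theta_0\in(-\epsilon,\epsilon),\qquad t\in(-\delta,\delta)\mapsto w_t\in V,$$ where $d(t)$ is a monotonically decreasing function of $t$, such that all the $(d,\theta,\delta\rho)\in\mathbb R\times W_\theta\times V$ satisfying $$(\theta,\delta\rho)\text{ is a solution to (EL)},\qquad |d+2\lambda_2q^4\cos^4\theta_0|<\epsilon,\qquad \|w_t\|_{W^{2,2}(0,h)}\le\epsilon$$ are either the cholesteric phase $(\theta\equiv0,\ \delta\rho\equiv0)$, or the smectic phases $$\big(\theta\equiv0,\ \delta\rho=\pm(t\sin(qz)+t^2w_t)\big)\qquad\text{(with } d=d(t)).$$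
   Context: Let $h>0$, $\sigma=2\pi/p$ ($p>0$ the pitch) and $d\in\mathbb R$. The system (EL), which is the Euler–Lagrange system of $$F(\theta,\delta\rho)=\int_0^h\Big\{k_1\theta_z^2-k_1\sigma^2\cos^2\theta+\tfrac d2\delta\rho^2+\tfrac f4\delta\rho^4+\lambda_1(\delta\rho_{zz}+q^2\delta\rho)^2+\lambda_2\big(\sin^2\theta\,\delta\rho_{zz}+q^2\delta\rho\cos^2\theta_0\big)^2\Big\}\,dz$$ (with $k_1=k_2=k_3$), is, in the weak sense, $$2k_1\theta_{zz}=k_1\sigma^2\sin(2\theta)+2\lambda_2\big(\sin^2\theta\,\delta\rho_{zz}+q^2\delta\rho\cos^2\theta_0\big)\sin(2\theta)\,\delta\rho_{zz},$$ $$-2\lambda_1\delta\rho_{zzzz}=d\,\delta\rho+f\delta\rho^3+4\lambda_1q^2\delta\rho_{zz}+2\lambda_1q^4\delta\rho+2\lambda_2(\sin^4\theta\,\delta\rho_{zz})_{zz}$$ $$+2\lambda_2\big(q^2\cos^2\theta_0\,\delta\rho_{zz}\sin^2\theta+q^2\cos^2\theta_0(\sin^2\theta\,\delta\rho)_{zz}+q^4\cos^4\theta_0\,\delta\rho\big),$$ with natural (Neumann) boundary conditions for $\theta$ and periodic boundary conditions for $\delta\rho$ on $[0,h]$. The spaces are $$W_\theta=\{\theta\in W^{1,2}(0,h):\theta\in[-\tfrac\pi2,\tfrac\pi2],\ \theta_z(0)=\theta_z(h)=0\},$$ $$W_{\delta\rho}=\{\delta\rho\in W^{2,2}(0,h):\delta\rho(0)=\delta\rho(h),\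 \delta\rho_z(0)=\delta\rho_z(h),\ \delta\rho_{zz}(0)=\delta\rho_{zz}(h)\},$$ and $V=W_{\delta\rho}\cap W_0^{1,2}(0,h)$, where $W_0^{1,2}(0,h)$ is the set of $W^{1,2}(0,h)$ functions vanishing at $0$ and $h$.
   Formalization: d(t) is shown decreasing in |t| (it has a strict maximum at t=0, so it is not monotone on (-δ,δ)); the condition ‖w_t‖≤ε is replaced by ‖θ‖_{W^{1,2}}≤ε and ‖δρ‖_{W^{2,2}}≤ε, since (θ≡π/2, δρ≡0) solves (EL) for every d. *)

(* Defs.v *)
From mathcomp Require Import all_boot all_order all_algebra.
From mathcomp Require Import all_classical all_reals all_analysis.

Set Implicit Arguments.
Unset Strict Implicit.
Unset Printing Implicit Defensive.

Import Order.TTheory GRing.Theory Num.Theory.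
Import numFieldNormedType.Exports.

Local Open Scope classical_set_scope.
Local Open Scope ring_scope.

(* Elements of the Sobolev spaces on (0, h) are represented by functions
   R -> R of which only the values on [0, h] matter. *)

Section Sobolev.
Context {R : realType}.
Variable h : R.
Implicit Types u g theta : R -> R.

Definition integ (g : R -> R) : R :=
  (\int[@lebesgue_measure R]_(z in `]0, h[) g z)%R.

Definition L2 (g : R -> R) : Prop :=
  measurable_fun (`]0, h[ : set R) g /\
  (@lebesgue_measure R).-integrable `]0, h[ (EFin \o (fun z => g z ^+ 2)).

(* test functions of class C^1_c(0, h) *)
Definition C1c (phi : R -> R) : Prop :=
  [/\ forall z, derivable phi z 1, continuous (derive1 phi) &
      exists a b, [/\ 0 < a, b < h & forall z, phi z != 0 -> a <= z <= b]].

Definition is_wderiv (u g : R -> R) : Prop :=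
  [/\ L2 u, L2 g & forall phi, C1c phi ->
      integ (fun z => u z * derive1 phi z) = - integ (fun z => g z * phi z)].

(* Some representative of the weak derivative (which is unique up to a null
   set); junk when there is none. *)
Definition wD (u : R -> R) : R -> R := xget (fun=> 0) [set g | is_wderiv u g].

(* In dimension one every class has a unique representative that is continuous
   on [0, h]; requiring it gives a meaning to boundary values. *)
Definition W12 (u : R -> R) : Prop :=
  {within `[0, h], continuous u} /\ exists g, is_wderiv u g.

Definition W22 (u : R -> R) : Prop :=
  W12 u /\ exists g, is_wderiv (wD u) g.

Definition normW12 (u : R -> R) : R :=
  Num.sqrt (integ (fun z => u z ^+ 2) + integ (fun z => wD u z ^+ 2)).

Definition normW22 (u : R -> R) : R :=
  Num.sqrt (integ (fun z => u z ^+ 2) + integ (fun z => wD u z ^+ 2)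
            + integ (fun z => wD (wD u) z ^+ 2)).

(* u is differentiable at z relatively to [0, h], with derivative l; this is
   the one-sided derivative at the endpoints. *)
Definition has_deriv (u : R -> R) (z l : R) : Prop :=
  (y - z)^-1 * (u y - u z) @[y --> within `[0, h] z^'] --> l.

Definition Wtheta (theta : R -> R) : Prop :=
  [/\ W12 theta,
      forall z, 0 <= z <= h -> - (pi / 2) <= theta z <= pi / 2,
      has_deriv theta 0 0 & has_deriv theta h 0].

(* A function of W^{2,2}(0, h) is C^1 on [0, h], with derivative v below. *)
Definition Wrho (u : R -> R) : Prop :=
  [/\ W22 u, u 0 = u h &
      exists v : R -> R,
        [/\ forall z, 0 <= z <= h -> has_deriv u z (v z),
            v 0 = v h &
            exists l, has_deriv v 0 l /\ has_deriv v h l]].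

Definition W12_0 (u : R -> R) : Prop := [/\ W12 u, u 0 = 0 & u h = 0].

Definition V (u : R -> R) : Prop := Wrho u /\ W12_0 u.

(* w is C^infinity as a map from (-delta, delta) to V normed by W^{2,2};
   D n is its n-th derivative. *)
Definition smooth_to_V (delta : R) (w : R -> R -> R) : Prop :=
  exists D : nat -> R -> R -> R,
    [/\ D 0%N = w,
        forall n t, `|t| < delta -> V (D n t) &
        forall n t, `|t| < delta ->
          normW22 (fun z => s^-1 * (D n (t + s) z - D n t z) - D n.+1 t z)
            @[s --> 0^'] --> (0 : R)].

Definition smooth_on (delta : R) (d : R -> R) : Prop :=
  forall n t, `|t| < delta -> derivable (derive1n n d) t 1.

Section EulerLagrange.
Variables (k1 sigma lam1 lam2 f q theta0 : R).

(* Weak forms of the two equations, tested against psi and eta. *)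
Definition weak_eq_theta (theta u psi : R -> R) : Prop :=
  - integ (fun z => 2 * k1 * wD theta z * wD psi z) =
  integ (fun z =>
    (k1 * sigma ^+ 2 * sin (2 * theta z)
     + 2 * lam2 * (sin (theta z) ^+ 2 * wD (wD u) z
                   + q ^+ 2 * u z * cos theta0 ^+ 2)
         * sin (2 * theta z) * wD (wD u) z) * psi z).

Definition weak_eq_rho (d : R) (theta u eta : R -> R) : Prop :=
  - integ (fun z => 2 * lam1 * wD (wD u) z * wD (wD eta) z) =
  integ (fun z =>
    (d * u z + f * u z ^+ 3 + 4 * lam1 * q ^+ 2 * wD (wD u) z
     + 2 * lam1 * q ^+ 4 * u z) * eta z)
  + integ (fun z =>
      2 * lam2 * (sin (theta z) ^+ 4 * wD (wD u) z) * wD (wD eta) z)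
  + integ (fun z =>
      2 * lam2 *
        (q ^+ 2 * cos theta0 ^+ 2 * wD (wD u) z * sin (theta z) ^+ 2 * eta z
         + q ^+ 2 * cos theta0 ^+ 2
             * (sin (theta z) ^+ 2 * u z) * wD (wD eta) z
         + q ^+ 4 * cos theta0 ^+ 4 * u z * eta z)).

(* Natural boundary conditions for theta: psi is unconstrained at the
   endpoints; periodic ones for delta rho: eta is periodic. *)
Definition EL (d : R) (theta u : R -> R) : Prop :=
  [/\ Wtheta theta, Wrho u,
      forall psi, W12 psi -> weak_eq_theta theta u psi &
      forall eta, Wrho eta -> weak_eq_rho d theta u eta].

End EulerLagrange.

Definition vanishes (u : R -> R) : Prop := forall z, 0 <= z <= h -> u z = 0.

End Sobolev.

Definition smectic {R : realType} (q : R) (w : R -> R -> R) (t z : R) : R :=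
  t * sin (q * z) + t ^+ 2 * w t z.

(* Main.v *)
(* Under the smallness assumption on the norms, testing the first equation of
   (EL) against theta itself forces theta = 0: the term k1 sigma^2 sin (2 theta)
   is coercive near 0, and the coupling is controlled by the squared W^{2,2}
   norm of the density. With theta = 0 the second equation reads
     u'''' + 2 q^2 u'' + q^4 u = m u - nu u^3,
   where nu = f / (2 lam1) and 2 lam1 m = dstar - d, i.e. L^2 u = m u - nu u^3
   for L u = u'' + q^2 u with periodic conditions. The kernel of L is spanned
   by sin (q z) and cos (q z), and L has an explicit Green operator on its
   orthogonal complement.
   The branch is built as a power series u = t * sum_k t^(2k) U_k,
   m = t^2 * sum_k t^(2k) M_k whose coefficients are determined recursively:
   M_k is the solvability condition of the equation for U_(k+1). The U_k are
   odd under z -> h - z, so the condition against cos (q z) is automatic and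
   U_k vanishes at the endpoints. A majorant with weights
   (k+1)^-2, which reproduce under Cauchy products, gives geometric bounds,
   hence smoothness in t; and m is increasing in |t| as M_0 > 0.
   Conversely a small weak solution solves
     u = a sin (q z) + b cos (q z) + L^{-2} (m u - nu u^3),
   with u(0) = 0 fixing b; two small solutions with the same a coincide by a
   contraction estimate, and a = 0 only for u = 0. *)

(* A weak solution has no regularity beyond W^{2,2}, and [wD] is an arbitrary representative, so a
   weak solution is never differentiated and no bootstrap is run. All derivatives are moved onto
   explicit C^2 functions: testing with L^{-2} k, for every k orthogonal to the kernel of L,
   identifies the solution by duality. This requires a double integration by parts for W^{2,2}
   functions whose boundary derivatives exist only from one side; it is proved with spline cutoffs.
   Explicit functions live on the whole line, their data being frozen outside [0, h] by [clamp], so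
   that ordinary derivatives and the fundamental theorem of calculus apply up to the endpoints. The
   reduced equation is translation invariant, whence a two-dimensional kernel; the condition u(0) =
   0 in [V] removes the translates, and oddness about h / 2 keeps the branch inside [V]. The
   parameter m is never an independent unknown: once the amplitude a is fixed, the solvability
   condition against sin (q z) yields m, in the recursion as well as in the contraction. *)
Require Import Defs.
From mathcomp Require Import all_boot all_order all_algebra.
From mathcomp Require Import all_classical all_reals all_analysis.
From mathcomp Require Import measurable_realfun ring lra.

Import Order.TTheory GRing.Theory Num.Theory.
Import numFieldNormedType.Exports.

Set Implicit Arguments.
Unset Strict Implicit.
Unset Printing Implicit Defensive.

Local Open Scope classical_set_scope.
Local Open Scope ring_scope.

(** * Integrals on (0, h) *)

Section Integrals.
Context {R : realType} (h : R).
Hypothesis h0 : 0 < h.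
Implicit Types f g F G : R -> R.
Local Notation mu := (@lebesgue_measure R).

Definition integrable_on f := mu.-integrable `]0, h[ (EFin \o f).
Definition cont_on f := {within `[0, h], continuous f}.

Let mI : measurable (`]0, h[ : set (measurableTypeR R)).
Proof. exact: measurable_itv. Qed.

Lemma in_oo (z : R) : `]0, h[%classic z <-> 0 < z < h.
Proof. by rewrite /= in_itv. Qed.

Lemma in_cc (z : R) : `[0, h]%classic z <-> 0 <= z <= h.
Proof. by rewrite /= in_itv. Qed.

Lemma eq_integ f g : (forall z, 0 < z < h -> f z = g z) ->
  integ h f = integ h g.
Proof.
by move=> fg; apply: eq_Rintegral => z; rewrite inE => /in_oo; exact: fg.
Qed.

Lemma integrableD_on f g : integrable_on f -> integrable_on g ->
  integrable_on (fun z => f z + g z).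
Proof. by move=> fi gi; have := integrableD mI fi gi; exact. Qed.

Lemma integrableZ_on c f : integrable_on f -> integrable_on (fun z => c * f z).
Proof.
by move=> fi; have := integrableZl mI c fi; exact.
Qed.

Lemma integrableB_on f g : integrable_on f -> integrable_on g ->
  integrable_on (fun z => f z - g z).
Proof. by move=> fi gi; have := integrableB mI fi gi; exact. Qed.

Lemma eq_integrable_on f g : (forall z, 0 < z < h -> f z = g z) ->
  integrable_on f -> integrable_on g.
Proof.
move=> fg; apply: eq_integrable => // z; rewrite inE => /in_oo zI.
by rewrite /= fg.
Qed.

Lemma integD f g : integrable_on f -> integrable_on g ->
  integ h (fun z => f z + g z) = integ h f + integ h g.
Proof. exact: RintegralD. Qed.

Lemma integB f g : integrable_on f -> integrable_on g ->
  integ h (fun z => f z - g z) = integ h f - integ h g.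
Proof. exact: RintegralB. Qed.

Lemma integZ c f : integrable_on f ->
  integ h (fun z => c * f z) = c * integ h f.
Proof. exact: RintegralZl. Qed.

Lemma integ0 : integ h (fun=> 0) = 0.
Proof. by rewrite /integ Rintegral_cst// mul0r. Qed.

Lemma integ_cst c : integ h (fun=> c) = c * h.
Proof.
rewrite /integ Rintegral_cst//; congr (_ * _).
by have := @lebesgue_measure_itv R `]0, h[; rewrite /= lte_fin h0 oppr0 adde0 => ->.
Qed.

Lemma integN f : integrable_on f -> integ h (fun z => - f z) = - integ h f.
Proof.
move=> fi; rewrite -mulN1r -integZ//; apply: eq_integ => z _.
by rewrite mulN1r.
Qed.

Lemma le_integ f g : integrable_on f -> integrable_on g ->
  (forall z, 0 < z < h -> f z <= g z) -> integ h f <= integ h g.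
Proof. by move=> fi gi fg; apply: le_Rintegral => // z /in_oo; exact: fg. Qed.

Lemma integ_ge0 f : (forall z, 0 < z < h -> 0 <= f z) -> 0 <= integ h f.
Proof. by move=> f0; apply: Rintegral_ge0 => z /in_oo; exact: f0. Qed.

Lemma norm_integ f : integrable_on f ->
  `|integ h f| <= integ h (fun z => `|f z|).
Proof. exact: le_normr_Rintegral. Qed.

Lemma integrable_norm_on f : integrable_on f -> integrable_on (fun z => `|f z|).
Proof. by move=> fi; have := integrable_norm fi; exact. Qed.

Lemma integrable_measurable_on f : integrable_on f ->
  measurable_fun (`]0, h[ : set R) f.
Proof. by move=> /integrableP[/measurable_EFinP]. Qed.

Lemma le_integrable_on f g : measurable_fun (`]0, h[ : set R) f ->
  (forall z, 0 < z < h -> `|f z| <= g z) -> integrable_on g -> integrable_on f.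
Proof.
move=> mf fg gi; apply: (le_integrable mI) gi; first exact/measurable_EFinP.
move=> z /in_oo zI /=; rewrite lee_fin (le_trans (fg _ zI))//.
exact: ler_norm.
Qed.

Lemma cont_on_integrable f : cont_on f -> integrable_on f.
Proof.
move=> fc; have : mu.-integrable `[0, h] (EFin \o f).
  by apply: continuous_compact_integrable => //; exact: segment_compact.
by apply: integrableS => //; apply: subset_itvScc; rewrite bnd_simp.
Qed.

Lemma continuous_cont_on f : continuous f -> cont_on f.
Proof. exact: continuous_subspaceT. Qed.

Lemma cst_cont_on c : cont_on (fun=> c).
Proof. by apply: continuous_cont_on => z; exact: cvg_cst. Qed.

Lemma id_cont_on : cont_on (fun z => z).
Proof. by apply: continuous_cont_on => z; exact: cvg_id. Qed.

Lemma cont_onD f g : cont_on f -> cont_on g -> cont_on (fun z => f z + g z).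
Proof. by move=> fc gc z; apply: cvgD; [exact: fc|exact: gc]. Qed.

Lemma cont_onB f g : cont_on f -> cont_on g -> cont_on (fun z => f z - g z).
Proof. by move=> fc gc z; apply: cvgB; [exact: fc|exact: gc]. Qed.

Lemma cont_onM f g : cont_on f -> cont_on g -> cont_on (fun z => f z * g z).
Proof. by move=> fc gc z; apply: cvgM; [exact: fc|exact: gc]. Qed.

Lemma cont_onN f : cont_on f -> cont_on (fun z => - f z).
Proof. by move=> fc z; apply: cvgN; exact: fc. Qed.

Lemma cont_onZ c f : cont_on f -> cont_on (fun z => c * f z).
Proof. by move=> fc; apply: cont_onM => //; exact: cst_cont_on. Qed.

Lemma cont_onX n f : cont_on f -> cont_on (fun z => f z ^+ n).
Proof.
move=> fc; elim: n => [|n IH].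
  by under eq_fun do rewrite expr0; exact: cst_cont_on.
by under eq_fun do rewrite exprS; exact: cont_onM.
Qed.

Lemma cont_on_comp f g : cont_on f -> continuous g ->
  cont_on (fun z => g (f z)).
Proof. by move=> fc gc z; apply: continuous_comp; [exact: fc|exact: gc]. Qed.

Lemma eq_cont_on f g : (forall z, 0 <= z <= h -> f z = g z) ->
  cont_on f -> cont_on g.
Proof.
move=> fg; apply: subspace_eq_continuous => z; rewrite inE => /in_cc; exact: fg.
Qed.

Lemma norm_integ_le f B : integrable_on f ->
  (forall z, 0 < z < h -> `|f z| <= B) -> `|integ h f| <= B * h.
Proof.
move=> fi fB; rewrite -integ_cst; apply: le_trans (norm_integ fi) _.
apply: le_integ => //; first exact: integrable_norm_on.
exact/cont_on_integrable/cst_cont_on.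
Qed.

Lemma cont_on_bounded f : cont_on f ->
  exists B, 0 <= B /\ forall z, 0 <= z <= h -> `|f z| <= B.
Proof.
move=> fc; have := continuous_compact fc (@segment_compact _ 0 h).
move=> /compact_bounded[M [_ /(_ (`|M| + 1))]].
have -> : M < `|M| + 1 by rewrite ltr_pwDr// ler_norm.
move=> /(_ isT) H; exists (`|M| + 1); split; first by rewrite addr_ge0.
by move=> z zI; apply: (H (f z)); exists z => //; exact/in_cc.
Qed.

(** The derivative is asked for on the whole line, which spares one-sided derivatives at the
    endpoints; this is why explicit functions are later extended beyond [[0, h]]. *)
Lemma integ_derive F f : (forall z, is_derive z (1 : R) F (f z)) -> cont_on f ->
  integ h f = F h - F 0.
Proof.
move=> Ff fc; rewrite /integ.
have fi := cont_on_integrable fc.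
have fi' : mu.-integrable `[0, h] (EFin \o f).
  by apply: continuous_compact_integrable => //; exact: segment_compact.
rewrite Rintegral_itv_bndo_bndc// Rintegral_itv_obnd_cbnd; last first.
  by apply: integrableS fi' => //; apply: subset_itvScc; rewrite bnd_simp.
rewrite /Rintegral (@continuous_FTC2 _ f F)//.
- have Fc : continuous F.
    by move=> z; apply/differentiable_continuous/derivable1_diffP/ex_derive.
  split; first by move=> z _; exact: ex_derive.
    by apply: cvg_at_right_filter; exact: Fc.
  by apply: cvg_at_left_filter; exact: Fc.
- by move=> z _; rewrite derive1E derive_val.
Qed.

End Integrals.

(** A subtraction is the sum with an opposite, so its case must precede that of sums. Atomic
    functions are closed by [assumption]: their continuity has to be in the context beforehand. *)
Ltac cont_tac := lazymatch goal with
  | |- cont_on _ (fun z => @?f z + - @?g z) =>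
      refine (@cont_onB _ _ f g _ _); cont_tac
  | |- cont_on _ (fun z => @?f z + @?g z) =>
      refine (@cont_onD _ _ f g _ _); cont_tac
  | |- cont_on _ (fun z => - @?f z) => refine (@cont_onN _ _ f _); cont_tac
  | |- cont_on _ (fun z => @?f z * @?g z) =>
      refine (@cont_onM _ _ f g _ _); cont_tac
  | |- cont_on _ (fun z => @?f z ^+ ?n) => refine (@cont_onX _ _ n f _); cont_tac
  | |- cont_on _ (fun z => z) => exact: id_cont_on
  | |- cont_on _ (fun _ => ?c) => exact: cst_cont_on
  | |- _ => assumption
  end.
Ltac int_tac := apply: cont_on_integrable; cont_tac.

(** * Calculus on the whole line: derivatives, primitives, clamped extensions *)

Definition deriv_of {R : realType} (F f : R -> R) := forall z : R, is_derive z (1 : R) F (f z).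

Section Derivatives.
Context {R : realType}.
Implicit Types (f g F G : R -> R) (z a b : R).

Lemma is_derive1D F G z a b : is_derive z 1 F a -> is_derive z 1 G b ->
  is_derive z 1 (fun x => F x + G x) (a + b).
Proof. by move=> Fa Gb; have := is_deriveD Fa Gb. Qed.

Lemma is_derive1B F G z a b : is_derive z 1 F a -> is_derive z 1 G b ->
  is_derive z 1 (fun x => F x - G x) (a - b).
Proof. by move=> Fa Gb; have := is_deriveB Fa Gb. Qed.

Lemma is_derive1M F G z a b : is_derive z 1 F a -> is_derive z 1 G b ->
  is_derive z 1 (fun x => F x * G x) (a * G z + F z * b).
Proof.
move=> Fa Gb; apply: (is_derive_eq (is_deriveM Fa Gb)).
by rewrite /GRing.scale/= addrC [G z * _]mulrC.
Qed.

Lemma is_derive1Z c F z a : is_derive z 1 F a ->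
  is_derive z 1 (fun x => c * F x) (c * a).
Proof.
move=> Fa; by apply: (is_derive_eq (@is_derive1M (fun=> c) F z 0 a (is_derive_cst _ _ _) Fa)); rewrite mul0r add0r.
Qed.

Lemma is_derive1_sin q z :
  is_derive z 1 (fun x => sin (q * x)) (q * cos (q * z)).
Proof.
by apply: (is_derive_eq (is_derive1_comp (is_derive_sin (q * z)) (is_derive1Z q (is_derive_id z 1)))); rewrite mulr1 mulrC.
Qed.

Lemma is_derive1_cos q z :
  is_derive z 1 (fun x => cos (q * x)) (- (q * sin (q * z))).
Proof.
by apply: (is_derive_eq (is_derive1_comp (is_derive_cos (q * z)) (is_derive1Z q (is_derive_id z 1)))); rewrite mulr1 mulrC mulrN.
Qed.

Lemma derive_continuous F f : deriv_of F f -> continuous F.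
Proof.
move=> Ff z; apply/differentiable_continuous/derivable1_diffP.
exact: (@ex_derive _ _ _ _ _ _ _ (Ff z)).
Qed.

Lemma derive_norm_le F f B x y : deriv_of F f -> x <= y ->
  (forall z, x <= z <= y -> `|f z| <= B) -> `|F y - F x| <= B * (y - x).
Proof.
move=> Ff xy fB.
have [c] := MVT_segment xy (fun z _ => Ff z)
  (continuous_subspaceT (derive_continuous Ff)).
rewrite in_itv /= => cI ->; rewrite normrM [`|y - x|]ger0_norm ?subr_ge0//.
by rewrite ler_wpM2r ?subr_ge0// fB.
Qed.

Lemma derive_eq F G f : deriv_of F f -> deriv_of G f -> forall x y, F x - G x = F y - G y.
Proof.
move=> Ff Gf x y; apply: (@is_derive_0_is_cst _ (fun z => F z - G z)) => z.
by apply: (is_derive_eq (is_derive1B (Ff z) (Gf z))); rewrite subrr.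
Qed.

Lemma is_derive1_rev F f c : deriv_of F f ->
  deriv_of (fun z => F (c - z)) (fun z => - f (c - z)).
Proof.
move=> Ff z.
have d : is_derive z 1 (fun x => c - x) (-1).
  by apply: (is_derive_eq (is_derive1B (is_derive_cst c z 1) (is_derive_id z 1))); rewrite sub0r.
by apply: (is_derive_eq (@is_derive1_comp _ F (fun x => c - x) _ _ _ (Ff (c - z)) d)); rewrite mulrN1.
Qed.

End Derivatives.

Section Primitive.
Context {R : realType}.
Implicit Types (k : R -> R) (z : R).
Local Notation mu := (@lebesgue_measure R).

(** The signed integral from 0 to [z]: whatever the sign of [z], one of the two intervals is empty
    or a point. *)
Definition prim k z : R :=
  (\int[mu]_(s in `[0, z]) k s)%R - (\int[mu]_(s in `[z, 0]) k s)%R.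

Lemma prim0 k : prim k 0 = 0.
Proof. by rewrite /prim subrr. Qed.

Lemma itv_integrable k a b : continuous k -> mu.-integrable `[a, b] (EFin \o k).
Proof.
move=> kc; apply: continuous_compact_integrable; first exact: segment_compact.
exact: continuous_subspaceT.
Qed.

(** A base point to the left of both 0 and [z] removes the case distinction on the sign, so that the
    fundamental theorem with a fixed lower bound applies around [z], including at 0. *)
Lemma primE k a z : continuous k -> a < 0 -> a < z ->
  prim k z = (\int[mu]_(s in `[a, z]) k s)%R - (\int[mu]_(s in `[a, 0]) k s)%R.
Proof.
move=> kc a0 az; rewrite /prim.
have oc (x y : R) : (\int[mu]_(s in `]x, y]) k s = \int[mu]_(s in `[x, y]) k s)%R.
  rewrite Rintegral_itv_obnd_cbnd//.
  apply: integrableS (itv_integrable x y kc) => //.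
  by apply: subset_itvScc; rewrite bnd_simp.
have [z0|z0|->] := ltgtP z 0; last by rewrite !subrr.
- rewrite (@set_itv_ge _ _ (BLeft 0) (BRight z)) ?bnd_simp -?ltNge//.
  rewrite Rintegral_set0 sub0r -oc -(@Rintegral_itvB _ _ (BLeft a)) ?bnd_simp ?ltW//.
    by rewrite opprB.
  exact: itv_integrable.
- rewrite (@set_itv_ge _ _ (BLeft z) (BRight 0)) ?bnd_simp -?ltNge//.
  rewrite Rintegral_set0 subr0 -oc -(@Rintegral_itvB _ _ (BLeft a)) ?bnd_simp ?ltW//.
  exact: itv_integrable.
Qed.

Lemma prim_derive k : continuous k -> deriv_of (prim k) k.
Proof.
move=> kc z; pose a := Num.min z 0 - 1.
have az : a < z by rewrite /a ltrBlDr (@le_lt_trans _ _ z)// ?ltrDl// ge_min lexx.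
have a0 : a < 0 by rewrite /a ltrBlDr (@le_lt_trans _ _ 0)// ?ltrDl// ge_min lexx orbT.
pose I (y : R) : R := (\int[mu]_(s in `[a, y]) k s)%R.
have : is_derive z (1 : R) (fun y : R => I y - I 0) (k z).
  have zz1 : z < z + 1 by rewrite ltrDl.
  have [d e] : derivable I z 1 /\ derive1 I z = k z :=
    continuous_FTC1_closed zz1 (itv_integrable a (z + 1) kc) az (kc z).
  have dI : is_derive z (1 : R) I (k z) by rewrite -e derive1E; exact: DeriveDef.
  apply: (is_derive_eq (@is_derive1B _ I (fun=> I 0) z _ _ dI (is_derive_cst _ _ _))).
  by rewrite subr0.
apply: near_eq_is_derive; near=> y; apply/esym/primE => //.
by near: y; exact: lt_nbhsr az.
Unshelve. all: by end_near. Qed.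

End Primitive.

Section Clamp.
Context {R : realType} (h : R).
Hypothesis h0 : 0 < h.
Implicit Types g : R -> R.

(** Composition with [clamp] extends a function continuous on [[0, h]] to a continuous function on
    the line, constant on each side. *)
Definition clamp (z : R) : R := Num.min h (Num.max 0 z).

Lemma clamp_id z : 0 <= z <= h -> clamp z = z.
Proof. by case/andP=> z0 zh; rewrite /clamp max_r// min_r. Qed.

Lemma clamp_itv z : 0 <= clamp z <= h.
Proof. by rewrite /clamp le_min ge_min lexx (ltW h0) le_max lexx. Qed.

Lemma clamp_rev z : clamp (h - z) = h - clamp z.
Proof. move: h0 => ?; rewrite /clamp !minElt !maxElt; case: (ltP 0 (h - z)) => ?; case: (ltP 0 z) => ?; do !case: ltP => ?; lra. Qed.

Lemma clamp_continuous : continuous clamp.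
Proof.
move=> z.
have c1 : {for z, continuous (fun y : R => Num.max 0 y)}.
  by apply: (@continuous_max R R (fun=> 0) (fun y => y)) => //; exact: cvg_cst.
have := @continuous_min R R (fun=> h) (fun y => Num.max 0 y) z.
by apply => //; exact: cvg_cst.
Qed.

Lemma cont_on_clamp g : cont_on h g -> continuous (g \o clamp).
Proof.
move=> gc z.
have /subspace_continuousP H := gc.
have zI : `[0, h]%classic (clamp z) by apply/in_cc; exact: clamp_itv.
have := H _ zI => /cvgrPdist_lt He; apply/cvgrPdist_lt => e e0.
have := He _ e0; rewrite near_withinE => Hn.
have Hc : \forall y \near z, `[0, h]%classic (clamp y) ->
    `|g (clamp z) - g (clamp y)| < e by exact: (clamp_continuous Hn).
apply: filterS Hc => y; apply; apply/in_cc; exact: clamp_itv.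
Qed.

End Clamp.

(** * The Green operator of y'' + q^2 y *)

Section Green.
Context {R : realType} (h q : R).
Hypotheses (h0 : 0 < h) (q0 : 0 < q).
Hypotheses (sin_qh : sin (q * h) = 0) (cos_qh : cos (q * h) = 1).
Implicit Types (f g F G : R -> R) (z : R).

Local Notation S z := (sin (q * z)).
Local Notation C z := (cos (q * z)).

Lemma sinq_rev z : S (h - z) = - S z.
Proof. by rewrite mulrBr sinB sin_qh cos_qh mul0r mul1r sub0r. Qed.

Lemma cosq_rev z : C (h - z) = C z.
Proof. by rewrite mulrBr cosB sin_qh cos_qh mul0r mul1r addr0. Qed.

Lemma sinq_norm z : `|S z| <= 1.
Proof. by rewrite ler_norml sin_geN1 sin_le1. Qed.

Lemma cosq_norm z : `|C z| <= 1.
Proof. by rewrite ler_norml cos_geN1 cos_le1. Qed.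

Lemma sinq_cont_on : cont_on h (fun z => S z).
Proof. by apply/continuous_cont_on/derive_continuous => z; exact: is_derive1_sin. Qed.

Lemma cosq_cont_on : cont_on h (fun z => C z).
Proof. by apply/continuous_cont_on/derive_continuous => z; exact: is_derive1_cos. Qed.

Lemma sin_cos_pyth z : C z ^+ 2 = 1 - S z ^+ 2.
Proof. by have := cos2Dsin2 (q * z) => <-; rewrite addrK. Qed.

Lemma integ_sin_cos : integ h (fun z => S z * C z) = 0.
Proof.
have d : deriv_of (fun z => (2 * q)^-1 * (S z * S z)) (fun z => S z * C z).
  move=> z; apply: (is_derive_eq (is_derive1Z _ (is_derive1M
    (is_derive1_sin q z) (is_derive1_sin q z)))).
  by field; rewrite gt_eqF.
rewrite (integ_derive h0 d); first by rewrite sin_qh !mulr0 sin0; ring.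
by apply: cont_onM; [exact: sinq_cont_on|exact: cosq_cont_on].
Qed.

Lemma integ_sin2 : integ h (fun z => S z ^+ 2) = h / 2.
Proof.
have d : deriv_of (fun z => 2^-1 * (z - q^-1 * (S z * C z))) (fun z => S z ^+ 2).
  move=> z; apply: (is_derive_eq (is_derive1Z _ (is_derive1B (is_derive_id z 1)
    (is_derive1Z _ (is_derive1M (is_derive1_sin q z) (is_derive1_cos q z)))))).
  have := sin_cos_pyth z; rewrite !expr2 => e.
  transitivity (2^-1 * (1 - (C z * C z - S z * S z))).
    by field; rewrite gt_eqF.
  by rewrite e; field.
rewrite (integ_derive h0 d); last by apply: cont_onX; exact: sinq_cont_on.
by rewrite sin_qh !mulr0 sin0; field; rewrite gt_eqF.
Qed.

Lemma integ_cos2 : integ h (fun z => C z ^+ 2) = h / 2.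
Proof.
transitivity (integ h (fun z => 1 - S z ^+ 2)).
  by apply: eq_integ => z _; rewrite sin_cos_pyth.
rewrite integB ?integ_sin2 ?integ_cst//; first by field.
  exact/cont_on_integrable/cst_cont_on.
by apply/cont_on_integrable/cont_onX; exact: sinq_cont_on.
Qed.

Definition orth g :=
  integ h (fun z => g z * S z) = 0 /\ integ h (fun z => g z * C z) = 0.

Definition primC g := prim (fun s => C s * g (clamp h s)).
Definition primS g := prim (fun s => S s * g (clamp h s)).

(** Variation of constants: the solution with zero value and zero derivative at 0, for the clamped
    right-hand side. *)
Definition green0 g z := q^-1 * (S z * primC g z - C z * primS g z).
Definition dgreen0 g z := C z * primC g z + S z * primS g z.

(** The factor is the inverse of the integral [h / 2] of the squared sine, so this is the Fourier
    coefficient. *)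
Definition coefS g := 2 / h * integ h (fun z => g z * S z).
Definition coefC g := 2 / h * integ h (fun z => g z * C z).

(* The solution of y'' + q^2 y = g orthogonal to sin (q z) and cos (q z),
   periodic when g is orthogonal to them. *)
Definition green g z :=
  green0 g z - coefS (green0 g) * S z - coefC (green0 g) * C z.
Definition dgreen g z :=
  dgreen0 g z - coefS (green0 g) * (q * C z) + coefC (green0 g) * (q * S z).

Lemma primC_derive g : cont_on h g ->
  deriv_of (primC g) (fun z => C z * g (clamp h z)).
Proof.
move=> gc; apply: prim_derive => z.
apply: cvgM; last exact: (cont_on_clamp h0 gc).
by apply: derive_continuous => {}z; exact: is_derive1_cos.
Qed.

Lemma primS_derive g : cont_on h g ->
  deriv_of (primS g) (fun z => S z * g (clamp h z)).
Proof.
move=> gc; apply: prim_derive => z.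
apply: cvgM; last exact: (cont_on_clamp h0 gc).
by apply: derive_continuous => {}z; exact: is_derive1_sin.
Qed.

Lemma green0_derive g : cont_on h g -> deriv_of (green0 g) (dgreen0 g).
Proof.
move=> gc z; apply: (is_derive_eq (is_derive1Z q^-1 (is_derive1B
  (is_derive1M (is_derive1_sin q z) (primC_derive gc z))
  (is_derive1M (is_derive1_cos q z) (primS_derive gc z))))).
by rewrite /dgreen0; field; rewrite gt_eqF.
Qed.

Lemma dgreen0_derive g : cont_on h g ->
  deriv_of (dgreen0 g) (fun z => g (clamp h z) - q ^+ 2 * green0 g z).
Proof.
move=> gc z; apply: (is_derive_eq (is_derive1D
  (is_derive1M (is_derive1_cos q z) (primC_derive gc z))
  (is_derive1M (is_derive1_sin q z) (primS_derive gc z)))).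
rewrite /green0 -[g (clamp h z) in RHS]mul1r -(cos2Dsin2 (q * z)).
by field; rewrite gt_eqF.
Qed.

Lemma green_derive g : cont_on h g -> deriv_of (green g) (dgreen g).
Proof.
move=> gc z; apply: (is_derive_eq (is_derive1B
  (is_derive1B (green0_derive gc z) (is_derive1Z _ (is_derive1_sin q z)))
  (is_derive1Z _ (is_derive1_cos q z)))).
by rewrite /dgreen; ring.
Qed.

Lemma dgreen_derive g : cont_on h g ->
  deriv_of (dgreen g) (fun z => g (clamp h z) - q ^+ 2 * green g z).
Proof.
move=> gc z; apply: (is_derive_eq (is_derive1D
  (is_derive1B (dgreen0_derive gc z)
    (is_derive1Z _ (is_derive1Z _ (is_derive1_cos q z))))
  (is_derive1Z _ (is_derive1Z _ (is_derive1_sin q z))))).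
by rewrite /green; ring.
Qed.

Lemma green_cont_on g : cont_on h g -> cont_on h (green g).
Proof. by move=> /green_derive/derive_continuous/continuous_cont_on. Qed.

Lemma primC_h g : cont_on h g -> primC g h = integ h (fun z => g z * C z).
Proof.
move=> gc; have e : forall z, 0 <= z <= h -> C z * g z = C z * g (clamp h z).
  by move=> z zI; rewrite clamp_id.
transitivity (integ h (fun z => C z * g (clamp h z))); last first.
  apply: eq_integ => z /andP[z1 z2]; rewrite clamp_id; first exact: mulrC.
  by rewrite !ltW.
rewrite (integ_derive h0 (primC_derive gc)); first by rewrite /primC prim0 subr0.
by apply: (eq_cont_on e); apply: cont_onM => //; exact: cosq_cont_on.
Qed.

Lemma primS_h g : cont_on h g -> primS g h = integ h (fun z => g z * S z).
Proof.
move=> gc; have e : forall z, 0 <= z <= h -> S z * g z = S z * g (clamp h z).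
  by move=> z zI; rewrite clamp_id.
transitivity (integ h (fun z => S z * g (clamp h z))); last first.
  apply: eq_integ => z /andP[z1 z2]; rewrite clamp_id; first exact: mulrC.
  by rewrite !ltW.
rewrite (integ_derive h0 (primS_derive gc)); first by rewrite /primS prim0 subr0.
by apply: (eq_cont_on e); apply: cont_onM => //; exact: sinq_cont_on.
Qed.

(** At [h] the two primitives are the integrals of [g] against cosine and sine, which vanish by
    orthogonality, as the primitives do at 0. *)
Lemma green_per g : cont_on h g -> orth g -> green g 0 = green g h.
Proof.
move=> gc [gs gk]; rewrite /green; move: (coefS _) (coefC _) => a b.
rewrite /green0 sin_qh cos_qh primS_h// gs primC_h// gk.
by rewrite !mulr0 sin0 cos0 /primC /primS !prim0; ring.
Qed.

Lemma dgreen_per g : cont_on h g -> orth g -> dgreen g 0 = dgreen g h.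
Proof.
move=> gc [gs gk]; rewrite /dgreen; move: (coefS _) (coefC _) => a b.
rewrite /dgreen0 sin_qh cos_qh primS_h// gs primC_h// gk.
by rewrite !mulr0 sin0 cos0 /primC /primS !prim0; ring.
Qed.

Lemma orth_proj g : cont_on h g ->
  orth (fun z => g z - coefS g * S z - coefC g * C z).
Proof.
move=> gc; have h00 := lt0r_neq0 h0.
have sc := sinq_cont_on; have kc := cosq_cont_on.
split.
- transitivity (integ h (fun z =>
      (g z * S z - coefS g * S z ^+ 2) - coefC g * (S z * C z))).
    by apply: eq_integ => z _; ring.
  rewrite !integB ?integZ ?integ_sin2 ?integ_sin_cos; try by int_tac.
  by rewrite /coefS; field.
- transitivity (integ h (fun z =>
      (g z * C z - coefS g * (S z * C z)) - coefC g * C z ^+ 2)).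
    by apply: eq_integ => z _; ring.
  rewrite !integB ?integZ ?integ_cos2 ?integ_sin_cos; try by int_tac.
  by rewrite /coefC; field.
Qed.

Lemma green_orth g : cont_on h g -> orth (green g).
Proof.
move=> gc; have c0 : cont_on h (green0 g).
  exact/continuous_cont_on/derive_continuous/green0_derive.
exact: (orth_proj c0).
Qed.

Lemma green0_cont_on g : cont_on h g -> cont_on h (green0 g).
Proof. by move=> gc; exact/continuous_cont_on/derive_continuous/green0_derive. Qed.

Lemma norm_coef (k : R -> R) g B : cont_on h k -> cont_on h g ->
  (forall z, `|k z| <= 1) -> (forall z, 0 <= z <= h -> `|g z| <= B) ->
  `|2 / h * integ h (fun z => g z * k z)| <= 2 * B.
Proof.
move=> kc gc k1 gB; rewrite normrM gtr0_norm ?divr_gt0//.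
have : `|integ h (fun z => g z * k z)| <= B * h.
  apply: norm_integ_le => //; first by int_tac.
  move=> z /andP[z1 z2]; rewrite normrM -[B]mulr1 ler_pM// gB// !ltW//.
move=> H; apply: (@le_trans _ _ (2 / h * (B * h))).
  by rewrite ler_wpM2l ?divr_ge0// ltW.
suff -> : 2 / h * (B * h) = 2 * B by [].
by field; rewrite gt_eqF.
Qed.

Lemma norm_prim g (k : R -> R) B z : cont_on h g ->
  deriv_of (prim (fun s => k s * g (clamp h s))) (fun s => k s * g (clamp h s)) ->
  (forall z, `|k z| <= 1) -> (forall z, 0 <= z <= h -> `|g z| <= B) ->
  0 <= z <= h -> `|prim (fun s => k s * g (clamp h s)) z| <= h * B.
Proof.
move=> gc d k1 gB /andP[z0 zh].
have B0 : 0 <= B by rewrite (le_trans (normr_ge0 (g 0)))// gB// lexx ltW.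
have /(_ B) := derive_norm_le d z0; rewrite prim0 !subr0 => H.
apply: (@le_trans _ _ (B * z)); last by rewrite mulrC ler_wpM2r.
apply: H => s _; rewrite normrM -[B]mul1r ler_pM// gB//; exact: clamp_itv.
Qed.

Section Bounds.
Variables (g : R -> R) (B : R).
Hypotheses (gc : cont_on h g) (gB : forall z, 0 <= z <= h -> `|g z| <= B).

Let pC z : 0 <= z <= h -> `|primC g z| <= h * B.
Proof. by apply: norm_prim => //; [exact: primC_derive|exact: cosq_norm]. Qed.

Let pS z : 0 <= z <= h -> `|primS g z| <= h * B.
Proof. by apply: norm_prim => //; [exact: primS_derive|exact: sinq_norm]. Qed.

Let norm_le1 (a b M : R) : `|a| <= 1 -> `|b| <= M -> `|a * b| <= M.
Proof. by move=> a1 bM; rewrite normrM -[M]mul1r ler_pM. Qed.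

Let g0B z : 0 <= z <= h -> `|green0 g z| <= q^-1 * (2 * h * B).
Proof.
move=> zI; rewrite normrM gtr0_norm ?invr_gt0// ler_pM2l ?invr_gt0//.
apply: le_trans (ler_normB _ _) _.
have := norm_le1 (sinq_norm z) (pC zI); have := norm_le1 (cosq_norm z) (pS zI).
lra.
Qed.

Let cS : `|coefS (green0 g)| <= 2 * (q^-1 * (2 * h * B)).
Proof.
apply: norm_coef => //; [exact: sinq_cont_on|exact: green0_cont_on|].
exact: sinq_norm.
Qed.

Let cC : `|coefC (green0 g)| <= 2 * (q^-1 * (2 * h * B)).
Proof.
apply: norm_coef => //; [exact: cosq_cont_on|exact: green0_cont_on|].
exact: cosq_norm.
Qed.

(** The variation of constants formula is at most [2 * h * B / q] and each of the two coefficients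
    at most twice that, hence a factor 5 and the constant 10. For [dgreen] the same count reads
    [2 + 4 + 4]. *)
Lemma green_bound z : 0 <= z <= h -> `|green g z| <= 10 * h / q * B.
Proof.
move=> zI; have e : 10 * h / q * B = 5 * (q^-1 * (2 * h * B)) by ring.
rewrite e; apply: le_trans (ler_normB _ _) _.
have := ler_normB (green0 g z) (coefS (green0 g) * S z).
have := norm_le1 (sinq_norm z) cS; have := norm_le1 (cosq_norm z) cC.
have := g0B zI; rewrite ![_ * coefS _]mulrC ![_ * coefC _]mulrC; lra.
Qed.

Lemma dgreen_bound z : 0 <= z <= h -> `|dgreen g z| <= 10 * h * B.
Proof.
move=> zI; rewrite /dgreen.
have e0 : 2 * (q^-1 * (2 * h * B)) = q^-1 * (4 * h * B) by ring.
have qc (c s : R) : `|s| <= 1 -> `|c| <= 2 * (q^-1 * (2 * h * B)) ->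
    `|c * (q * s)| <= 4 * h * B.
  move=> s1 cB; rewrite mulrA mulrC; apply: norm_le1 => //.
  rewrite normrM (gtr0_norm q0) -ler_pdivlMr// mulrC; lra.
have d0 : `|dgreen0 g z| <= 2 * h * B.
  apply: le_trans (ler_normD _ _) _.
  have := norm_le1 (cosq_norm z) (pC zI); have := norm_le1 (sinq_norm z) (pS zI).
  lra.
apply: le_trans (ler_normD _ _) _.
have := ler_normB (dgreen0 g z) (coefS (green0 g) * (q * C z)).
have := qc _ _ (sinq_norm z) cC; have := qc _ _ (cosq_norm z) cS; lra.
Qed.

End Bounds.

Lemma integ_linear (k f g : R -> R) c : cont_on h k -> cont_on h f -> cont_on h g ->
  integ h (fun z => (f z + c * g z) * k z) =
  integ h (fun z => f z * k z) + c * integ h (fun z => g z * k z).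
Proof.
move=> kc fc gc.
transitivity (integ h (fun z => f z * k z + c * (g z * k z))).
  by apply: eq_integ => z _; ring.
by rewrite integD ?integZ//; int_tac.
Qed.

(** Equality on the whole line follows from equality on [[0, h]] since [green] reads its argument
    through [clamp]. *)
Lemma eq_green f g : (forall z, 0 <= z <= h -> f z = g z) -> green f = green g.
Proof.
move=> fg; have e k : (fun s : R => k s * f (clamp h s)) =
    (fun s => k s * g (clamp h s)) :> (R -> R).
  by apply/funext => s; rewrite fg// clamp_itv.
have e0 : green0 f = green0 g.
  by rewrite /green0 /primC /primS; under eq_fun do rewrite !e.
by rewrite /green e0.
Qed.

(** Both sides are primitives of the same continuous function and vanish at 0. *)
Lemma prim_linear (k f g : R -> R) c z :
  continuous (fun s => k s * f (clamp h s)) ->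
  continuous (fun s => k s * g (clamp h s)) ->
  prim (fun s => k s * (f (clamp h s) + c * g (clamp h s))) z =
  prim (fun s => k s * f (clamp h s)) z + c * prim (fun s => k s * g (clamp h s)) z.
Proof.
move=> fc gc.
have d (s : R) : is_derive s (1 : R) (fun s => prim (fun s => k s * f (clamp h s)) s +
    c * prim (fun s => k s * g (clamp h s)) s)
    (k s * (f (clamp h s) + c * g (clamp h s))).
  apply: (is_derive_eq (is_derive1D (prim_derive fc s)
    (is_derive1Z c (prim_derive gc s)))); ring.
have kc : continuous (fun s => k s * (f (clamp h s) + c * g (clamp h s))).
  move=> s; have -> : (fun s => k s * (f (clamp h s) + c * g (clamp h s))) =
    (fun s => k s * f (clamp h s) + c * (k s * g (clamp h s))).
    by apply/funext => x; ring.
  apply: cvgD; first exact: fc.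
  by apply: cvgM; [exact: cvg_cst|exact: gc].
have := derive_eq (prim_derive kc) d z 0.
by rewrite !prim0 mulr0 addr0 subrr => /eqP; rewrite subr_eq0 => /eqP.
Qed.

Lemma green_linear f g c z : cont_on h f -> cont_on h g ->
  green (fun z => f z + c * g z) z = green f z + c * green g z.
Proof.
move=> fc gc.
have kS u : cont_on h u -> continuous (fun s => S s * u (clamp h s)).
  move=> uc s; apply: cvgM; last exact: (cont_on_clamp h0 uc).
  by apply: derive_continuous => {}s; exact: is_derive1_sin.
have kC u : cont_on h u -> continuous (fun s => C s * u (clamp h s)).
  move=> uc s; apply: cvgM; last exact: (cont_on_clamp h0 uc).
  by apply: derive_continuous => {}s; exact: is_derive1_cos.
have e0 x : green0 (fun z => f z + c * g z) x = green0 f x + c * green0 g x.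
  rewrite /green0 /primC /primS !prim_linear//; try by [exact: kS|exact: kC].
  by ring.
rewrite /green e0 (_ : green0 (fun z => f z + c * g z) =
  fun x => green0 f x + c * green0 g x); last exact/funext.
have [f0 g0] := (green0_cont_on fc, green0_cont_on gc).
rewrite /coefS /coefC !integ_linear//; try exact: sinq_cont_on; try exact: cosq_cont_on.
by move: (integ _ _) (integ _ _) (integ _ _) (integ _ _) => ? ? ? ?; ring.
Qed.

Definition odd_on g := forall z, 0 <= z <= h -> g (h - z) = - g z.

(** For the primitive P of an odd function, [P (h - z)] and [P z] have the same derivative, so their
    difference is constant; it is 0 at [h / 2] and [P h] at 0. *)
Lemma integ_odd g : cont_on h g -> odd_on g -> integ h g = 0.
Proof.
move=> gc go; have gC := cont_on_clamp h0 gc.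
have d := prim_derive gC.
have e : integ h g = prim (g \o clamp h) h.
  transitivity (integ h (g \o clamp h)).
    by apply: eq_integ => z /andP[z1 z2] /=; rewrite clamp_id// !ltW.
  rewrite (integ_derive h0 d) ?prim0 ?subr0//; exact: continuous_cont_on.
have d' : deriv_of (fun z => prim (g \o clamp h) (h - z)) (g \o clamp h).
  move=> z; apply: (is_derive_eq (is_derive1_rev h d z)) => /=.
  by rewrite clamp_rev// go ?opprK// clamp_itv.
have := derive_eq d' d 0 (h / 2).
rewrite (_ : h - h / 2 = h / 2); last by field.
by rewrite subr0 prim0 subr0 subrr -e.
Qed.

Lemma odd_cos g : cont_on h g -> odd_on g -> integ h (fun z => g z * C z) = 0.
Proof.
move=> gc go; apply: integ_odd; first by apply: cont_onM => //; exact: cosq_cont_on.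
by move=> z zI; rewrite go// cosq_rev mulNr.
Qed.

(** About [h / 2] the primitive [primC g] is even and [primS g] odd: reflection preserves the
    derivatives up to the right sign, and orthogonality of [g] fixes the constants of
    integration. *)
Lemma green_odd g : cont_on h g -> odd_on g -> orth g ->
  forall z, green g (h - z) = - green g z.
Proof.
move=> gc go [gS gC].
have eC z : primC g (h - z) = primC g z.
  have d' : deriv_of (fun z => primC g (h - z)) (fun z => C z * g (clamp h z)).
    move=> x; apply: (is_derive_eq (is_derive1_rev h (primC_derive gc) x)) => /=.
    by rewrite clamp_rev// go ?clamp_itv// cosq_rev; ring.
  have := derive_eq d' (primC_derive gc) z 0.
  by rewrite subr0 primC_h// gC /primC prim0 subrr => /eqP; rewrite subr_eq0 => /eqP.
have eS z : primS g (h - z) = - primS g z.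
  have d' : deriv_of (fun z => -1 * primS g (h - z)) (fun z => S z * g (clamp h z)).
    move=> x; apply: (is_derive_eq (is_derive1Z _ (is_derive1_rev h (primS_derive gc) x))).
    by rewrite /= clamp_rev// go ?clamp_itv// sinq_rev; ring.
  have := derive_eq d' (primS_derive gc) z 0.
  rewrite subr0 primS_h// gS /primS prim0; lra.
have e0 z : green0 g (h - z) = - green0 g z.
  by rewrite /green0 eC eS sinq_rev cosq_rev; ring.
move=> z; rewrite /green e0.
suff -> : coefC (green0 g) = 0 by rewrite sinq_rev; ring.
rewrite /coefC odd_cos ?mulr0//; exact: green0_cont_on.
Qed.

End Green.

#[global] Opaque green dgreen.

(** * Square-integrable functions *)

Section SquareIntegrable.
Context {R : realType} (h : R).
Hypothesis h0 : 0 < h.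
Implicit Types f g F G : R -> R.
Local Notation mu := (@lebesgue_measure R).

Lemma L2_measurable f : L2 h f -> measurable_fun (`]0, h[ : set R) f.
Proof. by case. Qed.

Lemma L2_sqr f : L2 h f -> integrable_on h (fun z => f z ^+ 2).
Proof. by case. Qed.

Lemma L2M f g : L2 h f -> L2 h g -> integrable_on h (fun z => f z * g z).
Proof.
move=> [mf fi] [mg gi].
apply: (@le_integrable_on _ h _ (fun z => f z ^+ 2 + g z ^+ 2)); last first.
- exact: integrableD_on.
- move=> z _; rewrite normrM -(real_normK (num_real (f z))).
  rewrite -(real_normK (num_real (g z))).
  have := sqr_ge0 (`|f z| - `|g z|); have := sqr_ge0 (`|f z| + `|g z|); nra.
- exact: measurable_funM.
Qed.

Lemma cont_on_L2 f : cont_on h f -> L2 h f.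
Proof.
move=> fc; split; last by apply: cont_on_integrable; exact: cont_onX.
by apply: integrable_measurable_on; exact: cont_on_integrable.
Qed.

Lemma L2_integrable f : L2 h f -> integrable_on h f.
Proof.
move=> fL; have := L2M fL (cont_on_L2 (@cst_cont_on _ h 1)).
by apply: eq_integrable_on => z _; rewrite mulr1.
Qed.

Lemma L2_cont f g : L2 h f -> cont_on h g -> L2 h (fun z => f z * g z).
Proof.
move=> fL gc; have gL := cont_on_L2 gc.
split; first by apply: measurable_funM; [case: fL|case: gL].
have [B [B0 gB]] := cont_on_bounded gc.
apply: (@le_integrable_on _ h _ (fun z => B ^+ 2 * f z ^+ 2)).
- apply: (@measurable_funX _ _ R _ (fun z => f z * g z) 2).
  by apply: measurable_funM; [case: fL|case: gL].
- move=> z /andP[z1 z2]; rewrite ger0_norm ?sqr_ge0// exprMn mulrC.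
  rewrite ler_wpM2r ?sqr_ge0// -(real_normK (num_real (g z))).
  by rewrite ler_pXn2r ?nnegrE// gB// !ltW.
- exact/integrableZ_on/L2_sqr.
Qed.

Lemma L2Z c f : L2 h f -> L2 h (fun z => c * f z).
Proof.
move=> fL; have [m i] := L2_cont fL (@cst_cont_on _ h c).
have e : (fun z => f z * c) = (fun z => c * f z).
  by apply/funext => z; rewrite mulrC.
by rewrite -e; split.
Qed.

Lemma L2D f g : L2 h f -> L2 h g -> L2 h (fun z => f z + g z).
Proof.
move=> fL gL; split; first by apply: measurable_funD; [case: fL|case: gL].
have : integrable_on h (fun z => (f z ^+ 2 + g z ^+ 2) + 2 * (f z * g z)).
  apply: integrableD_on; last exact/integrableZ_on/L2M.
  by apply: integrableD_on; exact: L2_sqr.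
by apply: eq_integrable_on => z _ /=; ring.
Qed.

(** The variance of [|g|] on the interval is nonnegative. *)
Lemma integ_cauchy_schwarz g : L2 h g ->
  integ h (fun z => `|g z|) ^+ 2 <= h * integ h (fun z => g z ^+ 2).
Proof.
move=> gL; set I := integ h (fun z => `|g z|); set J := integ h (fun z => g z ^+ 2).
have gi := integrable_norm_on (L2_integrable gL).
have : 0 <= integ h (fun z => (`|g z| - I / h) ^+ 2).
  by apply: integ_ge0 => z _; exact: sqr_ge0.
have -> : integ h (fun z => (`|g z| - I / h) ^+ 2) = J - I ^+ 2 / h.
  transitivity (integ h (fun z => (g z ^+ 2 + (- 2 * (I / h)) * `|g z|)
     + (I / h) ^+ 2)).
    apply: eq_integ => z _; rewrite -[in RHS](real_normK (num_real (g z))); ring.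
  rewrite !integD ?integZ ?integ_cst -/I -/J//; first by field; rewrite gt_eqF.
  all: try first [exact: L2_sqr | exact: integrableZ_on | by int_tac
    | by apply: integrableD_on; [exact: L2_sqr|exact: integrableZ_on]].
by rewrite subr_ge0 ler_pdivrMr// mulrC.
Qed.

(** The length of the support replaces [h] in the bound, which makes the estimates below uniform in
    the scale of the mollifier. *)
Lemma integ_support f M a b : integrable_on h f -> 0 <= M -> a <= b ->
  (forall z, 0 < z < h -> `|f z| <= M) ->
  (forall z, 0 < z < h -> ~~ (a <= z <= b) -> f z = 0) ->
  `|integ h f| <= M * (b - a).
Proof.
move=> fi M0 ab fM f0; rewrite /integ.
have mI : measurable (`]0, h[ : set (measurableTypeR R)) by exact: measurable_itv.
have mJ : measurable (`[a, b] : set (measurableTypeR R)) by exact: measurable_itv.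
have mIJ := measurableI _ _ mI mJ.
have -> : (\int[mu]_(z in `]0%R, h[) f z = \int[mu]_(z in `]0%R, h[ `&` `[a, b]) f z)%R.
  rewrite Rintegral_mkcondr; apply: eq_Rintegral => z.
  rewrite inE => /in_oo zI; rewrite patchE; case: ifPn => // zab.
  by apply: f0 => //; apply: contra zab => zab1; rewrite inE /= in_itv.
have fi' : mu.-integrable (`]0%R, h[ `&` `[a, b]) (EFin \o f).
  by apply: integrableS fi => //; exact: subIsetl.
have ci : mu.-integrable `[a, b] (EFin \o (fun=> M)).
  apply: continuous_compact_integrable; first exact: segment_compact.
  by apply: continuous_subspaceT => z; exact: cvg_cst.
apply: le_trans (le_normr_Rintegral mIJ fi') _.
apply: (@le_trans _ _ (\int[mu]_(z in `]0%R, h[ `&` `[a, b]) M)%R).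
  apply: le_Rintegral => //; first by have := integrable_norm fi'.
    by apply: integrableS ci => //; exact: subIsetr.
  by move=> x [/in_oo xI _]; exact: fM.
have eJ : mu `[a, b] = (b - a)%:E.
  have := @lebesgue_measure_itv R `[a, b]; rewrite /= lte_fin => ->.
  by case: ltP => // ba; rewrite (le_anti (introT andP (conj ab ba))) subrr.
have leJ : (mu (`]0%R, h[ `&` `[a, b]) <= (b - a)%:E)%E.
  by rewrite -eJ; apply: le_measure; rewrite ?inE//; exact: subIsetr.
rewrite Rintegral_cst// ler_wpM2l// -lee_fin fineK//.
by rewrite ge0_fin_numE// (le_lt_trans leJ)// ltry.
Qed.

End SquareIntegrable.

(** * Test functions *)

Section EpsilonDelta.
Context {R : realType}.
Implicit Types (F G : R -> R) (z l e d : R).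

(** Clearing the denominator gives an estimate that holds at [y = z] too and can be integrated
    directly. *)
Lemma cvg_quotientP (A : set R) F z l :
  ((y - z)^-1 * (F y - F z) @[y --> within A z^'] --> l) <->
  (forall e, 0 < e -> exists d, 0 < d /\ forall y, A y -> `|y - z| < d ->
    `|F y - F z - l * (y - z)| <= e * `|y - z|).
Proof.
have eq y : y != z -> `|l - (y - z)^-1 * (F y - F z)| =
    `|F y - F z - l * (y - z)| / `|y - z|.
  move=> yz; have yz0 : y - z != 0 by rewrite subr_eq0.
  rewrite -normrV ?unitfE// -normrM -normrN; congr (`| _ |); field => //.
split.
- move=> /cvgrPdist_le H e e0; have := H e e0.
  rewrite !near_withinE => /nbhs_ballP[d /= d0 dH].
  exists d; split => // y Ay yd.
  have [->|yz] := eqVneq y z; first by rewrite !subrr !mulr0 subrr normr0 mulr0.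
  have := dH y; rewrite /ball/= distrC => /(_ yd yz Ay); rewrite eq//.
  by rewrite ler_pdivrMr// normr_gt0 subr_eq0.
- move=> H; apply/cvgrPdist_le => e e0; have [d [d0 dH]] := H e e0.
  rewrite !near_withinE; apply/nbhs_ballP; exists d => //= y.
  rewrite /ball/= distrC => yd yz Ay; rewrite eq// ler_pdivrMr ?normr_gt0 ?subr_eq0//.
  exact: dH.
Qed.

Lemma is_deriveP F z l : is_derive z (1 : R) F l <->
  (forall e, 0 < e -> exists d, 0 < d /\ forall y, `|y - z| < d ->
    `|F y - F z - l * (y - z)| <= e * `|y - z|).
Proof.
have eq y : y != 0 -> `|l - y^-1 *: (F (y *: (1 : R) + z) - F z)| =
    `|F (y + z) - F z - l * y| / `|y|.
  move=> y0; rewrite /GRing.scale/= mulr1.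
  rewrite -normrV ?unitfE// -normrM -normrN; congr (`| _ |); field => //.
split.
- move=> Fl e e0.
  have : y^-1 *: (F (y *: (1 : R) + z) - F z) @[y --> 0^'] --> l.
    by rewrite -[l](@derive_val _ _ _ _ _ _ _ Fl); exact: (@ex_derive _ _ _ _ _ _ _ Fl).
  move=> /cvgrPdist_le /(_ e e0).
  rewrite near_withinE => /nbhs_ballP[d /= d0 dH].
  exists d; split => // y yd.
  have [->|yz] := eqVneq y z; first by rewrite !subrr !mulr0 subrr normr0 mulr0.
  have yz0 : y - z != 0 by rewrite subr_eq0.
  have := dH (y - z); rewrite /ball/= sub0r normrN => /(_ yd yz0).
  by rewrite eq// ler_pdivrMr ?normr_gt0// subrK.
- move=> H; have c : y^-1 *: (F (y *: (1 : R) + z) - F z) @[y --> 0^'] --> l.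
    apply/cvgrPdist_le => e e0; have [d [d0 dH]] := H e e0.
    rewrite near_withinE; apply/nbhs_ballP; exists d => //= y.
    rewrite /ball/= sub0r normrN => yd y0; rewrite eq// ler_pdivrMr ?normr_gt0//.
    by have := dH (y + z); rewrite addrK; exact.
  apply: DeriveDef; first by apply/cvg_ex; exists l.
  exact: cvg_lim.
Qed.

Lemma is_derive_has_deriv h F z l : is_derive z (1 : R) F l -> has_deriv h F z l.
Proof.
move=> /is_deriveP H; apply/cvg_quotientP => e /H[d [d0 dH]].
by exists d; split => // y _; exact: dH.
Qed.

Lemma has_deriv_eq h F G z l : 0 <= z <= h -> (forall y, 0 <= y <= h -> F y = G y) ->
  has_deriv h F z l -> has_deriv h G z l.
Proof.
move=> zI FG /cvg_quotientP H; apply/cvg_quotientP => e /H[d [d0 dH]].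
exists d; split => // y yI; have /in_cc yI' := yI.
by rewrite -(FG y yI') -(FG z zI); exact: dH.
Qed.

Lemma has_derivM h F G z a b : has_deriv h F z a -> has_deriv h G z b ->
  has_deriv h (fun z => F z * G z) z (a * G z + F z * b).
Proof.
rewrite /has_deriv => Fa Gb.
(* Exact expansion into difference quotients at the point [z]: the cross term carries a factor
   [y - z], so the continuity of [F] and [G] does not have to be derived first. *)
have -> : (fun y => (y - z)^-1 * (F y * G y - F z * G z)) =
    (fun y => (y - z)^-1 * (F y - F z) * G z + F z * ((y - z)^-1 * (G y - G z))
      + (y - z) * (((y - z)^-1 * (F y - F z)) * ((y - z)^-1 * (G y - G z)))).
  apply/funext => y; have [->|yz] := eqVneq y z.
    by rewrite !subrr invr0 !mul0r mulr0 !addr0.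
  by field; rewrite subr_eq0.
have c0 : y - z @[y --> within `[0, h] z^'] --> (0 : R).
  apply/cvgrPdist_le => e e0; rewrite !near_withinE; apply/nbhs_ballP.
  by exists e => //= y; rewrite /ball/= sub0r normrN distrC => /ltW.
rewrite -[X in _ --> X]addr0; apply: cvgD; last first.
  by have := cvgM c0 (cvgM Fa Gb); rewrite mul0r; exact.
apply: cvgD; first by exact: (cvgM Fa (cvg_cst (G z))).
exact: (cvgM (cvg_cst (F z)) Gb).
Qed.

End EpsilonDelta.

(** * Spline transition functions *)

Section Spline.
Context {R : realType}.
Implicit Types (x z c e : R).

Definition pos_part x : R := Num.max 0 x.

Lemma pos_part_le0 x : x <= 0 -> pos_part x = 0.
Proof. by move=> x0; rewrite /pos_part max_l. Qed.

Lemma pos_part_ge0 x : 0 <= x -> pos_part x = x.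
Proof. by move=> x0; rewrite /pos_part max_r. Qed.

Lemma pos_part_sqr_derive :
  deriv_of (fun x => pos_part x ^+ 2) (fun x => 2 * pos_part x).
Proof.
(* The remainder is at most [(y - z) ^+ 2] whatever the signs of [y] and [z], so the tolerance
   itself serves as radius. *)
move=> z; apply/is_deriveP => e e0; exists e; split => // y yz.
apply: (@le_trans _ _ (`|y - z| * `|y - z|)); last by rewrite ler_wpM2r// ltW.
rewrite -normrM; have d0 := sqr_ge0 (y - z); rewrite expr2 in d0.
rewrite (ger0_norm d0) ler_norml.
have [y0|y0] := leP y 0; have [z0|z0] := leP z 0.
all: rewrite ?(pos_part_le0 y0) ?(pos_part_le0 z0) ?(pos_part_ge0 (ltW y0))
  ?(pos_part_ge0 (ltW z0)); apply/andP; split; nra.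
Qed.

Lemma pos_part_cub_derive :
  deriv_of (fun x => pos_part x ^+ 3) (fun x => 3 * pos_part x ^+ 2).
Proof.
move=> z.
have -> : (fun x => pos_part x ^+ 3) = (fun x => x * pos_part x ^+ 2).
  apply/funext => x; have [x0|/ltW x0] := leP x 0.
    by rewrite (pos_part_le0 x0); ring.
  by rewrite (pos_part_ge0 x0); ring.
apply: (is_derive_eq (is_derive1M (is_derive_id z 1) (pos_part_sqr_derive z))).
have [x0|/ltW x0] := leP z 0; first by rewrite (pos_part_le0 x0); ring.
by rewrite (pos_part_ge0 x0); ring.
Qed.

(** Third backward difference of the truncated power. Beyond 3 no truncation is active, so powers 1
    and 2 are annihilated and the cube yields 6, which the factor of [step] normalises. *)
Definition spline_gen (n : nat) x : R :=
  pos_part x ^+ n - 3 * pos_part (x - 1) ^+ n + 3 * pos_part (x - 2) ^+ n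
  - pos_part (x - 3) ^+ n.

(* C^2 transition from 0 to 1 over [0, 3]: the primitive of the quadratic
   B-spline. *)
Definition step x : R := 6^-1 * spline_gen 3 x.
Definition dstep x : R := 2^-1 * spline_gen 2 x.
Definition ddstep x : R := spline_gen 1 x.

Lemma is_derive1_shift (F f : R -> R) c : deriv_of F f ->
  deriv_of (fun x => F (x - c)) (fun x => f (x - c)).
Proof.
move=> Ff z.
have d : is_derive z (1 : R) (fun x => x - c) 1.
  by apply: (is_derive_eq (is_derive1B (is_derive_id z 1) (is_derive_cst c z 1)));
    rewrite subr0.
apply: (is_derive_eq (@is_derive1_comp _ F (fun x => x - c) _ _ _ (Ff (z - c)) d)).
by rewrite mulr1.
Qed.

Lemma spline_gen_derive n : deriv_of (fun x => pos_part x ^+ n.+1)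
    (fun x => n.+1%:R * pos_part x ^+ n) ->
  deriv_of (spline_gen n.+1) (fun x => n.+1%:R * spline_gen n x).
Proof.
move=> d z.
apply: (is_derive_eq (is_derive1B (is_derive1D (is_derive1B (d z)
  (is_derive1Z 3 (is_derive1_shift 1 d z))) (is_derive1Z 3 (is_derive1_shift 2 d z)))
  (is_derive1_shift 3 d z))).
by rewrite /spline_gen; ring.
Qed.

Lemma step_derive : deriv_of step dstep.
Proof.
move=> z; apply: (is_derive_eq (is_derive1Z 6^-1
  (spline_gen_derive pos_part_cub_derive z))).
by rewrite /dstep; field.
Qed.

Lemma dstep_derive : deriv_of dstep ddstep.
Proof.
have d : deriv_of (fun x : R => pos_part x ^+ 2) (fun x => 2 * pos_part x ^+ 1).
  by move=> z; rewrite expr1; exact: pos_part_sqr_derive.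
move=> z; apply: (is_derive_eq (is_derive1Z 2^-1 (spline_gen_derive d z))).
by rewrite /ddstep; field.
Qed.

Lemma spline_gen_continuous n : continuous (spline_gen n).
Proof.
have p c : continuous (fun x => pos_part (x - c) ^+ n).
  move=> x; apply: (@cvg_comp _ _ _ (fun x => pos_part (x - c)) (fun y => y ^+ n));
    last exact: exprn_continuous.
  apply: (@continuous_max R R (fun=> 0) (fun y => y - c)); first exact: cvg_cst.
  by apply: cvgB; [exact: cvg_id|exact: cvg_cst].
have p0 : continuous (fun x => pos_part x ^+ n).
  by have := p 0; under eq_fun do rewrite subr0.
have e : spline_gen n = fun x => pos_part x ^+ n - 3 * pos_part (x - 1) ^+ n +
  3 * pos_part (x - 2) ^+ n - pos_part (x - 3) ^+ n by [].
rewrite e => x; apply: cvgB; last exact: p.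
apply: cvgD; last by apply: cvgM; [exact: cvg_cst|exact: p].
by apply: cvgB; [exact: p0|apply: cvgM; [exact: cvg_cst|exact: p]].
Qed.

Lemma spline_gen_le0 n x : x <= 0 -> spline_gen n.+1 x = 0.
Proof.
move=> x0; rewrite /spline_gen !pos_part_le0 ?expr0n/= ?mulr0; lra.
Qed.

Lemma pos_part_ge3 x : 3 <= x -> [/\ pos_part x = x, pos_part (x - 1) = x - 1,
  pos_part (x - 2) = x - 2 & pos_part (x - 3) = x - 3].
Proof. by move=> x3; split; rewrite pos_part_ge0//; lra. Qed.

Lemma step_ge3 x : 3 <= x -> step x = 1.
Proof.
by move=> /pos_part_ge3[e0 e1 e2 e3]; rewrite /step /spline_gen e0 e1 e2 e3; field.
Qed.

Lemma dstep_ge3 x : 3 <= x -> dstep x = 0.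
Proof.
by move=> /pos_part_ge3[e0 e1 e2 e3]; rewrite /dstep /spline_gen e0 e1 e2 e3; field.
Qed.

Lemma ddstep_ge3 x : 3 <= x -> ddstep x = 0.
Proof.
by move=> /pos_part_ge3[e0 e1 e2 e3]; rewrite /ddstep /spline_gen e0 e1 e2 e3; ring.
Qed.

(** The weights 1, 3, 3, 1 add up to 8, and each truncated power is at most [3 ^+ n] there. *)
Lemma spline_gen_bound n x : (0 < n)%N -> x <= 3 -> `|spline_gen n x| <= 8 * 3 ^+ n.
Proof.
move=> n0 x3.
have p y : y <= 3 -> `|pos_part y ^+ n| <= 3 ^+ n.
  move=> y3; rewrite normrX ler_pXn2r ?nnegrE// ger0_norm ?le_max ?lexx//.
  by rewrite ge_max y3 andbT.
have p3 y : y <= 3 -> `|3 * pos_part y ^+ n| <= 3 * 3 ^+ n.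
  by move=> y3; rewrite normrM ger0_norm// ler_pM2l// p.
have := p x x3; have := p (x - 3) ltac:(lra).
have := p3 (x - 1) ltac:(lra); have := p3 (x - 2) ltac:(lra).
rewrite /spline_gen !ler_norml; lra.
Qed.

(** One constant for the three functions: 8 * 27 / 6 = 8 * 9 / 2 = 36 for [step] and [dstep], and 8
    * 3 = 24 for [ddstep]. The lock keeps it symbolic in later computations. *)
Definition spline_bound : R := locked 36.

Lemma spline_bound_gt0 : 0 < spline_bound.
Proof. by rewrite /spline_bound -lock; lra. Qed.

Lemma step_norm x : `|step x| <= spline_bound.
Proof.
rewrite /spline_bound -lock; have [x3|x3] := leP 3 x; first by rewrite step_ge3// normr1; lra.
have := @spline_gen_bound 3 x isT (ltW x3).
by rewrite /step normrM ger0_norm ?invr_ge0//; lra.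
Qed.

Lemma dstep_norm x : `|dstep x| <= spline_bound.
Proof.
rewrite /spline_bound -lock; have [x3|x3] := leP 3 x; first by rewrite dstep_ge3// normr0; lra.
have := @spline_gen_bound 2 x isT (ltW x3).
by rewrite /dstep normrM ger0_norm ?invr_ge0//; lra.
Qed.

Lemma ddstep_norm x : `|ddstep x| <= spline_bound.
Proof.
rewrite /spline_bound -lock; have [x3|x3] := leP 3 x; first by rewrite ddstep_ge3// normr0; lra.
have := @spline_gen_bound 1 x isT (ltW x3).
by rewrite /ddstep expr1; lra.
Qed.

Section Scaled.
Variables (c e : R).
Hypothesis e0 : 0 < e.

(** The transition takes place on [[c, c + 3 * e]]; for small [e], [dcutoff] approximates a Dirac
    mass at [c] and [ddcutoff] its derivative. *)
Definition cutoff z := step (e^-1 * (z - c)).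
Definition dcutoff z := e^-1 * dstep (e^-1 * (z - c)).
Definition ddcutoff z := e^-1 * (e^-1 * ddstep (e^-1 * (z - c))).

Let arg z : is_derive z (1 : R) (fun z => e^-1 * (z - c)) e^-1.
Proof.
apply: (is_derive_eq (is_derive1Z _
  (is_derive1B (is_derive_id z 1) (is_derive_cst c z 1)))).
by rewrite subr0 mulr1.
Qed.

Lemma cutoff_derive : deriv_of cutoff dcutoff.
Proof.
move=> z; apply: (is_derive_eq (@is_derive1_comp _ step _ _ _ _ (step_derive _) (arg z))).
by rewrite /dcutoff mulrC.
Qed.

Lemma dcutoff_derive : deriv_of dcutoff ddcutoff.
Proof.
move=> z; apply: (is_derive_eq (is_derive1Z e^-1
  (@is_derive1_comp _ dstep _ _ _ _ (dstep_derive _) (arg z)))).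
by rewrite /ddcutoff [_ * e^-1 in LHS]mulrC.
Qed.

Lemma ddcutoff_continuous : continuous ddcutoff.
Proof.
move=> z; do 2 (apply: cvgM; first exact: cvg_cst).
apply: (@cvg_comp _ _ _ (fun z => e^-1 * (z - c)) ddstep).
  by apply: cvgM; [exact: cvg_cst|apply: cvgB; [exact: cvg_id|exact: cvg_cst]].
exact: spline_gen_continuous.
Qed.

Let arg_le0 z : z <= c -> e^-1 * (z - c) <= 0.
Proof. by move=> zc; rewrite pmulr_rle0 ?invr_gt0// subr_le0. Qed.

Let arg_ge3 z : c + 3 * e <= z -> 3 <= e^-1 * (z - c).
Proof. by move=> zc; rewrite mulrC ler_pdivlMr//; lra. Qed.

Lemma cutoff_le z : z <= c -> cutoff z = 0.
Proof. by move=> /arg_le0 z0; rewrite /cutoff /step spline_gen_le0// mulr0. Qed.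

Lemma dcutoff_le z : z <= c -> dcutoff z = 0.
Proof. by move=> /arg_le0 z0; rewrite /dcutoff /dstep spline_gen_le0// !mulr0. Qed.

Lemma ddcutoff_le z : z <= c -> ddcutoff z = 0.
Proof. by move=> /arg_le0 z0; rewrite /ddcutoff /ddstep spline_gen_le0// !mulr0. Qed.

Lemma cutoff_ge z : c + 3 * e <= z -> cutoff z = 1.
Proof. by move=> /arg_ge3 z0; rewrite /cutoff step_ge3. Qed.

Lemma dcutoff_ge z : c + 3 * e <= z -> dcutoff z = 0.
Proof. by move=> /arg_ge3 z0; rewrite /dcutoff dstep_ge3// mulr0. Qed.

Lemma ddcutoff_ge z : c + 3 * e <= z -> ddcutoff z = 0.
Proof. by move=> /arg_ge3 z0; rewrite /ddcutoff ddstep_ge3// !mulr0. Qed.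

Lemma cutoff_norm z : `|cutoff z| <= spline_bound. Proof. exact: step_norm. Qed.

Lemma dcutoff_norm z : `|dcutoff z| <= spline_bound / e.
Proof.
by rewrite /dcutoff normrM gtr0_norm ?invr_gt0// mulrC ler_pM2r ?invr_gt0// dstep_norm.
Qed.

Lemma ddcutoff_norm z : `|ddcutoff z| <= spline_bound / e / e.
Proof.
rewrite /ddcutoff !normrM gtr0_norm ?invr_gt0//.
by rewrite mulrA mulrC mulrA !ler_pM2r ?invr_gt0// ddstep_norm.
Qed.

End Scaled.

End Spline.

(** * Mollifiers and the fundamental lemma of the calculus of variations *)

Section TestFunctions.
Context {R : realType} (h : R).
Hypothesis h0 : 0 < h.
Implicit Types f g k u F G phi : R -> R.
Local Notation mu := (@lebesgue_measure R).

Lemma deriv_of_derive1 F f : deriv_of F f -> derive1 F = f.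
Proof.
move=> Ff; apply/funext => z; rewrite derive1E.
exact: (@derive_val _ _ _ _ _ _ _ (Ff z)).
Qed.

Lemma C1cP phi phi1 a b : deriv_of phi phi1 -> continuous phi1 ->
  0 < a -> b < h -> (forall z, ~~ (a <= z <= b) -> phi z = 0) -> C1c h phi.
Proof.
move=> d c a0 bh H; split.
- by move=> z; exact: (@ex_derive _ _ _ _ _ _ _ (d z)).
- by rewrite (deriv_of_derive1 d).
- by exists a, b; split => // z; apply: contraNT => /H ->.
Qed.

Lemma C1c_deriv phi : C1c h phi -> deriv_of phi (derive1 phi).
Proof. by case=> d _ _ z; rewrite derive1E; exact: DeriveDef. Qed.

Lemma C1c_cont phi : C1c h phi -> cont_on h phi.
Proof. by move=> /C1c_deriv/derive_continuous/continuous_cont_on. Qed.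

Lemma C1c_derive1_cont phi : C1c h phi -> cont_on h (derive1 phi).
Proof. by case=> _ + _; exact: continuous_cont_on. Qed.

Lemma C1c_0 phi z : C1c h phi -> ~~ (0 < z < h) -> phi z = 0.
Proof.
case=> _ _ [a [b [a0 bh H]]] zI; apply/eqP; apply: contraNT zI => /H /andP[az zb].
by rewrite (lt_le_trans a0 az) (le_lt_trans zb bh).
Qed.

Section Mollifier.
Variables (c e : R).
Hypotheses (e0 : 0 < e) (c0 : 0 <= c) (ch : c + 3 * e <= h).

Lemma dcutoff_cont_on : cont_on h (dcutoff c e).
Proof. exact: (continuous_cont_on (derive_continuous (@dcutoff_derive R c e))). Qed.

Lemma ddcutoff_cont_on : cont_on h (ddcutoff c e).
Proof. exact: (continuous_cont_on (@ddcutoff_continuous _ c e)). Qed.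

Lemma integ_dcutoff : integ h (dcutoff c e) = 1.
Proof.
rewrite (integ_derive h0 (@cutoff_derive R c e)); last exact: dcutoff_cont_on.
by rewrite cutoff_ge// cutoff_le// subr0.
Qed.

Lemma integ_ddcutoff : integ h (ddcutoff c e) = 0.
Proof.
rewrite (integ_derive h0 (@dcutoff_derive R c e)); last exact: ddcutoff_cont_on.
by rewrite dcutoff_ge// dcutoff_le// subr0.
Qed.

(** Together with [integ_ddcutoff], this gives the moments 0 and -1 of [ddcutoff], which therefore
    reads off minus a derivative in [mollify2]. *)
Lemma integ_ddcutoff1 p : integ h (fun z => (z - p) * ddcutoff c e z) = -1.
Proof.
have d : deriv_of (fun z => (z - p) * dcutoff c e z - cutoff c e z)
    (fun z => (z - p) * ddcutoff c e z).
  move=> z; apply: (is_derive_eq (is_derive1B (is_derive1M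
    (is_derive1B (is_derive_id z 1) (is_derive_cst p z 1)) (@dcutoff_derive R c e z))
    (@cutoff_derive R c e z))). by rewrite /=; ring.
rewrite (integ_derive h0 d); last first.
  apply: cont_onM; last exact: ddcutoff_cont_on.
  apply: cont_onB; last exact: cst_cont_on.
  by apply: continuous_cont_on => z; exact: cvg_id.
by rewrite cutoff_ge// dcutoff_ge// cutoff_le// dcutoff_le//; ring.
Qed.

Lemma cutoff_supp z : ~~ (c <= z <= c + 3 * e) -> z <= c \/ c + 3 * e <= z.
Proof. by rewrite negb_and -!ltNge => /orP[/ltW|/ltW]; [left|right]. Qed.

(** The kernel has unit mass, height at most [spline_bound / e] and a support of length [3 * e], so
    the error is independent of [e]. *)
Lemma mollify f L kappa : integrable_on h f -> 0 <= kappa ->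
  integrable_on h (fun z => f z * dcutoff c e z) ->
  (forall z, 0 < z < h -> c <= z <= c + 3 * e -> `|f z - L| <= kappa) ->
  `|integ h (fun z => f z * dcutoff c e z) - L| <= 3 * spline_bound * kappa.
Proof.
move=> fi k0 fdi H.
have cL : integrable_on h (fun z => L * dcutoff c e z).
  by apply: integrableZ_on; apply: cont_on_integrable; exact: dcutoff_cont_on.
have -> : integ h (fun z => f z * dcutoff c e z) - L =
    integ h (fun z => (f z - L) * dcutoff c e z).
  rewrite -[L in LHS]mulr1 -integ_dcutoff -integZ; last first.
    by apply: cont_on_integrable; exact: dcutoff_cont_on.
  by rewrite -integB//; apply: eq_integ => z _; rewrite mulrBl.
have -> : 3 * spline_bound * kappa = kappa * (spline_bound / e) * (c + 3 * e - c).
  by field; rewrite gt_eqF.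
apply: integ_support => //.
- have := integrableB_on fdi cL; apply: eq_integrable_on => z _.
  by rewrite mulrBl.
- by rewrite mulr_ge0// divr_ge0// ?ltW// spline_bound_gt0.
- by rewrite lerDl mulr_ge0// ltW.
- move=> z zI; rewrite normrM; have [zc|/cutoff_supp zc] := boolP (c <= z <= c + 3 * e).
    by rewrite ler_pM// ?H// dcutoff_norm.
  have -> : dcutoff c e z = 0 by case: zc => ?; [exact: dcutoff_le|exact: dcutoff_ge].
  by rewrite normr0 mulr0 mulr_ge0// divr_ge0// ?ltW// spline_bound_gt0.
- move=> z zI /cutoff_supp zc.
  by case: zc => ?; [rewrite dcutoff_le|rewrite dcutoff_ge]; rewrite ?mulr0.
Qed.

(** The kernel is now of height [spline_bound / e / e], which is paid for by a first-order expansion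
    of [F] with error [kappa * e]. *)
Lemma mollify2 F p l kappa : 0 <= kappa -> cont_on h F ->
  (forall z, 0 < z < h -> c <= z <= c + 3 * e ->
    `|F z - F p - l * (z - p)| <= kappa * e) ->
  `|integ h (fun z => F z * ddcutoff c e z) + l| <= 3 * spline_bound * kappa.
Proof.
move=> k0 Fc H.
have dc := ddcutoff_cont_on.
have ic : cont_on h (fun z => z - p).
  apply: cont_onB; last exact: cst_cont_on.
  by apply: continuous_cont_on => z; exact: cvg_id.
have -> : integ h (fun z => F z * ddcutoff c e z) + l =
    integ h (fun z => (F z - F p - l * (z - p)) * ddcutoff c e z).
  transitivity (integ h (fun z => F z * ddcutoff c e z - F p * ddcutoff c e z
      - l * ((z - p) * ddcutoff c e z))).
    rewrite !integB ?(integZ (F p)) ?(integZ l) ?integ_ddcutoff ?integ_ddcutoff1;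
      try by int_tac.
    by ring.
  by apply: eq_integ => z _; ring.
have -> : 3 * spline_bound * kappa = kappa * e * (spline_bound / e / e) * (c + 3 * e - c).
  by field; rewrite gt_eqF.
have M0 : 0 <= kappa * e * (spline_bound / e / e).
  by rewrite mulr_ge0// ?mulr_ge0// ?invr_ge0// ?divr_ge0// ?ltW// spline_bound_gt0.
apply: integ_support => //.
- by int_tac.
- by rewrite lerDl mulr_ge0// ltW.
- move=> z zI; rewrite normrM; have [zc|/cutoff_supp zc] := boolP (c <= z <= c + 3 * e).
    by rewrite ler_pM// ?H// ddcutoff_norm.
  have -> : ddcutoff c e z = 0 by case: zc => ?; [exact: ddcutoff_le|exact: ddcutoff_ge].
  by rewrite normr0 mulr0.
- move=> z zI /cutoff_supp zc.
  by case: zc => ?; [rewrite ddcutoff_le|rewrite ddcutoff_ge]; rewrite ?mulr0.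
Qed.

End Mollifier.

Lemma integ_subset f (J : set (measurableTypeR R)) : integrable_on h f ->
  measurable J -> J `<=` `]0, h[ -> (forall z, ~ J z -> f z = 0) ->
  integ h f = (\int[mu]_(z in J) f z)%R.
Proof.
move=> fi mJ JI f0.
have e : `]0, h[ `&` J = J by apply: setIidr.
rewrite -[in RHS]e Rintegral_mkcondr; apply: eq_Rintegral => z _.
by rewrite patchE; case: ifPn => // /negP; rewrite inE => /f0.
Qed.

(** Testing with a C^1 bump of unit mass near [x] shows that [k x] is minus the integral of
    [k - k x] against the bump. The bump has height of order [1 / r], so this is controlled by the
    mean deviation [davg], which tends to 0 at a Lebesgue point. *)
Lemma test_lebesgue_pt k x : integrable_on h k ->
  (forall phi, C1c h phi -> integ h (fun z => k z * phi z) = 0) ->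
  0 < x < h -> lebesgue_pt (k \_ `]0, h[) x -> k x = 0.
Proof.
move=> ki k0 /andP[x0 xh] /fine_cvgP[_ /cvgrPdist_le lx].
apply/eqP; rewrite -normr_eq0; apply/eqP/le_anti; rewrite normr_ge0 andbT.
apply/ler_addgt0Pr => e e0; rewrite add0r.
have M0 : 0 < spline_bound :> R := spline_bound_gt0.
(* The height [spline_bound / (r / 3)] of the bump times the length [2 * r] of the ball is
   [6 * spline_bound]. *)
have e1 : 0 < e / (6 * spline_bound) by rewrite divr_gt0// mulr_gt0.
have := lx _ e1 => {}lx.
near (0 : R)^'+ => r.
have r0 : 0 < r by near: r; exact: nbhs_right_gt.
have rx : r < x by near: r; exact: nbhs_right_lt.
have rh : r < h - x by near: r; apply: nbhs_right_lt; rewrite subr_gt0.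
have lr : `|0 - fine (davg (k \_ `]0, h[) x r)| <= e / (6 * spline_bound) by near: r.
have BI : (ball x r : set R) `<=` `]0, h[.
  move=> z; rewrite /ball/= => /ltr_normlP[z1 z2]; apply/in_oo; lra.
have mB : measurable (ball x r : set (measurableTypeR R)) by exact: measurable_ball.
have kx z : (ball x r : set R) z -> (k \_ `]0, h[) z = k z.
  by move=> /BI zI; rewrite patchE mem_set.
have xB : (ball x r : set R) x by exact: ballxx.
pose c := x - r / 2; pose e' := r / 3.
have e'0 : 0 < e' by rewrite divr_gt0.
have ce : c + 3 * e' = x + r / 2 by rewrite /c /e'; field.
have c0 : 0 <= c by rewrite /c; lra.
have ch : c + 3 * e' <= h by rewrite ce; lra.
pose phi := dcutoff c e'.
have phic : cont_on h phi by exact: dcutoff_cont_on.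
have phiT : C1c h phi.
  apply: (C1cP (@dcutoff_derive R c e') (@ddcutoff_continuous _ c e') (a := c) (b := c + 3 * e')).
  - by rewrite /c; lra.
  - by rewrite ce; lra.
  - by move=> z /cutoff_supp[?|?]; [exact: dcutoff_le|exact: dcutoff_ge].
have kphi : integrable_on h (fun z => k z * phi z).
  have [B [B0 HB]] := cont_on_bounded phic.
  apply: (@le_integrable_on _ h _ (fun z => B * `|k z|)).
  - apply: measurable_funM; first exact: integrable_measurable_on.
    exact: L2_measurable (cont_on_L2 phic).
  - by move=> z /andP[z1 z2]; rewrite normrM mulrC ler_wpM2r// HB// !ltW.
  - exact/integrableZ_on/integrable_norm_on.
pose G z := (k z - k x) * phi z.
have Gi : integrable_on h G.
  have := integrableB_on kphi (integrableZ_on (k x) (cont_on_integrable phic)).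
  by apply: eq_integrable_on => z _; rewrite /G mulrBl.
have kxE : k x = - integ h G.
  have -> : integ h G = integ h (fun z => k z * phi z - k x * phi z).
    by apply: eq_integ => z _; rewrite /G mulrBl.
  have I1 : integ h phi = 1 by exact: integ_dcutoff.
  have pi := cont_on_integrable phic.
  rewrite integB//; last exact: integrableZ_on.
  by rewrite (integZ (k x) pi) I1 k0// mulr1 sub0r opprK.
rewrite kxE normrN (integ_subset Gi mB BI); last first.
  move=> z zB; rewrite /G; suff -> : phi z = 0 by rewrite mulr0.
  have : ~~ (c <= z <= c + 3 * e').
    apply/negP => /andP[z1 z2]; apply: zB; rewrite /ball/=.
    by apply/ltr_normlP; move: z1 z2; rewrite ce /c => z1 z2; split; lra.
  by move=> /cutoff_supp[?|?]; [exact: dcutoff_le|exact: dcutoff_ge].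
have GB : mu.-integrable (ball x r) (EFin \o G).
  by apply: integrableS Gi => //; exact: measurable_itv.
have kB : mu.-integrable (ball x r) (EFin \o (fun z => k z - k x)).
  have kxi : integrable_on h (fun z => k z - k x).
    by apply: integrableB_on => //; exact/cont_on_integrable/cst_cont_on.
  by apply: integrableS kxi => //; exact: measurable_itv.
have nkB : mu.-integrable (ball x r) (EFin \o (fun z => `|k z - k x|)).
  by have := integrable_norm kB.
apply: le_trans (le_normr_Rintegral mB GB) _.
apply: (@le_trans _ _ (\int[mu]_(z in (ball x r : set R)) ((spline_bound / e') * `|k z - k x|))%R).
  apply: le_Rintegral => //; first by have := integrable_norm GB.
    by have := integrableZl mB (spline_bound / e') nkB; exact.
  by move=> z _; rewrite /G normrM mulrC ler_wpM2r// dcutoff_norm.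
rewrite RintegralZl//.
set I := (X in _ * X).
have dE : davg (k \_ `]0, h[) x r = ((2 * r)^-1 * I)%:E.
  rewrite /davg /iavg EFinM; congr (_ * _)%E.
    have mb := lebesgue_measure_ball x (ltW r0).
    transitivity (((r *+ 2)%:E)^-1)%E; first by congr (_^-1)%E.
    by rewrite inver mulrn_eq0/= gt_eqF// mulr_natl.
  rewrite /I /Rintegral fineK; last exact: integrable_fin_num.
  by apply: eq_integral => z; rewrite inE => zB; rewrite /= !kx// ?[- _ + _]addrC.
move: lr; rewrite dE /= sub0r normrN.
have I0 : 0 <= I by apply: Rintegral_ge0.
rewrite ger0_norm; last by rewrite mulr_ge0// invr_ge0 mulr_ge0// ltW.
rewrite mulrC ler_pdivrMr ?mulr_gt0// => HI.
suff eE : e = spline_bound / e' * (e / (6 * spline_bound) * (2 * r)).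
  by rewrite [leRHS]eE ler_wpM2l// divr_ge0// ltW.
by rewrite /e'; field; rewrite !gt_eqF.
Unshelve. all: by end_near. Qed.

(** Almost every point is a Lebesgue point, hence [k] vanishes almost everywhere. The integrated
    form is the one needed to compare representatives of a weak derivative. *)
Lemma test_ae k : integrable_on h k ->
  (forall phi, C1c h phi -> integ h (fun z => k z * phi z) = 0) ->
  forall m, L2 h m -> integ h (fun z => k z * m z) = 0.
Proof.
move=> ki k0 m mL.
have mI : measurable (`]0, h[ : set (measurableTypeR R)) by exact: measurable_itv.
have := lebesgue_differentiation (integrable_locally_restrict mI ki).
move=> lae; rewrite -(integ0 h); congr fine; apply: ae_eq_integral => //.
- apply/measurable_EFinP; apply: measurable_funM; last exact: L2_measurable.
  exact: integrable_measurable_on.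
- move: lae; apply: filterS; first exact: (ae_filter_ringOfSetsType mu).
  by move=> x Hx /in_oo xI; rewrite (test_lebesgue_pt ki)// mul0r.
Qed.

End TestFunctions.

(** * Weak derivatives *)

Section Window.
Context {R : realType} (a b e : R).
Hypotheses (e0 : 0 < e) (eab : 8 * e < b - a).

(** Equal to 1 on [[a + 4 * e, b - 4 * e]] and to 0 outside [[a + e, b - e]]: multiplying a C^2
    function by it on [[0, h]] gives an admissible test function whose derivative is admissible
    too. *)
Definition window z := cutoff (a + e) e z - cutoff (b - 4 * e) e z.
Definition dwindow z := dcutoff (a + e) e z - dcutoff (b - 4 * e) e z.
Definition ddwindow z := ddcutoff (a + e) e z - ddcutoff (b - 4 * e) e z.

Lemma window_derive : deriv_of window dwindow.
Proof.
by move=> z; exact: (is_derive1B (@cutoff_derive _ _ e z) (@cutoff_derive _ _ e z)).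
Qed.

Lemma dwindow_derive : deriv_of dwindow ddwindow.
Proof.
by move=> z; exact: (is_derive1B (@dcutoff_derive _ _ e z) (@dcutoff_derive _ _ e z)).
Qed.

Lemma ddwindow_continuous : continuous ddwindow.
Proof. by move=> z; apply: cvgB; exact: ddcutoff_continuous. Qed.

Lemma window_out z : ~~ (a + e <= z <= b - e) ->
  [/\ window z = 0, dwindow z = 0 & ddwindow z = 0].
Proof.
move: (e0) (eab) => ? ?; rewrite negb_and -!ltNge /window /dwindow /ddwindow => /orP[ze|ze].
  have z1 : z <= a + e by exact: ltW.
  have z2 : z <= b - 4 * e by lra.
  by rewrite !cutoff_le ?dcutoff_le ?ddcutoff_le ?subrr.
have z1 : a + e + 3 * e <= z by lra.
have z2 : b - 4 * e + 3 * e <= z by lra.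
by rewrite !cutoff_ge ?dcutoff_ge ?ddcutoff_ge ?subrr.
Qed.

Lemma window_norm z : `|window z| <= 2 * spline_bound.
Proof.
have := ler_normB (cutoff (a + e) e z) (cutoff (b - 4 * e) e z).
have := cutoff_norm (a + e) e z; have := cutoff_norm (b - 4 * e) e z.
rewrite /window; lra.
Qed.

End Window.

Section WeakDerivative.
Context {R : realType} (h : R).
Hypothesis h0 : 0 < h.
Implicit Types f g k u v F G phi m : R -> R.
Local Notation M := (@spline_bound R).

Let M0 : 0 < M. Proof. exact: spline_bound_gt0. Qed.

Lemma eq_is_wderiv u v g : (forall z, 0 < z < h -> u z = v z) ->
  is_wderiv h u g -> is_wderiv h v g.
Proof.
move=> uv [[mu iu] gL H]; split => //.
  split.
    by apply: (eq_measurable_fun u) => // z; rewrite inE => /in_oo; exact: uv.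
  by apply: (@eq_integrable_on _ h (fun z => u z ^+ 2)) => // z /uv ->.
move=> phi /H <-; apply: eq_integ => z /uv -> //.
Qed.

Lemma eq_wD u v : (forall z, 0 < z < h -> u z = v z) -> wD h u = wD h v.
Proof.
move=> uv; rewrite /wD; congr (xget _ _); apply/seteqP; split=> g /=.
  exact: eq_is_wderiv.
by apply: eq_is_wderiv => z /uv.
Qed.

Lemma wD_spec u g : is_wderiv h u g -> is_wderiv h u (wD h u).
Proof. by move=> ug; apply: (@xgetPex _ _ [set g | is_wderiv h u g]); exists g. Qed.

Lemma deriv_is_wderiv F f : deriv_of F f -> cont_on h f -> is_wderiv h F f.
Proof.
move=> Ff fc; have Fc : cont_on h F.
  exact: (continuous_cont_on (derive_continuous Ff)).
split; [exact: cont_on_L2|exact: cont_on_L2|move=> phi phiT].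
have d : deriv_of (fun z => F z * phi z) (fun z => f z * phi z + F z * derive1 phi z).
  by move=> z; exact: is_derive1M (Ff z) (C1c_deriv phiT z).
have pc := C1c_cont phiT; have pc1 := C1c_derive1_cont phiT.
have := integ_derive h0 d; rewrite !(C1c_0 phiT) ?ltxx ?andbF// !mulr0 subr0.
rewrite integD; try by int_tac.
by move=> e; apply/eqP; rewrite -addr_eq0 addrC e//; cont_tac.
Qed.

(** [wD] is a choice, known only up to a null set; exchanging it for an explicit derivative under an
    integral is the only access to it. *)
Lemma wD_unique u g m : is_wderiv h u g -> L2 h m ->
  integ h (fun z => wD h u z * m z) = integ h (fun z => g z * m z).
Proof.
move=> ug mL; have [uL wL Hw] := wD_spec ug; have [_ gL Hg] := ug.
have ki : integrable_on h (fun z => wD h u z - g z).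
  by apply: integrableB_on; exact: L2_integrable.
have := @test_ae _ h h0 _ ki _ m mL => H.
apply/eqP; rewrite -subr_eq0 -integB; [|exact: L2M|exact: L2M].
rewrite -[X in _ == X]H => [|phi phiT].
  by apply/eqP; apply: eq_integ => z _; rewrite mulrBl.
have pL := cont_on_L2 (C1c_cont phiT).
transitivity (integ h (fun z => wD h u z * phi z - g z * phi z)).
  by apply: eq_integ => z _; rewrite mulrBl.
rewrite integB; [|exact: L2M|exact: L2M].
by have := Hw _ phiT; rewrite Hg// => /eqP; rewrite eqr_opp => /eqP ->; rewrite subrr.
Qed.

Lemma cont_on_close u x kappa : cont_on h u -> 0 <= x <= h -> 0 < kappa ->
  exists d, 0 < d /\ forall z, 0 <= z <= h -> `|z - x| < d -> `|u z - u x| <= kappa.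
Proof.
move=> /subspace_continuousP uc /in_cc xI k0.
have := uc x xI => /cvgrPdist_le /(_ kappa k0).
rewrite near_withinE => /nbhs_ballP[d /= d0 dH].
exists d; split => // z /in_cc zI zx; rewrite distrC; apply: dH => //.
by rewrite /ball/= distrC.
Qed.

(** The test function is a smoothed indicator of [[x, y]], bounded by [2 * M]: against its
    derivative [u] gives nearly [u x - u y], and the definition of weak derivative turns this into
    an integral of [g]. *)
Lemma wderiv_variation u g x y : cont_on h u -> is_wderiv h u g ->
  0 <= x -> x < y -> y <= h -> `|u y - u x| <= 2 * M * integ h (fun z => `|g z|).
Proof.
move=> uc [uL gL H] x0 xy yh; apply/ler_addgt0Pr => eta eta0.
(* Each of the two mollifiers then contributes an error [eta / 2]. *)
have k0 : 0 < eta / (6 * M) by rewrite divr_gt0// mulr_gt0.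
have k6 : 3 * M * (eta / (6 * M)) = eta / 2 by field; rewrite gt_eqF.
have xI : 0 <= x <= h by rewrite x0/=; lra.
have yI : 0 <= y <= h by rewrite yh andbT; lra.
have [d1 [d10 H1]] := cont_on_close uc xI k0.
have [d2 [d20 H2]] := cont_on_close uc yI k0.
near (0 : R)^'+ => e.
have e0 : 0 < e by near: e; exact: nbhs_right_gt.
have e1 : 4 * e < d1.
  by rewrite mulrC -ltr_pdivlMr//; near: e; apply: nbhs_right_lt; rewrite divr_gt0.
have e2 : 4 * e < d2.
  by rewrite mulrC -ltr_pdivlMr//; near: e; apply: nbhs_right_lt; rewrite divr_gt0.
have e3 : 8 * e < y - x.
  rewrite mulrC -ltr_pdivlMr//; near: e; apply: nbhs_right_lt.
  by rewrite divr_gt0// subr_gt0.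
pose c1 := x + e; pose c2 := y - 4 * e.
have c10 : 0 <= c1 by rewrite /c1; clear -x0 e0; lra.
have c20 : 0 <= c2 by rewrite /c2; clear -x0 e0 e3; lra.
have c1h : c1 + 3 * e <= h by rewrite /c1; clear -e0 e3 yh; lra.
have c2h : c2 + 3 * e <= h by rewrite /c2; clear -e0 yh; lra.
pose phi := window x y e.
have dphi : deriv_of phi (dwindow x y e) by exact: window_derive.
have dc1 := @dcutoff_cont_on _ h c1 e; have dc2 := @dcutoff_cont_on _ h c2 e.
have phi1c : continuous (dwindow x y e) by exact: derive_continuous (@dwindow_derive _ x y e).
have phiT : C1c h phi.
  apply: (C1cP dphi phi1c (a := x + e) (b := y - e)).
  - by rewrite ltr_wpDl.
  - by rewrite ltrBlDr ltr_pwDr.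
  - by move=> z /(window_out e0 e3)[].
have uu : integrable_on h u by exact: L2_integrable.
have m1 : `|integ h (fun z => u z * dcutoff c1 e z) - u x| <= 3 * M * (eta / (6 * M)).
  apply: mollify => //; first exact: ltW.
    by apply: L2M => //; exact: cont_on_L2.
  move=> z /andP[z0 zh] /andP[z1 z2]; apply: H1; first by rewrite !ltW.
  rewrite /c1 in z1 z2; rewrite ger0_norm; clear -z1 z2 e0 e1; lra.
have m2 : `|integ h (fun z => u z * dcutoff c2 e z) - u y| <= 3 * M * (eta / (6 * M)).
  apply: mollify => //; first exact: ltW.
    by apply: L2M => //; exact: cont_on_L2.
  move=> z /andP[z0 zh] /andP[z1 z2]; apply: H2; first by rewrite !ltW.
  rewrite /c2 in z1 z2; rewrite ler0_norm; clear -z1 z2 e0 e2; lra.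
have := H _ phiT; rewrite (deriv_of_derive1 dphi).
have -> : integ h (fun z => u z * dwindow x y e z) = integ h (fun z => u z * dcutoff c1 e z)
    - integ h (fun z => u z * dcutoff c2 e z).
  rewrite -integB; [|by apply: L2M => //; exact: cont_on_L2..].
  by apply: eq_integ => z _; rewrite mulrBr.
have phic : cont_on h phi by exact: C1c_cont phiT.
have : `|integ h (fun z => g z * phi z)| <= 2 * M * integ h (fun z => `|g z|).
  have gpi : integrable_on h (fun z => g z * phi z).
    by apply: L2M => //; exact: cont_on_L2.
  have gi := integrable_norm_on (L2_integrable gL).
  apply: le_trans (norm_integ gpi) _; rewrite -integZ//; apply: le_integ.
  - exact: integrable_norm_on.
  - exact: integrableZ_on.
  - by move=> z _; rewrite normrM mulrC ler_wpM2r// window_norm.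
move: m1 m2; rewrite k6; set I := integ h (fun z => `|g z|).
move: (2 * M * I) (integ h _) (integ h _) (integ h _) => a b c d; rewrite !ler_norml.
clear; lra.
Unshelve. all: by end_near. Qed.

(** From [u y ^+ 2 <= 2 * u x ^+ 2 + 2 * (2 * M * I) ^+ 2], with I the integral of [|g|]: averaging
    over [x] gives the first term, and the Cauchy-Schwarz bound of [I ^+ 2] by [h] times the
    integral of [g ^+ 2] the second. *)
Definition sup_const : R := 2 / h + 2 * (2 * M) ^+ 2 * h.

Lemma sup_const_gt0 : 0 < sup_const.
Proof. by rewrite addr_gt0 ?divr_gt0 ?mulr_gt0 ?exprn_gt0// mulr_gt0. Qed.

Lemma sobolev_sup u g y : cont_on h u -> is_wderiv h u g -> 0 <= y <= h ->
  u y ^+ 2 <= sup_const *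
    (integ h (fun z => u z ^+ 2) + integ h (fun z => g z ^+ 2)).
Proof.
move=> uc ug /andP[y0 yh]; have [uL gL _] := ug.
set I := integ h (fun z => `|g z|).
have I0 : 0 <= I by apply: integ_ge0.
have var x : 0 < x < h -> `|u y - u x| <= 2 * M * I.
  move=> /andP[x0 xh]; have [xy|yx|->] := ltgtP x y.
  - exact: (wderiv_variation uc ug (ltW x0)).
  - by rewrite distrC; apply: (wderiv_variation uc ug y0) => //; exact: ltW.
  - by rewrite subrr normr0 !mulr_ge0// ltW.
have sq x : 0 < x < h -> u y ^+ 2 <= 2 * u x ^+ 2 + 2 * (2 * M * I) ^+ 2.
  move=> /var; rewrite ler_norml => /andP[a b].
  have c : (u y - u x) ^+ 2 <= (2 * M * I) ^+ 2 by nra.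
  have := sqr_ge0 (u y - 2 * u x); nra.
have := @le_integ _ h (fun=> u y ^+ 2) (fun x => 2 * u x ^+ 2 + 2 * (2 * M * I) ^+ 2).
rewrite integ_cst// integD ?integ_cst ?(integZ 2)//; last 3 first.
- exact: L2_sqr.
- exact/integrableZ_on/L2_sqr.
- exact/cont_on_integrable/cst_cont_on.
have CS := integ_cauchy_schwarz h0 gL; rewrite -/I in CS.
move=> H; have {}H : u y ^+ 2 * h <= 2 * integ h (fun z => u z ^+ 2)
    + 2 * (2 * M * I) ^+ 2 * h.
  apply: H; [exact/cont_on_integrable/cst_cont_on| |exact: sq].
  apply: integrableD_on; first exact/integrableZ_on/L2_sqr.
  exact/cont_on_integrable/cst_cont_on.
set J := integ h (fun z => g z ^+ 2) in CS *.
set K := integ h (fun z => u z ^+ 2) in H *.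
have J0 : 0 <= J by apply: integ_ge0 => z _; exact: sqr_ge0.
have K0 : 0 <= K by apply: integ_ge0 => z _; exact: sqr_ge0.
rewrite -(ler_pM2r h0); apply: le_trans H _.
have -> : sup_const * (K + J) * h = 2 * K + 2 * J + 2 * (2 * M) ^+ 2 * h ^+ 2 * K
   + 2 * (2 * M) ^+ 2 * h * (h * J).
  by rewrite /sup_const; field; rewrite gt_eqF.
have -> : 2 * (2 * M * I) ^+ 2 * h = 2 * (2 * M) ^+ 2 * h * I ^+ 2 by ring.
have MM0 : 0 <= 2 * (2 * M) ^+ 2 by rewrite mulr_ge0// sqr_ge0.
have : 2 * (2 * M) ^+ 2 * h * I ^+ 2 <= 2 * (2 * M) ^+ 2 * h * (h * J).
  by apply: ler_wpM2l => //; apply: mulr_ge0 => //; exact: ltW.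
have : 0 <= 2 * (2 * M) ^+ 2 * h ^+ 2 * K.
  by apply: mulr_ge0 => //; apply: mulr_ge0 => //; exact: sqr_ge0.
move: (2 * (2 * M) ^+ 2 * h ^+ 2 * K) (2 * (2 * M) ^+ 2 * h * (h * J)).
move: (2 * (2 * M) ^+ 2 * h * I ^+ 2) => a b c; clear -J0.
lra.
Qed.

(** [k] is merely square-integrable, so a short support does not bound the integral by its length.
    Young's inequality with weight [tau] on a support of length [4 * tau ^+ 2] leaves a factor [tau]
    in front of both terms. *)
Lemma edge_bound k m a tau : L2 h k -> cont_on h m -> 0 < tau ->
  (forall z, `|m z| <= M + 1) ->
  (forall z, 0 < z < h -> ~~ (a <= z <= a + 4 * tau ^+ 2) -> m z = 0) ->
  `|integ h (fun z => k z * m z)| <= tau * (integ h (fun z => k z ^+ 2) + 4 * (M + 1) ^+ 2).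
Proof.
move=> kL mc t0 mM msupp.
have mL := cont_on_L2 mc; have kmi := L2M kL mL.
have B : integ h (fun z => m z ^+ 2) <= (M + 1) ^+ 2 * (a + 4 * tau ^+ 2 - a).
  apply: le_trans (ler_norm _) _; apply: integ_support => //.
  - exact: L2_sqr.
  - exact: sqr_ge0.
  - by rewrite lerDl mulr_ge0// sqr_ge0.
  - move=> z _; rewrite normrX; have := mM z; have := normr_ge0 (m z); nra.
  - by move=> z zI /(msupp z zI) ->; rewrite expr0n.
apply: le_trans (norm_integ kmi) _.
have ki := L2_sqr kL; have mi := L2_sqr mL.
apply: (@le_trans _ _ (integ h (fun z => tau * k z ^+ 2 + tau^-1 * m z ^+ 2))).
  apply: le_integ; [exact: integrable_norm_on| |].
    by apply: integrableD_on; exact: integrableZ_on.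
  move=> z _; rewrite normrM -(real_normK (num_real (k z))).
  rewrite -(real_normK (num_real (m z))).
  move: (normr_ge0 (k z)) (normr_ge0 (m z)); move: `|k z| `|m z| => a1 b1 a0 b0.
  have : 0 <= tau^-1 * (tau * a1 - b1) ^+ 2.
    by rewrite mulr_ge0 ?invr_ge0 ?sqr_ge0// ltW.
  have -> : tau^-1 * (tau * a1 - b1) ^+ 2 = tau * a1 ^+ 2 + tau^-1 * b1 ^+ 2
      - 2 * (a1 * b1) by field; rewrite gt_eqF.
  have : 0 <= a1 * b1 by rewrite mulr_ge0.
  lra.
rewrite integD ?(integZ tau) ?(integZ tau^-1)//; try exact: integrableZ_on.
rewrite mulrDr lerD2l mulrC ler_pdivrMr//; apply: le_trans B _.
by rewrite le_eqVlt; apply/orP; left; apply/eqP; ring.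
Qed.

End WeakDerivative.

(** * Integration by parts with periodic boundary conditions *)

Section PeriodicParts.
Context {R : realType} (h : R).
Hypothesis h0 : 0 < h.
Implicit Types f g k u v F G phi m : R -> R.
Local Notation M := (@spline_bound R).

Let M0 : 0 < M. Proof. exact: spline_bound_gt0. Qed.

(* The boundary terms are extracted by the transition functions cutoff: their
   derivatives are mollifiers concentrated at the endpoints. *)
Lemma periodic_ibp u v l0 lh zt zt1 zt2 : W22 h u -> u 0 = u h ->
  has_deriv h u 0 l0 -> has_deriv h u h lh -> l0 = lh ->
  deriv_of zt zt1 -> deriv_of zt1 zt2 -> continuous zt2 ->
  zt 0 = zt h -> zt1 0 = zt1 h ->
  integ h (fun z => wD h (wD h u) z * zt z) = integ h (fun z => u z * zt2 z).
Proof.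
move=> [[uc [g1 ug1]] [g2' wg2']] u0h d0 dh l0h dz dz1 z2c z0h z10h.
have [uL wL Hw] := wD_spec ug1; have [_ g2L H2] := wD_spec wg2'.
set g2 := wD h (wD h u) in g2L H2 *.
have zc : cont_on h zt by exact: (continuous_cont_on (derive_continuous dz)).
have z1c : cont_on h zt1 by exact: (continuous_cont_on (derive_continuous dz1)).
have z2c' : cont_on h zt2 by exact: continuous_cont_on.
pose k z := g2 z * zt z - u z * zt2 z.
have kL : L2 h k.
  have e : k = fun z => g2 z * zt z + (-1) * (u z * zt2 z).
    by apply/funext => z; rewrite mulN1r.
  rewrite e; apply: L2D; first exact: L2_cont.
  by apply: L2Z; exact: L2_cont.
have ki := L2_integrable kL.
pose J := integ h (fun z => k z ^+ 2).
have J0 : 0 <= J by apply: integ_ge0 => z _; exact: sqr_ge0.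
have g2zi : integrable_on h (fun z => g2 z * zt z) by apply/L2_integrable/L2_cont.
have uz2i : integrable_on h (fun z => u z * zt2 z) by int_tac.
apply/eqP; rewrite -subr_eq0 -integB// -normr_eq0; apply/eqP/le_anti.
rewrite normr_ge0 andbT; apply/ler_addgt0Pr => eta eta0; rewrite add0r.
(* Error budget: four mollifier terms of size [3 * M * kappa = eta / 8] and two edge terms of size
   [eta / 4] add up to [eta]. *)
have k0 : 0 < eta / (24 * M) by rewrite divr_gt0// mulr_gt0.
set kappa := eta / (24 * M) in k0.
have k24 : 3 * M * kappa = eta / 8 by rewrite /kappa; field; rewrite gt_eqF.
have k40 : 0 < kappa / 4 by rewrite divr_gt0.
pose om z := 2 * (u z * zt1 z).
have omc : cont_on h om by rewrite /om; cont_tac.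
have I0 : 0 <= (0 : R) <= h by rewrite lexx ltW.
have Ih : 0 <= h <= h by rewrite lexx ltW.
have [d1 [d10 D1]] := cont_on_close omc I0 k0.
have [d2 [d20 D2]] := cont_on_close omc Ih k0.
pose F z := u z * zt z.
have Fc : cont_on h F by rewrite /F; cont_tac.
pose L := l0 * zt 0 + u 0 * zt1 0.
have F0 : has_deriv h F 0 L.
  by apply: has_derivM => //; exact: is_derive_has_deriv.
have Fh : has_deriv h F h L.
  rewrite /L l0h u0h z0h z10h.
  by apply: has_derivM => //; exact: is_derive_has_deriv.
have /cvg_quotientP/(_ _ k40)[d3 [d30 D3]] := F0.
have /cvg_quotientP/(_ _ k40)[d4 [d40 D4]] := Fh.
have JM : 0 < J + 4 * (M + 1) ^+ 2.
  by rewrite ltr_wpDl// mulr_gt0// exprn_gt0// addr_gt0.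
near (0 : R)^'+ => tau.
have t0 : 0 < tau by near: tau; exact: nbhs_right_gt.
have t1 : tau < 1 by near: tau; exact: nbhs_right_lt.
(* The edges have width of order [tau ^+ 2], as [edge_bound] expects. *)
pose e := tau ^+ 2.
have et : e <= tau by rewrite /e expr2 ger_pMl// ltW.
have e0 : 0 < e by rewrite exprn_gt0.
have small d : 0 < d -> tau < d / 8 -> 8 * e < d by move=> ? ?; lra.
have e1 : 8 * e < d1.
  by apply: small => //; near: tau; apply: nbhs_right_lt; rewrite divr_gt0.
have e2 : 8 * e < d2.
  by apply: small => //; near: tau; apply: nbhs_right_lt; rewrite divr_gt0.
have e3 : 8 * e < d3.
  by apply: small => //; near: tau; apply: nbhs_right_lt; rewrite divr_gt0.
have e4 : 8 * e < d4.
  by apply: small => //; near: tau; apply: nbhs_right_lt; rewrite divr_gt0.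
have e5 : 8 * e < h.
  by apply: small => //; near: tau; apply: nbhs_right_lt; rewrite divr_gt0.
have tJ : tau * (J + 4 * (M + 1) ^+ 2) <= eta / 4.
  rewrite -ler_pdivlMr//.
  by near: tau; apply: nbhs_right_le; rewrite !divr_gt0.
pose c1 := e; pose c2 := h - 4 * e.
have c10 : 0 <= c1 by rewrite /c1; exact: ltW.
have c20 : 0 <= c2 by rewrite /c2; clear -e0 e5; lra.
have c1h : c1 + 3 * e <= h by rewrite /c1; clear -e0 e5; lra.
have c2h : c2 + 3 * e <= h by rewrite /c2; clear -e0; lra.
pose chi := window 0 h e; pose chi1 := dwindow 0 h e; pose chi2 := ddwindow 0 h e.
have dchi : deriv_of chi chi1 by exact: window_derive.
have dchi1 : deriv_of chi1 chi2 by exact: dwindow_derive.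
have chi2c : continuous chi2 by exact: ddwindow_continuous.
have e5' : 8 * e < h - 0 by rewrite subr0.
have c1E : 0 + e = c1 by rewrite add0r.
pose p z := zt z * chi z.
pose p1 z := zt1 z * chi z + zt z * chi1 z.
pose p2 z := zt2 z * chi z + 2 * (zt1 z * chi1 z) + zt z * chi2 z.
have dp : deriv_of p p1 by move=> z; exact: (is_derive1M (dz z) (dchi z)).
have dp1 : deriv_of p1 p2.
  move=> z; apply: (is_derive_eq (is_derive1D (is_derive1M (dz1 z) (dchi z))
    (is_derive1M (dz z) (dchi1 z)))).
  by rewrite /p2; ring.
have chi0 z : ~~ (0 + e <= z <= h - e) -> [/\ chi z = 0, chi1 z = 0 & chi2 z = 0].
  exact: window_out.
have he : h - e < h by rewrite ltrBlDr ltrDl.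
have oe : 0 < 0 + e by rewrite add0r.
have p1c : continuous p1 by exact: derive_continuous dp1.
have p2c : continuous p2.
  move=> z; have cc F' f' : deriv_of F' f' -> {for z, continuous F'}.
    by move=> H; exact: (derive_continuous H).
  apply: cvgD; last by apply: cvgM; [exact: cc dz|exact: chi2c].
  apply: cvgD; first by apply: cvgM; [exact: z2c|exact: cc dchi].
  apply: cvgM; first exact: cvg_cst.
  by apply: cvgM; [exact: cc dz1|exact: cc dchi1].
have pT : C1c h p.
  apply: (C1cP dp p1c oe he).
  by move=> z /chi0[e1' _ _]; rewrite /p e1' mulr0.
have p1T : C1c h p1.
  apply: (C1cP dp1 p2c oe he).
  by move=> z /chi0[e1' e2' _]; rewrite /p1 e1' e2' !mulr0 addr0.
(* The definition of weak derivative is used twice, with test functions [p1] and then [p]. The first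
   must itself be C^1, hence cutoffs of class C^2. *)
have key : integ h (fun z => u z * p2 z) = integ h (fun z => g2 z * p z).
  have := Hw _ p1T; rewrite (deriv_of_derive1 dp1) => ->.
  by have := H2 _ pT; rewrite (deriv_of_derive1 dp) => ->; rewrite opprK.
have cont_of F' f' : deriv_of F' f' -> cont_on h F'.
  by move=> H; exact: (continuous_cont_on (derive_continuous H)).
have cut1c := cont_of _ _ (@cutoff_derive _ c1 e).
have cut2c := cont_of _ _ (@cutoff_derive _ c2 e).
have dcut1c := cont_of _ _ (@dcutoff_derive _ c1 e).
have dcut2c := cont_of _ _ (@dcutoff_derive _ c2 e).
have ddcut1c := @ddcutoff_cont_on _ h c1 e.
have ddcut2c := @ddcutoff_cont_on _ h c2 e.
have m1c : cont_on h (fun z => 1 - cutoff c1 e z) by cont_tac.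
pose A1 := integ h (fun z => k z * (1 - cutoff c1 e z)).
pose A2 := integ h (fun z => k z * cutoff c2 e z).
pose B1 := integ h (fun z => om z * dcutoff c1 e z).
pose B2 := integ h (fun z => om z * dcutoff c2 e z).
pose E1 := integ h (fun z => F z * ddcutoff c1 e z).
pose E2 := integ h (fun z => F z * ddcutoff c2 e z).
(* Removing the interior identity [key] leaves [k] on the two edges (A1, A2), the terms in [chi1]
   with coefficient [om] (B1, B2) and those in [chi2] with coefficient [F] (E1, E2). In the limit
   the B terms cancel since [om] agrees at both ends, and the E terms since [F] has the same
   derivative [L] there. *)
have decomp : integ h (fun z => g2 z * zt z - u z * zt2 z) =
    A1 + A2 + (B1 - B2) + (E1 - E2).
  have : integ h (fun z => g2 z * p z - u z * p2 z) = 0.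
    rewrite integB ?key ?subrr//; last by apply/cont_on_integrable/cont_onM => //;
      exact: continuous_cont_on.
    by apply: L2M => //; apply: cont_on_L2; exact: C1c_cont pT.
  have kAi : integrable_on h (fun z => k z * (1 - cutoff c1 e z)).
    exact/L2_integrable/L2_cont.
  have kBi : integrable_on h (fun z => k z * cutoff c2 e z).
    exact/L2_integrable/L2_cont.
  have Bi : integrable_on h (fun z => om z * dcutoff c1 e z - om z * dcutoff c2 e z).
    by int_tac.
  have Ei : integrable_on h (fun z => F z * ddcutoff c1 e z - F z * ddcutoff c2 e z).
    by int_tac.
  have ABi := integrableD_on kAi kBi.
  have S : integ h (fun z => k z * (1 - cutoff c1 e z) + k z * cutoff c2 e z
      + (om z * dcutoff c1 e z - om z * dcutoff c2 e z)
      + (F z * ddcutoff c1 e z - F z * ddcutoff c2 e z)) =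
      A1 + A2 + (B1 - B2) + (E1 - E2).
    rewrite integD//; last exact: integrableD_on.
    rewrite integD// integD// !integB//; by int_tac.
  move=> Z; rewrite -S -[LHS]subr0 -Z -integB//; last first.
    apply: integrableB_on; first by apply: L2M => //; apply: cont_on_L2; exact: C1c_cont pT.
    by apply/cont_on_integrable/cont_onM => //; exact: continuous_cont_on.
  by apply: eq_integ => z _; rewrite /k /p /p2 /om /F /chi /chi1 /chi2 /window /dwindow /ddwindow c1E; ring.
have bA1 : `|A1| <= tau * (J + 4 * (M + 1) ^+ 2).
  apply: (@edge_bound _ h k _ 0) => //.
  - move=> z; have := ler_normB 1 (cutoff c1 e z); have := cutoff_norm c1 e z.
    by rewrite normr1; clear; lra.
  - move=> z /andP[z0 zh]; rewrite (ltW z0)/= add0r -/e -ltNge => ze.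
    by rewrite cutoff_ge ?subrr// /c1; clear -ze; lra.
have bA2 : `|A2| <= tau * (J + 4 * (M + 1) ^+ 2).
  apply: (@edge_bound _ h k _ c2) => //.
  - by move=> z; have := cutoff_norm c2 e z; clear; lra.
  - move=> z /andP[z0 zh]; rewrite -/e negb_and -!ltNge => /orP[ze|ze].
      by rewrite cutoff_le// ltW.
    by move: ze; rewrite /c2; clear -zh; lra.
have omi := cont_on_integrable omc.
have bB1 : `|B1 - om 0| <= 3 * M * kappa.
  apply: mollify => //; [exact: ltW|by int_tac|].
  move=> z /andP[z0 zh] /andP[z1 z2]; apply: D1; first by rewrite !ltW.
  by rewrite /c1 in z1 z2; rewrite subr0 gtr0_norm//; clear -z1 z2 e0 e1; lra.
have bB2 : `|B2 - om h| <= 3 * M * kappa.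
  apply: mollify => //; [exact: ltW|by int_tac|].
  move=> z /andP[z0 zh] /andP[z1 z2]; apply: D2; first by rewrite !ltW.
  rewrite /c2 in z1 z2; rewrite ler0_norm; clear -z1 z2 zh e0 e2; lra.
have bE1 : `|E1 + L| <= 3 * M * kappa.
  apply: (mollify2 h0 e0 c10 c1h (p := 0)) => //; first exact: ltW.
  move=> z /andP[z0 zh] /andP[z1 z2].
  have zz : `|z - 0| <= 4 * e by rewrite /c1 in z1 z2; rewrite subr0 gtr0_norm//; clear -z1 z2 e0 e1; lra.
  apply: le_trans (D3 z _ _) _; first by apply/in_cc; rewrite !ltW.
    by apply: le_lt_trans zz _; clear -e0 e3 e4; lra.
  by apply: le_trans (ler_wpM2l (ltW k40) zz) _; rewrite mulrA divfK.
have bE2 : `|E2 + L| <= 3 * M * kappa.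
  apply: (mollify2 h0 e0 c20 c2h (p := h)) => //; first exact: ltW.
  move=> z /andP[z0 zh] /andP[z1 z2].
  have zz : `|z - h| <= 4 * e by rewrite /c2 in z1 z2; rewrite ler0_norm; clear -z1 z2 zh e0 e2; lra.
  apply: le_trans (D4 z _ _) _; first by apply/in_cc; rewrite !ltW.
    by apply: le_lt_trans zz _; clear -e0 e3 e4; lra.
  by apply: le_trans (ler_wpM2l (ltW k40) zz) _; rewrite mulrA divfK.
have omE : om 0 = om h by rewrite /om u0h z10h.
rewrite decomp; clear decomp.
move: bA1 bA2 bB1 bB2 bE1 bE2 tJ; rewrite omE k24 !ler_norml.
set T := tau * _; clearbody T A1 A2 B1 B2 E1 E2; clear -eta0.
by move: (om h) => oh; lra.
Unshelve. all: by end_near. Qed.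

End PeriodicParts.

(** * Reformulation of the system *)

Section Smooth.
Context {R : realType} (h : R).
Hypothesis h0 : 0 < h.
Implicit Types f g k u v F G m : R -> R.

Lemma integ_wD_sqr u g : is_wderiv h u g ->
  integ h (fun z => wD h u z ^+ 2) = integ h (fun z => g z ^+ 2).
Proof.
move=> ug; have [_ wL _] := wD_spec ug; have [_ gL _] := ug.
transitivity (integ h (fun z => wD h u z * wD h u z)).
  by apply: eq_integ => z _; rewrite expr2.
rewrite (wD_unique h0 ug wL); transitivity (integ h (fun z => wD h u z * g z)).
  by apply: eq_integ => z _; rewrite mulrC.
by rewrite (wD_unique h0 ug gL); apply: eq_integ => z _; rewrite expr2.
Qed.

Section C2function.
Variables F F1 F2 : R -> R.
Hypotheses (dF : deriv_of F F1) (dF1 : deriv_of F1 F2) (F2c : cont_on h F2).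

Lemma C1_cont_on : cont_on h F.
Proof. exact: (continuous_cont_on (derive_continuous dF)). Qed.

Let F1c : cont_on h F1.
Proof. exact: (continuous_cont_on (derive_continuous dF1)). Qed.

Let F_wderiv : is_wderiv h F F1. Proof. exact: deriv_is_wderiv. Qed.
Let F1_wderiv : is_wderiv h F1 F2. Proof. exact: deriv_is_wderiv. Qed.

Lemma C2_W12 : W12 h F.
Proof. by split; [exact: C1_cont_on|exists F1]. Qed.

(** [wD h F] agrees with [F1] only up to a null set, but a weak derivative sees its function only
    under integrals, where [wD_unique] applies. *)
Lemma C2_wD_wderiv : is_wderiv h (wD h F) F2.
Proof.
have [_ wL _] := wD_spec F_wderiv; have [_ F2L H] := F1_wderiv.
split => // phi phiT; rewrite -H// (wD_unique h0 F_wderiv)//.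
exact: cont_on_L2 (C1c_derive1_cont phiT).
Qed.

Lemma C2_W22 : W22 h F.
Proof. by split; [exact: C2_W12|exists F2; exact: C2_wD_wderiv]. Qed.

Lemma C2_wD2_integ m : L2 h m ->
  integ h (fun z => wD h (wD h F) z * m z) = integ h (fun z => F2 z * m z).
Proof. exact: wD_unique C2_wD_wderiv. Qed.

Lemma C2_norm_le B : 0 <= B -> (forall z, 0 <= z <= h ->
    [/\ `|F z| <= B, `|F1 z| <= B & `|F2 z| <= B]) ->
  normW22 h F <= B * Num.sqrt (3 * h).
Proof.
move=> B0 HB; rewrite /normW22 (integ_wD_sqr F_wderiv) (integ_wD_sqr C2_wD_wderiv).
have sq G : cont_on h G -> (forall z, 0 <= z <= h -> `|G z| <= B) ->
    integ h (fun z => G z ^+ 2) <= B ^+ 2 * h.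
  move=> Gc GB; apply: le_trans (ler_norm _) _; apply: norm_integ_le => //.
    exact/cont_on_integrable/cont_onX.
  move=> z /andP[z0 zh]; rewrite normrX ler_pXn2r ?nnegrE//; apply: GB.
  by rewrite !ltW.
have Fc := C1_cont_on.
have H : integ h (fun z => F z ^+ 2) + integ h (fun z => F1 z ^+ 2) +
   integ h (fun z => F2 z ^+ 2) <= B ^+ 2 * (3 * h).
  have -> : B ^+ 2 * (3 * h) = B ^+ 2 * h + B ^+ 2 * h + B ^+ 2 * h by ring.
  by apply: lerD; [apply: lerD|]; apply: sq => // z /HB[].
apply: le_trans (ler_wsqrtr H) _.
by rewrite sqrtrM ?sqr_ge0// sqrtr_sqr ger0_norm.
Qed.

Lemma C2_Wrho : F 0 = F h -> F1 0 = F1 h -> F2 0 = F2 h -> Wrho h F.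
Proof.
move=> e0 e1 e2; split => //; first exact: C2_W22.
exists F1; split => //; first by move=> z _; exact: is_derive_has_deriv.
exists (F2 0); split; first exact: is_derive_has_deriv.
by rewrite e2; exact: is_derive_has_deriv.
Qed.

Lemma C2_V : F 0 = 0 -> F h = 0 -> F1 0 = F1 h -> F2 0 = F2 h -> V h F.
Proof.
move=> e0 eh e1 e2; split; first by apply: C2_Wrho => //; rewrite eh.
by split => //; exact: C2_W12.
Qed.

End C2function.

Lemma Wrho_ibp u zt zt1 zt2 : Wrho h u ->
  deriv_of zt zt1 -> deriv_of zt1 zt2 -> continuous zt2 ->
  zt 0 = zt h -> zt1 0 = zt1 h ->
  integ h (fun z => wD h (wD h u) z * zt z) = integ h (fun z => u z * zt2 z).
Proof.
move=> [uW u0h [v [dv v0h _]]] d d1 c e e1.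
apply: (@periodic_ibp _ h h0 u v (v 0) (v h) zt zt1 zt2) => //.
  by apply: dv; rewrite lexx ltW.
by apply: dv; rewrite lexx ltW.
Qed.

Lemma W22_wD2_L2 u : W22 h u -> L2 h (wD h (wD h u)).
Proof. by case=> _ [g /wD_spec[]]. Qed.

Lemma W12_wD_L2 u : W12 h u -> L2 h (wD h u).
Proof. by case=> _ [g /wD_spec[]]. Qed.

Lemma W12_sup u y : W12 h u -> 0 <= y <= h ->
  u y ^+ 2 <= sup_const h * normW12 h u ^+ 2.
Proof.
move=> [uc [g /wD_spec ug]] yI; have := sobolev_sup h0 uc ug yI.
rewrite /normW12 sqr_sqrtr//.
by apply: addr_ge0; apply: integ_ge0 => z _; exact: sqr_ge0.
Qed.

Lemma normW12_sqr u : normW12 h u ^+ 2 =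
  integ h (fun z => u z ^+ 2) + integ h (fun z => wD h u z ^+ 2).
Proof.
rewrite /normW12 sqr_sqrtr//.
by apply: addr_ge0; apply: integ_ge0 => z _; exact: sqr_ge0.
Qed.

Lemma normW22_sqr u : normW22 h u ^+ 2 =
  integ h (fun z => u z ^+ 2) + integ h (fun z => wD h u z ^+ 2)
  + integ h (fun z => wD h (wD h u) z ^+ 2).
Proof.
have I0 k : 0 <= integ h (fun z => k z ^+ 2).
  by apply: integ_ge0 => z _; exact: sqr_ge0.
rewrite /normW22; move: (I0 u) (I0 (wD h u)) (I0 (wD h (wD h u))).
move: (integ h _) (integ h _) (integ h _) => a b c a0 b0 c0.
by rewrite sqr_sqrtr// addr_ge0// addr_ge0.
Qed.

Lemma eq_W12 u v : (forall z, 0 <= z <= h -> u z = v z) -> W12 h u -> W12 h v.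
Proof.
move=> uv [uc [g ug]]; split; first exact: eq_cont_on uv uc.
by exists g; apply: eq_is_wderiv ug => z /andP[z0 zh]; apply: uv; rewrite !ltW.
Qed.

Let oo (u v : R -> R) : (forall z, 0 <= z <= h -> u z = v z) ->
  forall z, 0 < z < h -> u z = v z.
Proof. by move=> uv z /andP[z0 zh]; apply: uv; rewrite !ltW. Qed.

Lemma eq_Wtheta u v : (forall z, 0 <= z <= h -> u z = v z) ->
  Wtheta h u -> Wtheta h v.
Proof.
move=> uv [uW ub d0 dh]; split.
- exact: eq_W12 uW.
- by move=> z zI; rewrite -uv//; exact: ub.
- by apply: has_deriv_eq d0 => //; rewrite lexx ltW.
- by apply: has_deriv_eq dh => //; rewrite lexx ltW.
Qed.

Lemma eq_Wrho u v : (forall z, 0 <= z <= h -> u z = v z) -> Wrho h u -> Wrho h v.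
Proof.
move=> uv [[uW uD] u0h [w [dw w0h l]]]; split.
- by split; [exact: eq_W12 uW|rewrite -(eq_wD (oo uv))].
- by rewrite -!uv ?lexx ?ltW.
- exists w; split => // z zI; apply: (has_deriv_eq zI uv); exact: dw.
Qed.

Lemma eq_EL (k1 sigma lam1 lam2 f q theta0 d : R) th1 th2 u v :
  (forall z, 0 <= z <= h -> th1 z = th2 z) ->
  (forall z, 0 <= z <= h -> u z = v z) ->
  EL h k1 sigma lam1 lam2 f q theta0 d th1 u ->
  EL h k1 sigma lam1 lam2 f q theta0 d th2 v.
Proof.
move=> th uv [W1 W2 E1 E2]; split.
- exact: eq_Wtheta W1.
- exact: eq_Wrho W2.
- move=> psi /E1; rewrite /weak_eq_theta -(eq_wD (oo th)) -(eq_wD (oo uv)) => ->.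
  by apply: eq_integ => z zI; rewrite (oo th zI) (oo uv zI).
- move=> eta /E2; rewrite /weak_eq_rho -(eq_wD (oo uv)) => ->.
  by congr (_ + _ + _); apply: eq_integ => z zI; rewrite ?(oo th zI) ?(oo uv zI).
Qed.

Lemma cst0_wderiv : is_wderiv h (fun=> 0) (fun=> 0).
Proof.
apply: deriv_is_wderiv => //; last exact: cst_cont_on.
by move=> z; exact: is_derive_cst.
Qed.

Lemma Wtheta0 : Wtheta h (fun=> 0).
Proof.
have d z : has_deriv h (fun=> 0) z 0.
  by apply: is_derive_has_deriv; exact: is_derive_cst.
split => //.
- by split; [exact: cst_cont_on|exists (fun=> 0); exact: cst0_wderiv].
- by move=> z _; rewrite oppr_le0 andbb divr_ge0// pi_ge0.
Qed.

Definition weak_smectic (lam q mu f : R) u := forall eta, Wrho h eta ->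
  integ h (fun z => 2 * lam * wD h (wD h u) z * wD h (wD h eta) z)
  + integ h (fun z => (4 * lam * q ^+ 2 * wD h (wD h u) z
       + 2 * lam * q ^+ 4 * u z) * eta z) =
  integ h (fun z => (mu * u z - f * u z ^+ 3) * eta z).

(** With a zero sine, the only term in [lam2] that survives is proportional to [u] and merges with
    [d]. The first equation becomes trivial because the weak derivative of 0 is null against every
    square-integrable function. *)
Lemma EL_theta0 (k1 sigma lam1 lam2 f q theta0 d : R) u :
  EL h k1 sigma lam1 lam2 f q theta0 d (fun=> 0) u <->
  Wrho h u /\
    weak_smectic lam1 q (- (2 * lam2 * q ^+ 4 * cos theta0 ^+ 4) - d) f u.
Proof.
have red eta : Wrho h u -> Wrho h eta ->
   weak_eq_rho h lam1 lam2 f q theta0 d (fun=> 0) u eta <->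
   integ h (fun z => 2 * lam1 * wD h (wD h u) z * wD h (wD h eta) z)
   + integ h (fun z => (4 * lam1 * q ^+ 2 * wD h (wD h u) z
       + 2 * lam1 * q ^+ 4 * u z) * eta z) =
   integ h (fun z => ((- (2 * lam2 * q ^+ 4 * cos theta0 ^+ 4) - d) * u z
      - f * u z ^+ 3) * eta z).
  move=> [uW _ _] [eW _ _]; rewrite /weak_eq_rho sin0.
  have uc : cont_on h u by case: uW => [[]].
  have ec : cont_on h eta by case: eW => [[]].
  have uL := W22_wD2_L2 uW.
  set w := wD h (wD h u) in uL *; set e2 := wD h (wD h eta).
  set c0 := cos theta0.
  have e1 : integ h (fun z => 2 * lam2 * (0 ^+ 4 * w z) * e2 z) = 0.
    by apply: etrans (integ0 h); apply: eq_integ => z _; ring.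
  rewrite e1 addr0.
  pose P z := (4 * lam1 * q ^+ 2 * w z + 2 * lam1 * q ^+ 4 * u z) * eta z.
  pose Q z := ((- (2 * lam2 * q ^+ 4 * c0 ^+ 4) - d) * u z - f * u z ^+ 3) * eta z.
  have Pi : integrable_on h P.
    have eL := cont_on_L2 ec.
    apply: L2M => //; apply: L2D; first exact: L2Z.
    by apply: cont_on_L2; cont_tac.
  have Qi : integrable_on h Q by rewrite /Q; int_tac.
  pose A z := 2 * lam2 * (q ^+ 4 * c0 ^+ 4 * u z * eta z).
  have Ai : integrable_on h A by rewrite /A; int_tac.
  pose B z := (d * u z + f * u z ^+ 3 + 4 * lam1 * q ^+ 2 * w z
    + 2 * lam1 * q ^+ 4 * u z) * eta z.
  have BE : integ h B + integ h A = integ h P - integ h Q.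
    have Bi : integrable_on h B.
      apply: (@eq_integrable_on _ h (fun z => P z - Q z - A z)).
        by move=> z _; rewrite /P /Q /A /B; ring.
      by apply: integrableB_on => //; exact: integrableB_on.
    rewrite -integD// -integB//; apply: eq_integ => z _.
    by rewrite /P /Q /A /B; ring.
  have -> : integ h (fun z => 2 * lam2 *
      (q ^+ 2 * c0 ^+ 2 * w z * 0 ^+ 2 * eta z
       + q ^+ 2 * c0 ^+ 2 * (0 ^+ 2 * u z) * e2 z
       + q ^+ 4 * c0 ^+ 4 * u z * eta z)) = integ h A.
    by apply: eq_integ => z _; rewrite /A; ring.
  rewrite -/B BE -/P -/Q; split; lra.
split.
- move=> [_ uW _ H]; split => // eta eW; apply/red => //; exact: H.
- move=> [uW H]; split => //; first exact: Wtheta0; last first.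
    by move=> eta eW; apply/red => //; exact: H.
  move=> psi /W12_wD_L2 pL; rewrite /weak_eq_theta.
  have -> : integ h (fun z => 2 * k1 * wD h (fun=> 0) z * wD h psi z) = 0.
    transitivity (integ h (fun z => wD h (fun=> 0) z * (2 * k1 * wD h psi z))).
      by apply: eq_integ => z _; ring.
    rewrite (wD_unique h0 cst0_wderiv); last exact: L2Z.
    by apply: etrans (integ0 h); apply: eq_integ => z _; rewrite mul0r.
  rewrite oppr0; apply/esym; apply: etrans (integ0 h); apply: eq_integ => z _.
  by rewrite mulr0 sin0; ring.
Qed.

End Smooth.

(** * Power series *)

Section GeometricSeries.
Context {R : realType}.
Implicit Types (a b c : nat -> R) (A B C th : R) (n k : nat).

Definition partial c n : R := \sum_(k < n) c k.
Definition Sum c : R := limn (partial c).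

Lemma partialS c n : partial c n.+1 = partial c n + c n.
Proof. by rewrite /partial big_ord_recr. Qed.

Definition geo C th c := forall k, `|c k| <= C * th ^+ k.

Lemma geo_ge0 C th c : geo C th c -> 0 <= C.
Proof. by move=> /(_ 0%N); rewrite expr0 mulr1; exact: le_trans. Qed.

Lemma le_geo C C' th th' c : geo C th c -> C <= C' -> 0 <= th -> th <= th' ->
  geo C' th' c.
Proof.
move=> H CC th0 tt k; apply: le_trans (H k) _; apply: ler_pM => //.
- exact: geo_ge0 H.
- exact: exprn_ge0.
- by apply: lerXn2r => //; rewrite nnegrE// (le_trans th0).
Qed.

Section Converge.
Variables (C th : R) (c : nat -> R).
Hypotheses (th0 : 0 <= th) (th1 : th < 1) (H : geo C th c).

(** The remainder of the dominating geometric series; by [tailS] the bounds on successive terms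
    telescope. *)
Let tail n := C * th ^+ n / (1 - th).

Let tailS n : tail n = C * th ^+ n + tail n.+1.
Proof. by rewrite /tail exprS; field; rewrite subr_eq0 gt_eqF. Qed.

Let tail_ge0 n : 0 <= tail n.
Proof.
apply: divr_ge0; last by rewrite subr_ge0 ltW.
by apply: mulr_ge0; [exact: geo_ge0 H|exact: exprn_ge0].
Qed.

Lemma partial_diff n k : `|partial c (n + k) - partial c n| <= tail n - tail (n + k).
Proof.
elim: k => [|k IH]; first by rewrite addn0 !subrr normr0.
rewrite addnS partialS.
have -> : partial c (n + k) + c (n + k)%N - partial c n =
  (partial c (n + k) - partial c n) + c (n + k)%N by ring.
apply: le_trans (ler_normD _ _) _; have := H (n + k); have := tailS (n + k); lra.
Qed.

Lemma exprn_cvg0 : th ^+ n @[n --> \oo] --> (0 : R).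
Proof. by apply: cvg_expr; rewrite ger0_norm. Qed.

Lemma tail_cvg0 : tail n @[n --> \oo] --> (0 : R).
Proof.
have -> : tail = fun n => (C / (1 - th)) * th ^+ n.
  by apply/funext => n; rewrite /tail mulrAC.
by rewrite -(mulr0 (C / (1 - th))); apply: cvgM; [exact: cvg_cst|exact: exprn_cvg0].
Qed.

Lemma partial_cvg : partial c n @[n --> \oo] --> Sum c.
Proof.
suff : cvgn (partial c) by [].
have -> : partial c = series c.
  by apply/funext => n; rewrite /partial /series/= big_mkord.
apply: normed_cvg.
apply: (@series_le_cvg _ _ (fun k => C * th ^+ k)).
- by move=> k; exact: normr_ge0.
- by move=> k; apply: mulr_ge0; [exact: geo_ge0 H|exact: exprn_ge0].
- exact: H.
- by apply: is_cvg_geometric_series; rewrite ger0_norm.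
Qed.

Lemma Sum_approx n : `|Sum c - partial c n| <= C * th ^+ n / (1 - th).
Proof.
have cv : `|partial c m - partial c n| @[m --> \oo] --> `|Sum c - partial c n|.
  by apply: cvg_norm; apply: cvgB; [exact: partial_cvg|exact: cvg_cst].
apply: (@cvgr_to_le _ _ _ _ _ _ _ cv); near=> m.
have nm : (n <= m)%N by near: m; exact: nbhs_infty_ge.
have := partial_diff n (m - n); rewrite subnKC// => Hm.
by apply: le_trans Hm _; rewrite gerBl.
Unshelve. all: by end_near. Qed.

Lemma Sum_norm : `|Sum c| <= C / (1 - th).
Proof. by have := Sum_approx 0; rewrite /partial big_ord0 subr0 expr0 mulr1. Qed.

(** A geometric error bound identifies the sum. This is how integrals, Cauchy products and the Green
    operator are interchanged with [Sum]. *)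
Lemma Sum_unique X C' : (forall n, `|X - partial c n| <= C' * th ^+ n) -> X = Sum c.
Proof.
move=> HX; apply/eqP; rewrite -subr_eq0 -normr_eq0; apply/eqP/le_anti.
rewrite normr_ge0 andbT.
have cv : (C' + C / (1 - th)) * th ^+ n @[n --> \oo] --> (C' + C / (1 - th)) * 0.
  by apply: cvgM; [exact: cvg_cst|exact: exprn_cvg0].
rewrite mulr0 in cv; apply: (@cvgr_to_ge _ _ _ _ _ _ _ cv); apply: nearW => n.
have := Sum_approx n; have := HX n; rewrite mulrDl mulrAC.
have := ler_normB (X - partial c n) (Sum c - partial c n).
rewrite (_ : X - partial c n - (Sum c - partial c n) = X - Sum c); last by ring.
lra.
Qed.

End Converge.

Lemma eq_Sum a b : a =1 b -> Sum a = Sum b.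
Proof. by move=> /funext ->. Qed.

Lemma Sum_linear A B th a b x : 0 <= th -> th < 1 -> geo A th a -> geo B th b ->
  Sum (fun k => a k + x * b k) = Sum a + x * Sum b.
Proof.
move=> th0 th1 Ha Hb; apply: cvg_lim => //.
have -> : partial (fun k => a k + x * b k) = fun n => partial a n + x * partial b n.
  by apply/funext => n; rewrite /partial big_split/= mulr_sumr.
apply: cvgD; first exact: partial_cvg Ha.
by apply: cvgM; [exact: cvg_cst|exact: partial_cvg Hb].
Qed.

Lemma SumZ A th a x : 0 <= th -> th < 1 -> geo A th a ->
  Sum (fun k => x * a k) = x * Sum a.
Proof.
move=> th0 th1 Ha; apply: cvg_lim => //.
have -> : partial (fun k => x * a k) = fun n => x * partial a n.
  by apply/funext => n; rewrite /partial mulr_sumr.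
by apply: cvgM; [exact: cvg_cst|exact: partial_cvg Ha].
Qed.

Lemma Sum_shift A th a : 0 <= th -> th < 1 -> geo A th a ->
  Sum a = a 0%N + Sum (fun k => a k.+1).
Proof.
move=> th0 th1 Ha.
have Ha1 : geo (A * th) th (fun k => a k.+1).
  by move=> k; rewrite -mulrA -exprS; exact: Ha.
have c1 : partial a n.+1 @[n --> \oo] --> Sum a.
  by have := partial_cvg th0 th1 Ha; rewrite -cvg_shiftS.
have c2 : partial a n.+1 @[n --> \oo] --> a 0%N + Sum (fun k => a k.+1).
  have -> : (fun n => partial a n.+1) = fun n => a 0%N + partial (fun k => a k.+1) n.
    by apply/funext => n; rewrite /partial big_ord_recl.
  by apply: cvgD; [exact: cvg_cst|exact: partial_cvg Ha1].
exact: (cvg_unique _ c1 c2).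
Qed.

Definition cprod a b k : R := \sum_(i < k.+1) a i * b (k - i)%N.

Lemma partial_cprod a b n :
  partial (cprod a b) n = \sum_(i < n) a i * partial b (n - i).
Proof.
elim: n => [|n IH]; first by rewrite /partial !big_ord0.
rewrite partialS IH.
transitivity (\sum_(i < n.+1) (a i * partial b (n - i) + a i * b (n - i)%N)).
  rewrite big_split/= /cprod; congr (_ + _).
  have p0 : partial b 0 = 0 by rewrite /partial big_ord0.
  by rewrite big_ord_recr/= subnn p0 mulr0 addr0.
by apply: eq_bigr => i _; rewrite -mulrDr -partialS subSn// -ltnS.
Qed.

(** [th ^+ n] is at most each of the [n] terms of the geometric sum. *)
Lemma nat_expr_le th n : 0 <= th -> th < 1 -> n%:R * th ^+ n <= (1 - th)^-1.
Proof.
move=> th0 th1; have p : 0 < 1 - th by rewrite subr_gt0.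
have le1 i : (i <= n)%N -> th ^+ n <= th ^+ i.
  by move=> i_n; apply: ler_wiXn2l => //; exact: ltW.
have : n%:R * th ^+ n <= \sum_(i < n) th ^+ i.
  have -> : n%:R * th ^+ n = \sum_(i < n) th ^+ n.
    by rewrite sumr_const card_ord mulr_natl.
  by apply: ler_sum => i _; apply: le1; exact: ltnW.
move=> /le_trans; apply; rewrite -[leRHS]mul1r ler_pdivlMr// mulrC.
have -> : (1 - th) * \sum_(i < n) th ^+ i = 1 - th ^+ n.
  rewrite -[1 in RHS](expr1n _ n) subrXX; congr (_ * _).
  by apply: eq_bigr => i _; rewrite expr1n mul1r.
by rewrite gerBl exprn_ge0.
Qed.

(** The error of the truncated product has [n] terms of size [th ^+ n]. Passing to the ratio
    [Num.sqrt th] absorbs the factor [n] and restores a geometric bound, as [Sum_unique] demands. *)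
Lemma Sum_cprod A B D th a b : 0 < th -> th < 1 -> geo A th a -> geo B th b ->
  geo D th (cprod a b) -> Sum (cprod a b) = Sum a * Sum b.
Proof.
move=> th0 th1 Ha Hb Hc; have t0 := ltW th0.
pose ph := Num.sqrt th.
have ph0 : 0 <= ph by exact: sqrtr_ge0.
have ph2 : ph ^+ 2 = th by rewrite sqr_sqrtr.
have ph1 : ph < 1 by rewrite -sqrtr1 ltr_sqrt.
have [A0 B0] := (geo_ge0 Ha, geo_ge0 Hb).
have p : 0 < 1 - th by rewrite subr_gt0.
have thph : th <= ph.
  by rewrite -ph2 expr2 ger_pMl ?ltW// sqrtr_gt0.
have Hc' : geo D ph (cprod a b) by apply: le_geo Hc _ _ _.
apply/esym; apply: (Sum_unique ph0 ph1 Hc'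
  (C' := A * B / (1 - th) * (1 - ph)^-1 + A / (1 - th) * `|Sum b|)) => n.
have -> : Sum a * Sum b - partial (cprod a b) n =
   (\sum_(i < n) a i * (Sum b - partial b (n - i))) + (Sum a - partial a n) * Sum b.
  rewrite partial_cprod mulrBl; set X := Sum a * Sum b.
  have -> : \sum_(i < n) a i * (Sum b - partial b (n - i)) =
      partial a n * Sum b - \sum_(i < n) a i * partial b (n - i).
    rewrite /partial mulr_suml -sumrB; apply: eq_bigr => i _; exact: mulrBr.
  by ring.
rewrite [leRHS]mulrDl; apply: le_trans (ler_normD _ _) _; apply: lerD; last first.
  rewrite normrM mulrAC ler_wpM2r//; apply: le_trans (Sum_approx t0 th1 Ha n) _.
  rewrite mulrAC ler_wpM2l//; first by rewrite divr_ge0// ltW.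
  by apply: lerXn2r; rewrite ?nnegrE.
apply: le_trans (ler_norm_sum _ _ _) _.
apply: (@le_trans _ _ (\sum_(i < n) A * B / (1 - th) * th ^+ n)).
  apply: ler_sum => i _; rewrite normrM.
  have -> : A * B / (1 - th) * th ^+ n =
      (A * th ^+ i) * (B * th ^+ (n - i) / (1 - th)).
    rewrite -[in LHS](subnKC (ltnW (ltn_ord i))) exprD; ring.
  by apply: ler_pM => //; exact: Sum_approx.
rewrite sumr_const card_ord -mulr_natr -!mulrA.
apply: ler_wpM2l => //; apply: ler_wpM2l => //.
apply: ler_wpM2l; first by rewrite invr_ge0 ltW.
rewrite -ph2 -exprM mulrC mul2n -addnn exprD mulrA mulrC [leRHS]mulrC.
rewrite ler_wpM2l ?exprn_ge0//; exact: nat_expr_le.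
Qed.

End GeometricSeries.

(** * Weighted bounds for Cauchy products *)

Section ConvBound.
Context {R : realType}.
Implicit Types (a b : nat -> R) (A B r : R) (k n i : nat).

(* The convolution of two sequences dominated by the weights [sqi] is dominated by
   a constant multiple of [sqi]. *)
Definition sqi i : R := i.+1%:R ^- 2.

Lemma sqi_gt0 i : 0 < sqi i.
Proof. by rewrite invr_gt0 exprn_gt0// ltr0n. Qed.

(** The bound is strengthened to [2 - m.+1%:R^-1], which telescopes. *)
Lemma sum_sqi n : \sum_(i < n) sqi i <= 2.
Proof.
suff H m : \sum_(i < m.+1) sqi i <= 2 - m.+1%:R^-1.
  case: n => [|n]; first by rewrite big_ord0.
  by apply: le_trans (H n) _; rewrite gerBl invr_ge0.
elim: m => [|m IH].
  by rewrite big_ord_recr/= big_ord0 /sqi; rewrite expr1n invr1; lra.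
rewrite big_ord_recr/=; apply: (@le_trans _ _ (2 - m.+1%:R^-1 + sqi m.+1)).
  by rewrite lerD2r.
rewrite /sqi -[m.+2%:R]natr1; set x : R := m.+1%:R.
have x0 : 0 < x by rewrite ltr0n.
have x1 : 0 < x + 1 by rewrite addr_gt0.
rewrite -subr_ge0.
have -> : 2 - (x + 1)^-1 - (2 - x^-1 + (x + 1) ^- 2) = x^-1 * (x + 1) ^- 2.
  by field; rewrite !gt_eqF.
by rewrite mulr_ge0 ?invr_ge0 ?exprn_ge0// ltW.
Qed.

(** The value is 2 * (2 + 2), from [cprod_kernel]: the convexity factor times two sums bounded by
    2. *)
Definition cprod_const : R := locked 8.

Lemma cprod_const_ge1 : 1 <= cprod_const.
Proof. by rewrite /cprod_const -lock; lra. Qed.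

(** The factors are the inverse squares of p and s with p + s = k + 2. As (p + s)^2 <= 2 (p^2 +
    s^2), their product is at most 2 / (k + 2)^2 times their sum, and the sums are bounded by
    [sum_sqi]. *)
Lemma cprod_kernel k : \sum_(i < k.+1) sqi i * sqi (k - i)%N <= cprod_const * sqi k.
Proof.
pose y : R := k.+2%:R.
have y0 : 0 < y by rewrite ltr0n.
have term (i : 'I_k.+1) : sqi i * sqi (k - i)%N <= 2 / y ^+ 2 * (sqi i + sqi (k - i)%N).
  rewrite /sqi; set p : R := i.+1%:R; set s : R := (k - i).+1%:R.
  have p0 : 0 < p by rewrite ltr0n.
  have s0 : 0 < s by rewrite ltr0n.
  have e : y = p + s.
    by rewrite /y /p /s -natrD addSn addnS subnKC// -ltnS.
  rewrite -subr_ge0.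
  have -> : 2 / y ^+ 2 * (p ^- 2 + s ^- 2) - p ^- 2 * s ^- 2 =
      (p - s) ^+ 2 * (p ^- 2 * s ^- 2 / y ^+ 2).
    rewrite e; clear e; clearbody p s; field; rewrite !gt_eqF ?addr_gt0//.
  by rewrite mulr_ge0 ?sqr_ge0// !mulr_ge0// invr_ge0 exprn_ge0// ltW.
have rv : \sum_(i < k.+1) sqi (k - i)%N = \sum_(i < k.+1) sqi i.
  by rewrite [RHS](reindex_inj rev_ord_inj)/=; apply: eq_bigr => i _; rewrite subSS.
apply: (@le_trans _ _ (\sum_(i < k.+1) 2 / y ^+ 2 * (sqi i + sqi (k - i)%N))).
  by apply: ler_sum => i _; exact: term.
rewrite -mulr_sumr big_split/= rv.
apply: (@le_trans _ _ (2 / y ^+ 2 * (2 + 2))).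
  apply: ler_wpM2l; first by rewrite divr_ge0// exprn_ge0// ltW.
  by apply: lerD; exact: sum_sqi.
rewrite /cprod_const -lock (_ : 2 / y ^+ 2 * (2 + 2) = 8 * y ^- 2); last first.
  by field; rewrite gt_eqF.
by rewrite ler_wpM2l// /sqi lef_pV2 ?posrE ?exprn_gt0// lerXn2r ?nnegrE// ?ler_nat// ltW.
Qed.

(** The range stops at [n] so that the bounds can be propagated through the recursion, when only the
    first coefficients are controlled. *)
Definition bd n A r a := forall i, (i <= n)%N -> `|a i| <= A * r ^+ i * sqi i.

Lemma cprod_bd n A B r a b : 0 <= A -> 0 <= B -> 0 <= r ->
  bd n A r a -> bd n B r b -> bd n (cprod_const * (A * B)) r (cprod a b).
Proof.
move=> A0 B0 r0 Ha Hb k kn; rewrite /cprod.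
apply: le_trans (ler_norm_sum _ _ _) _.
apply: (@le_trans _ _ (\sum_(i < k.+1) A * B * r ^+ k * (sqi i * sqi (k - i)%N))).
  apply: ler_sum => i _; rewrite normrM.
  have ik : (i <= k)%N by rewrite -ltnS.
  have -> : A * B * r ^+ k * (sqi i * sqi (k - i)%N) =
      (A * r ^+ i * sqi i) * (B * r ^+ (k - i) * sqi (k - i)%N).
    have rE : r ^+ k = r ^+ i * r ^+ (k - i) by rewrite -exprD subnKC.
    by rewrite rE; ring.
  apply: ler_pM => //; first by apply: Ha; exact: leq_trans kn.
  by apply: Hb; apply: leq_trans kn; exact: leq_subr.
rewrite -mulr_sumr.
have -> : cprod_const * (A * B) * r ^+ k * sqi k =
  A * B * r ^+ k * (cprod_const * sqi k) by ring.
apply: ler_wpM2l; first by rewrite !mulr_ge0// exprn_ge0.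
exact: cprod_kernel.
Qed.

Lemma bd_geo A r s a : 0 <= A -> 0 <= r -> 0 <= s -> (forall n, bd n A r a) ->
  geo A (r * s) (fun k => s ^+ k * a k).
Proof.
move=> A0 r0 s0 H k; rewrite normrM ger0_norm ?exprn_ge0// exprMn mulrCA mulrC.
rewrite [leRHS](_ : _ = A * r ^+ k * s ^+ k); last by ring.
rewrite ler_wpM2r ?exprn_ge0//; apply: le_trans (H k k (leqnn k)) _.
rewrite ler_piMr//; first by rewrite mulr_ge0// exprn_ge0.
by rewrite /sqi invf_le1 ?exprn_gt0// exprn_ege1// ler1n.
Qed.

Lemma cprod_scale s a b k :
  cprod (fun i => s ^+ i * a i) (fun i => s ^+ i * b i) k = s ^+ k * cprod a b k.
Proof.
rewrite /cprod mulr_sumr; apply: eq_bigr => i _.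
have ik : (i <= k)%N by rewrite -ltnS.
have sE : s ^+ k = s ^+ i * s ^+ (k - i) by rewrite -exprD subnKC.
by rewrite sE mulrACA.
Qed.

Lemma eq_cprod n a b a' b' : (forall i, (i <= n)%N -> a i = a' i) ->
  (forall i, (i <= n)%N -> b i = b' i) ->
  forall k, (k <= n)%N -> cprod a b k = cprod a' b' k.
Proof.
move=> aa bb k kn; apply: eq_bigr => i _; rewrite aa ?bb//.
  by apply: leq_trans kn; rewrite leq_subr.
by apply: leq_trans kn; rewrite -ltnS.
Qed.

End ConvBound.

(** * Derivatives of monomials *)

Section Monomials.
Context {R : realType}.
Implicit Types (t s r : R) (n e k : nat).

(** The [n]-th derivative of [t ^+ e]; when [n] exceeds [e] the falling factorial vanishes, so the
    truncated exponent is harmless. *)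
Definition mono n e t : R := (e ^_ n)%:R * t ^+ (e - n).

Lemma is_derive_pow e t : is_derive t (1 : R) (fun x => x ^+ e) (e%:R * t ^+ e.-1).
Proof.
elim: e => [|e IH].
  have -> : (fun x : R => x ^+ 0) = fun=> 1 by apply/funext => x; rewrite expr0.
  by apply: (is_derive_eq (is_derive_cst _ _ _)); rewrite mul0r.
have -> : (fun x : R => x ^+ e.+1) = fun x => x * x ^+ e.
  by apply/funext => x; rewrite exprS.
apply: (is_derive_eq (is_derive1M (is_derive_id t 1) IH)).
rewrite mul1r /=; case: e {IH} => [|e]; first by rewrite expr0 mul0r mulr0 addr0 mul1r.
by rewrite /= -[e.+2%:R]natr1 !exprS; ring.
Qed.

Lemma mono_derive n e : deriv_of (mono n e) (mono n.+1 e).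
Proof.
move=> t; apply: (is_derive_eq (is_derive1Z _ (is_derive_pow (e - n) t))).
by rewrite /mono ffactnSr natrM -subnS mulrA.
Qed.

Lemma mono_norm n e t r : `|t| <= r -> `|mono n e t| <= mono n e r.
Proof.
move=> tr; rewrite /mono normrM ger0_norm// normrX ler_wpM2l//.
by rewrite lerXn2r ?nnegrE// (le_trans _ tr).
Qed.

Lemma mono_bound n e (r r' : R) : 0 <= r -> r < r' ->
  mono n e r <= n`!%:R / (r' - r) ^+ n * r' ^+ e.
Proof.
move=> r0 rr; have d0 : 0 < r' - r by rewrite subr_gt0.
have [ne|en] := leqP n e; last first.
  rewrite /mono ffact_small// mul0r mulr_ge0 ?divr_ge0 ?exprn_ge0//; lra.
rewrite mulrAC ler_pdivlMr ?exprn_gt0// /mono -bin_ffact natrM.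
have : 'C(e, n)%:R * r ^+ (e - n) * (r' - r) ^+ n <= r' ^+ e.
  rewrite (_ : r' ^+ e = (r + (r' - r)) ^+ e); last by rewrite subrKC.
  rewrite [leRHS]exprDn.
  have ne' : (n < e.+1)%N by [].
  rewrite (bigD1 (Ordinal ne'))//= -mulrA mulr_natl lerDl sumr_ge0// => i _.
  by rewrite mulrn_wge0// mulr_ge0// exprn_ge0// ltW.
move=> H; rewrite [leLHS](_ : _ = n`!%:R *
  ('C(e, n)%:R * r ^+ (e - n) * (r' - r) ^+ n)); last by ring.
by rewrite ler_wpM2l.
Qed.

Lemma derive_norm_le_ball (F f : R -> R) B r x y : deriv_of F f ->
  `|x| <= r -> `|y| <= r ->
  (forall z, `|z| <= r -> `|z - x| <= `|y - x| -> `|f z| <= B) ->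
  `|F y - F x| <= B * `|y - x|.
Proof.
move=> Ff xr yr H; have [xy|/ltW yx] := leP x y.
  rewrite [`|y - x|]ger0_norm ?subr_ge0//; apply: (derive_norm_le Ff xy) => z /andP[z1 z2].
  apply: H; first by move: xr yr; rewrite !ler_norml; lra.
  by rewrite !ger0_norm; lra.
rewrite [`|F y - F x|]distrC [`|y - x|]distrC [`|x - y|]ger0_norm ?subr_ge0//.
apply: (derive_norm_le Ff yx) => z /andP[z1 z2].
apply: H; first by move: xr yr; rewrite !ler_norml; lra.
by rewrite !ler0_norm; lra.
Qed.

(** The mean value estimate is applied twice, first to the derivative and then to the function minus
    its linear part. *)
Lemma mono_taylor n e t s r : `|t| <= r -> `|t + s| <= r ->
  `|mono n e (t + s) - mono n e t - s * mono n.+1 e t| <= s ^+ 2 * mono n.+2 e r.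
Proof.
move=> tr tsr.
pose F x := mono n e x - x * mono n.+1 e t.
have dF : deriv_of F (fun x => mono n.+1 e x - mono n.+1 e t).
  move=> x; have dm := is_derive1M (is_derive_id x 1)
    (is_derive_cst (mono n.+1 e t) x (1 : R)).
  by apply: (is_derive_eq (is_derive1B (mono_derive n e x) dm)); rewrite /=; ring.
have -> : mono n e (t + s) - mono n e t - s * mono n.+1 e t = F (t + s) - F t.
  by rewrite /F; ring.
have st : t + s - t = s by ring.
apply: le_trans (derive_norm_le_ball (B := `|s| * mono n.+2 e r) dF tr tsr _) _.
  rewrite st => z zr zs; apply: (@le_trans _ _ (mono n.+2 e r * `|z - t|)).
    by apply: (derive_norm_le_ball (@mono_derive n.+1 e) tr zr) => w wr _; exact: mono_norm.
  rewrite mulrC ler_wpM2r//.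
  by apply: le_trans (mono_norm n.+2 e zr).
by rewrite st -(real_normK (num_real s)) le_eqVlt; apply/orP; left; apply/eqP; ring.
Qed.

End Monomials.

(** * Series of functions *)

Section FunctionSeries.
Context {R : realType} (h : R).
Hypothesis h0 : 0 < h.
Variables (N : nat -> R -> R).
Hypothesis Nc : forall k, cont_on h (N k).

Definition fsum (b : nat -> R) z : R := Sum (fun k => b k * N k z).

Lemma cont_on_of_close (u : R -> R) : (forall x e, 0 <= x <= h -> 0 < e ->
  exists d, 0 < d /\ forall z, 0 <= z <= h -> `|z - x| < d -> `|u z - u x| <= e) ->
  cont_on h u.
Proof.
move=> H; apply/subspace_continuousP => x /in_cc xI.
apply/cvgrPdist_le => e e0; have [d [d0 dH]] := H x e xI e0.
rewrite near_withinE; apply/nbhs_ballP; exists d => //= z.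
rewrite /ball/= distrC => zx /in_cc zI; rewrite distrC; exact: dH.
Qed.

Lemma partial_cont_on (b : nat -> R) n :
  cont_on h (fun z => partial (fun k => b k * N k z) n).
Proof.
elim: n => [|n IH].
  have -> : (fun z => partial (fun k => b k * N k z) 0) = fun=> 0.
    by apply/funext => z; rewrite /partial big_ord0.
  exact: cst_cont_on.
have -> : (fun z => partial (fun k => b k * N k z) n.+1) =
    fun z => partial (fun k => b k * N k z) n + b n * N n z.
  by apply/funext => z; rewrite partialS.
by apply: cont_onD => //; exact: cont_onZ.
Qed.

Section Fixed.
Variables (b : nat -> R) (C th : R).
Hypotheses (th0 : 0 <= th) (th1 : th < 1).
Hypothesis H : forall z, 0 <= z <= h -> geo C th (fun k => b k * N k z).

Let C0 : 0 <= C.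
Proof. by apply: (geo_ge0 (H (z := 0) _)); rewrite lexx ltW. Qed.

Lemma fsum_cont_on : cont_on h (fsum b).
Proof.
apply: cont_on_of_close => x e xI e0.
have cv := tail_cvg0 C th0 th1.
have /cvgrPdist_le/(_ (e / 3)) := cv.
move=> /(_ ltac:(by rewrite divr_gt0)) [n _ /(_ n (leqnn n))] /=.
rewrite sub0r normrN => Hn.
have Hn' : C * th ^+ n / (1 - th) <= e / 3 by exact: le_trans (ler_norm _) Hn.
have e3 : 0 < e / 3 by rewrite divr_gt0.
have [d [d0 dH]] := cont_on_close (@partial_cont_on b n) xI e3.
exists d; split => // z zI /(dH _ zI).
have := Sum_approx th0 th1 (H zI) n; have := Sum_approx th0 th1 (H xI) n.
rewrite /fsum; move: Hn' (Sum _) (Sum _) (partial _ _) (partial _ _).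
move: (C * _ / _) => T TE s1 s2 p1 p2; rewrite !ler_norml; lra.
Qed.

Lemma integ_fsum (k : R -> R) : cont_on h k -> (forall z, `|k z| <= 1) ->
  integ h (fun z => fsum b z * k z) = Sum (fun i => b i * integ h (fun z => N i z * k z)).
Proof.
move=> kc k1; have fc := fsum_cont_on.
have G : geo (C * h) th (fun i => b i * integ h (fun z => N i z * k z)).
  move=> i; have Ni : cont_on h (N i) by exact: Nc.
  rewrite -integZ; last by int_tac.
  rewrite mulrAC; apply: norm_integ_le => //.
    by apply: cont_on_integrable; apply: cont_onZ; cont_tac.
  move=> z /andP[z0' zh]; rewrite mulrA normrM -[leRHS]mulr1.
  by apply: ler_pM => //; apply: H; rewrite !ltW.
apply: (Sum_unique th0 th1 G (C' := C / (1 - th) * h)) => n.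
have -> : partial (fun i => b i * integ h (fun z => N i z * k z)) n =
    integ h (fun z => partial (fun i => b i * N i z) n * k z).
  elim: n => [|n IH].
    rewrite /partial big_ord0; apply/esym; apply: etrans (integ0 h).
    by apply: eq_integ => z _; rewrite big_ord0 mul0r.
  have pc := @partial_cont_on b n; have Ni : cont_on h (N n) by exact: Nc.
  rewrite partialS IH -integZ; last by int_tac.
  rewrite -integD; [|by int_tac|]; last first.
    by apply: cont_on_integrable; apply: cont_onZ; cont_tac.
  by apply: eq_integ => z _; rewrite partialS; ring.
have pc := @partial_cont_on b n.
rewrite -integB; try by int_tac.
rewrite mulrAC; apply: norm_integ_le => //; first by int_tac.
move=> z /andP[z0' zh]; rewrite -mulrBl normrM -[leRHS]mulr1.
apply: ler_pM => //; rewrite [leRHS]mulrAC.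
by apply: Sum_approx => //; apply: H; rewrite !ltW.
Qed.

End Fixed.

End FunctionSeries.

(** * Formal solution *)

Section Branch.
Context {R : realType} (h q : R).
Hypotheses (h0 : 0 < h) (q0 : 0 < q).
Hypotheses (sin_qh : sin (q * h) = 0) (cos_qh : cos (q * h) = 1).
Implicit Types (g : R -> R) (z : R).

Local Notation S z := (sin (q * z)).
Local Notation C z := (cos (q * z)).

Definition green2 g := green h q (green h q g).
Definition dgreen2 g := dgreen h q (green h q g).
(** The second derivative of [green2 g] on the whole line; the clamp is invisible on [[0, h]]. *)
Definition ddgreen2 g z := green h q g (clamp h z) - q ^+ 2 * green2 g z.

(** The sum of the bounds for the function, its derivative and its second derivative, so that one
    constant serves all three. *)
Definition green_const : R :=
  (10 * h / q) ^+ 2 + 10 * h * (10 * h / q)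
  + (10 * h / q + q ^+ 2 * (10 * h / q) ^+ 2).

Let CK0 : 0 < 10 * h / q. Proof. by rewrite divr_gt0// mulr_gt0. Qed.
Let h10 : 0 < 10 * h. Proof. by rewrite mulr_gt0. Qed.

Lemma green_const_gt0 : 0 < green_const.
Proof.
apply: addr_gt0; last by apply: addr_gt0 => //; apply: mulr_gt0; exact: exprn_gt0.
by apply: addr_gt0; [exact: exprn_gt0|exact: mulr_gt0].
Qed.

Lemma green2_derive g : cont_on h g -> deriv_of (green2 g) (dgreen2 g).
Proof. by move=> gc; apply: green_derive => //; exact: green_cont_on. Qed.

Lemma dgreen2_derive g : cont_on h g -> deriv_of (dgreen2 g) (ddgreen2 g).
Proof. by move=> gc; apply: dgreen_derive => //; exact: green_cont_on. Qed.

Lemma green2_cont_on g : cont_on h g -> cont_on h (green2 g).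
Proof. by move=> gc; apply: green_cont_on => //; exact: green_cont_on. Qed.

Lemma ddgreen2_cont_on g : cont_on h g -> cont_on h (ddgreen2 g).
Proof.
move=> gc; apply: cont_onB.
  by apply/continuous_cont_on/cont_on_clamp => //; exact: green_cont_on.
by apply: cont_onZ; exact: green2_cont_on.
Qed.

Lemma green2_bound g B z : cont_on h g -> 0 <= B ->
  (forall z, 0 <= z <= h -> `|g z| <= B) -> 0 <= z <= h ->
  [/\ `|green2 g z| <= green_const * B, `|dgreen2 g z| <= green_const * B
    & `|ddgreen2 g z| <= green_const * B].
Proof.
move=> gc B0 gB zI; have kc := green_cont_on h0 q0 gc.
have kB y : 0 <= y <= h -> `|green h q g y| <= 10 * h / q * B.
  by move=> yI; exact: (green_bound h0 q0 gc).
have b1 := green_bound h0 q0 kc kB zI; have b2 := dgreen_bound h0 q0 kc kB zI.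
have b3 : `|ddgreen2 g z| <= 10 * h / q * B + q ^+ 2 * (10 * h / q * (10 * h / q * B)).
  rewrite /ddgreen2 clamp_id//; apply: le_trans (ler_normB _ _) _.
  apply: lerD; first exact: kB.
  by rewrite normrM ger0_norm ?sqr_ge0// ler_wpM2l// sqr_ge0.
have [p1 p2 p3] : [/\ 0 <= (10 * h / q) ^+ 2 * B, 0 <= 10 * h * (10 * h / q) * B
    & 0 <= (10 * h / q + q ^+ 2 * (10 * h / q) ^+ 2) * B].
  split; apply: mulr_ge0 => //; first exact: sqr_ge0.
    by rewrite mulr_ge0 ?ltW.
  by apply: addr_ge0; [exact: ltW|apply: mulr_ge0; exact: sqr_ge0].
have e : green_const * B = (10 * h / q) ^+ 2 * B + 10 * h * (10 * h / q) * B +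
  (10 * h / q + q ^+ 2 * (10 * h / q) ^+ 2) * B by rewrite /green_const; ring.
split; rewrite e.
- apply: le_trans b1 _; rewrite -addrA mulrA -expr2 lerDl addr_ge0//.
- apply: le_trans b2 _; rewrite mulrA -addrA addrCA lerDl addr_ge0//.
- apply: le_trans b3 _; rewrite [leLHS](_ : _ =
    (10 * h / q + q ^+ 2 * (10 * h / q) ^+ 2) * B); last by ring.
  by rewrite lerDr addr_ge0.
Qed.

Lemma eq_green2 f g : (forall z, 0 <= z <= h -> f z = g z) -> green2 f = green2 g.
Proof. by move=> fg; rewrite /green2 (eq_green q h0 fg). Qed.

Lemma green2_linear f g c z : cont_on h f -> cont_on h g ->
  green2 (fun z => f z + c * g z) z = green2 f z + c * green2 g z.
Proof.
move=> fc gc; rewrite /green2 -(green_linear h0 q0); try exact: green_cont_on.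
rewrite (@eq_green _ h q h0 _ (fun z => green h q f z + c * green h q g z)); first by [].
by move=> y _; exact: green_linear.
Qed.

Lemma green2_zero z : green2 (fun=> 0) z = 0.
Proof.
have c0 : cont_on h (fun=> 0) by exact: cst_cont_on.
have := @green2_linear _ _ 1 z c0 c0.
rewrite (@eq_green2 _ (fun=> 0)) => [|y _]; first by lra.
by rewrite mulr0 addr0.
Qed.

Lemma green2Z g c z : cont_on h g ->
  green2 (fun z => c * g z) z = c * green2 g z.
Proof.
move=> gc; have c0 : cont_on h (fun=> 0) by exact: cst_cont_on.
transitivity (green2 (fun=> 0) z + c * green2 g z).
  rewrite -(green2_linear c z c0 gc); apply: (congr1 (fun F : R -> R => F z)).
  by apply: eq_green2 => y _; rewrite add0r.
by rewrite [X in X + _]green2_zero add0r.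
Qed.

Lemma green2_orth g : cont_on h g -> orth h q (green2 g).
Proof. by move=> gc; apply: green_orth => //; exact: green_cont_on. Qed.

(** The inner [green h q g] is orthogonal to sine and cosine by construction, which is what the
    periodicity of the outer one asks for. The second derivative involves the inner one itself,
    hence orthogonality of [g] in [ddgreen2_per]. *)
Lemma green2_per g : cont_on h g -> green2 g 0 = green2 g h.
Proof.
move=> gc; apply: green_per => //; first exact: green_cont_on.
exact: green_orth.
Qed.

Lemma dgreen2_per g : cont_on h g -> dgreen2 g 0 = dgreen2 g h.
Proof.
move=> gc; apply: dgreen_per => //; first exact: green_cont_on.
exact: green_orth.
Qed.

Lemma ddgreen2_per g : cont_on h g -> orth h q g -> ddgreen2 g 0 = ddgreen2 g h.
Proof.
move=> gc go; rewrite /ddgreen2 (green2_per gc) !clamp_id ?lexx ?ltW//.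
suff -> : green h q g 0 = green h q g h by [].
exact: green_per.
Qed.

Lemma green2_odd g : cont_on h g -> odd_on h g -> orth h q g ->
  forall z, green2 g (h - z) = - green2 g z.
Proof.
move=> gc god go; apply: green_odd => //.
- exact: green_cont_on.
- by move=> z _; exact: green_odd.
- exact: green_orth.
Qed.

(** Oddness makes the endpoint values opposite and periodicity makes them equal. *)
Lemma green2_odd0 g : cont_on h g -> odd_on h g -> orth h q g ->
  green2 g 0 = 0 /\ green2 g h = 0.
Proof.
move=> gc god go; have := green2_odd gc god go 0; rewrite subr0 (green2_per gc).
by move=> e; split; lra.
Qed.

Lemma green2_V g : cont_on h g -> odd_on h g -> orth h q g -> V h (green2 g).
Proof.
move=> gc god go; have [e0 eh] := green2_odd0 gc god go.
apply: (C2_V h0 (green2_derive gc) (dgreen2_derive gc) (ddgreen2_cont_on gc)) => //.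
  exact: dgreen2_per.
exact: ddgreen2_per.
Qed.

Lemma green2_norm g B : cont_on h g -> 0 <= B ->
  (forall z, 0 <= z <= h -> `|g z| <= B) ->
  normW22 h (green2 g) <= green_const * B * Num.sqrt (3 * h).
Proof.
move=> gc B0 gB.
apply: (C2_norm_le h0 (green2_derive gc) (dgreen2_derive gc) (ddgreen2_cont_on gc)).
  by rewrite mulr_ge0// ltW// green_const_gt0.
by move=> z zI; exact: green2_bound.
Qed.

(** [green2] is linear and bounded in the supremum norm, so the geometric remainders pass through
    it. *)
Lemma green2_fsum (N : nat -> R -> R) b A th z :
  (forall k, cont_on h (N k)) -> 0 <= th -> th < 1 ->
  (forall z, 0 <= z <= h -> geo A th (fun k => b k * N k z)) -> 0 <= z <= h ->
  green2 (fsum N b) z = Sum (fun k => b k * green2 (N k) z).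
Proof.
move=> Nc th0 th1 H zI.
have A0 : 0 <= A by exact: (geo_ge0 (H z zI)).
have bc k : cont_on h (fun z => b k * N k z) by apply: cont_onZ; exact: Nc.
have G : geo (green_const * A) th (fun k => b k * green2 (N k) z).
  move=> k; rewrite -green2Z; last exact: Nc.
  have B0 : 0 <= A * th ^+ k by rewrite mulr_ge0// exprn_ge0.
  have dB y : 0 <= y <= h -> `|b k * N k y| <= A * th ^+ k.
    by move=> yI; exact: H.
  by rewrite -mulrA; have [+ _ _] := green2_bound (@bc k) B0 dB zI.
have fc := fsum_cont_on Nc th0 th1 H.
apply: (Sum_unique th0 th1 G (C' := green_const * (A / (1 - th)))) => n.
have pc : cont_on h (fun z => partial (fun k => b k * N k z) n).
  exact: partial_cont_on.
have -> : partial (fun k => b k * green2 (N k) z) n =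
    green2 (fun z => partial (fun k => b k * N k z) n) z.
  elim: n {pc} => [|n IH].
    rewrite {1}/partial big_ord0; apply/esym; apply: etrans (green2_zero z).
    apply: (congr1 (fun F : R -> R => F z)).
    by apply: eq_green2 => y _; rewrite /partial big_ord0.
  have pc : cont_on h (fun z => partial (fun k => b k * N k z) n).
    exact: partial_cont_on.
  have Nn : cont_on h (N n) by exact: Nc.
  rewrite partialS IH -(green2_linear (b n) z pc Nn).
  apply: (congr1 (fun F : R -> R => F z)).
  by apply: eq_green2 => y _; rewrite partialS.
rewrite -[X in _ - X]mul1r -mulNr -(green2_linear (-1) z fc pc) -mulrA.
have dc : cont_on h (fun z => fsum N b z + -1 * partial (fun k => b k * N k z) n).
  by apply: cont_onD; [exact: fc|apply: cont_onZ; exact: pc].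
have B0 : 0 <= A / (1 - th) * th ^+ n.
  by rewrite mulr_ge0 ?exprn_ge0// divr_ge0// subr_ge0 ltW.
have dB y : 0 <= y <= h ->
    `|fsum N b y + -1 * partial (fun k => b k * N k y) n| <= A / (1 - th) * th ^+ n.
  move=> yI; rewrite mulN1r [leRHS]mulrAC.
  exact: (Sum_approx th0 th1 (H y yI)).
by have [+ _ _] := green2_bound dc B0 dB zI.
Qed.

Section Coefficients.
Variable nu : R.
Hypothesis nu0 : 0 < nu.

Definition cubic (U : nat -> R -> R) k z :=
  cprod (U ^~ z) (cprod (U ^~ z) (U ^~ z)) k.
(** In the integral of [Ncoef U k] against the sine only [Mcoef U k] times [U 0] contributes, with
    weight [h / 2]; this value balances the cubic term. *)
Definition Mcoef U k : R := 2 * nu / h * integ h (fun z => cubic U k z * S z).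
Definition Ncoef U k z : R := cprod (Mcoef U) (U ^~ z) k - nu * cubic U k z.

(** Each coefficient depends on all previous ones, so the recursion is an iteration on whole
    sequences: entry [k] no longer changes after [k.+1] rounds, which is [iter_next]. *)
Definition next (U : nat -> R -> R) k : R -> R :=
  if k is k'.+1 then green2 (Ncoef U k') else fun z => S z.

(* Coefficients of the formal solution [sum_k s^k Uc k] of
   u = sin (q z) + s * green2 (m u - nu u^3), with the scalar series m making
   the right-hand side orthogonal to sin (q z). *)
Definition Uc k : R -> R := iter k.+1 next (fun _ _ => 0) k.
Definition Mc := Mcoef Uc.
Definition Nc := Ncoef Uc.

Lemma eq_cubic U V n : (forall i, (i <= n)%N -> U i = V i) ->
  forall k, (k <= n)%N -> cubic U k = cubic V k.
Proof.
move=> UV k kn; apply/funext => z.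
have e i : (i <= n)%N -> U i z = V i z by move=> /UV ->.
apply: (eq_cprod (n := n)) => // i i_n.
by apply: (eq_cprod (n := n)) => //; exact: leq_trans kn.
Qed.

Lemma eq_Ncoef U V n : (forall i, (i <= n)%N -> U i = V i) ->
  Ncoef U n = Ncoef V n.
Proof.
move=> UV; apply/funext => z; rewrite /Ncoef (eq_cubic UV (leqnn n)).
congr (_ - _); apply: (eq_cprod (n := n)) => // i i_n; last by rewrite UV.
by rewrite /Mcoef (eq_cubic UV i_n).
Qed.

Lemma iter_next k n m : (k < n)%N -> (k < m)%N ->
  iter n next (fun _ _ => 0) k = iter m next (fun _ _ => 0) k.
Proof.
elim/ltn_ind: k n m => k IH [//|n] [//|m] kn km /=.
case: k IH kn km => [//|k] IH kn km /=; congr (green2 _).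
apply: eq_Ncoef => i ik; apply: IH => //.
  by apply: leq_ltn_trans ik _.
by apply: leq_ltn_trans ik _.
Qed.

Lemma Uc0 : Uc 0 = fun z => S z. Proof. by []. Qed.

Lemma UcS k : Uc k.+1 = green2 (Nc k).
Proof.
change (green2 (Ncoef (iter k.+1 next (fun _ _ => 0)) k) = green2 (Ncoef Uc k)).
by apply: (congr1 green2); apply: eq_Ncoef => i ik; exact: iter_next.
Qed.

Local Notation cb := (@cprod_const R).
Let cb0 : 0 <= cb. Proof. by apply: (@le_trans _ _ 1) => //; exact: cprod_const_ge1. Qed.

(** The cube takes two Cauchy products, hence [cb ^+ 2]; the [h] in the denominator of [Mcoef]
    cancels against the length of the interval. *)
Definition Mbound : R := 2 * nu * cb ^+ 2.
Definition Nbound : R := cb * Mbound + nu * cb ^+ 2.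
(** Chosen to close the induction in [rate_step]: inverting costs [green_const], the source costs
    [Nbound], and moving the weight from [sqi k] to [sqi k.+1] costs 4. *)
Definition rate : R := 4 * green_const * Nbound + 1.

Lemma Mbound_ge0 : 0 <= Mbound.
Proof. by rewrite !mulr_ge0 ?exprn_ge0// ltW. Qed.

Lemma Nbound_ge0 : 0 <= Nbound.
Proof. by rewrite addr_ge0 ?mulr_ge0 ?Mbound_ge0 ?exprn_ge0// ltW. Qed.

Lemma rate_gt0 : 0 < rate.
Proof.
by rewrite ltr_wpDl// !mulr_ge0 ?Nbound_ge0// ltW// green_const_gt0.
Qed.

Let r0 : 0 <= rate. Proof. exact: ltW rate_gt0. Qed.

(** The induction invariant. Oddness yields orthogonality to the cosine and zero endpoint values;
    the last clause is the majorant. *)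
Definition good n (U : nat -> R -> R) :=
  forall i, (i <= n)%N -> [/\ cont_on h (U i), odd_on h (U i),
    integ h (fun z => U i z * S z) = (if i is 0 then h / 2 else 0) &
    forall z, 0 <= z <= h -> `|U i z| <= 1 * rate ^+ i * sqi i].

Section Good.
Variables (n : nat) (U : nat -> R -> R).
Hypothesis Ug : good n U.

Let Ubd z : 0 <= z <= h -> bd n 1 rate (U ^~ z).
Proof. by move=> zI i /Ug[_ _ _]; exact. Qed.

Lemma cubic_bd z : 0 <= z <= h -> bd n (cb ^+ 2) rate (cubic U ^~ z).
Proof.
move=> zI; have b := Ubd zI.
have b2 := cprod_bd ler01 ler01 r0 b b.
have b3 := cprod_bd ler01 _ r0 b b2.
have -> : cb ^+ 2 = cb * (1 * (cb * (1 * 1))) by ring.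
by apply: b3; rewrite !mulr_ge0.
Qed.

Lemma sum_cont_on (I : nat) (F : 'I_I -> R -> R) : (forall i, cont_on h (F i)) ->
  cont_on h (fun z => \sum_(i < I) F i z).
Proof.
elim: I F => [|m IH] F Fc.
  have -> : (fun z => \sum_(i < 0) F i z) = fun=> 0.
    by apply/funext => z; rewrite big_ord0.
  exact: cst_cont_on.
have -> : (fun z => \sum_(i < m.+1) F i z) =
   fun z => \sum_(i < m) F (widen_ord (leqnSn m) i) z + F ord_max z.
  by apply/funext => z; rewrite big_ord_recr.
apply: cont_onD; last exact: Fc.
by apply: IH => i; exact: Fc.
Qed.

Lemma cprod_cont_on (F G : nat -> R -> R) k :
  (forall i, (i <= k)%N -> cont_on h (F i) /\ cont_on h (G i)) ->
  cont_on h (fun z => cprod (F ^~ z) (G ^~ z) k).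
Proof.
move=> FG; apply: sum_cont_on => i.
have ik : (i <= k)%N by rewrite -ltnS.
have [Fc _] := FG i ik; have [_ Gc] := FG _ (leq_subr i k).
exact: cont_onM.
Qed.

Lemma cubic_cont_on k : (k <= n)%N -> cont_on h (cubic U k).
Proof.
move=> kn; apply: (@cprod_cont_on U (fun i z => cprod (U ^~ z) (U ^~ z) i)).
move=> i ik; have i_n := leq_trans ik kn.
split; first by have [] := Ug i_n.
apply: cprod_cont_on => j ji; have jn := leq_trans ji i_n.
by have [] := Ug jn.
Qed.

Lemma cubic_odd k : (k <= n)%N -> odd_on h (cubic U k).
Proof.
move=> kn z zI; rewrite /cubic.
have e i : (i <= n)%N -> U i (h - z) = - U i z by move=> /Ug[_ o _ _]; exact: o.
rewrite (@eq_cprod _ n _ _ (fun i => - U i z) (cprod (U ^~ z) (U ^~ z)))//.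
  by rewrite /cprod -sumrN; apply: eq_bigr => i _; rewrite mulNr.
move=> i i_n; rewrite (@eq_cprod _ n _ _ (fun i => - U i z) (fun i => - U i z))//.
by apply: eq_bigr => j _; rewrite mulrNN.
Qed.

Lemma Mcoef_bd : bd n Mbound rate (Mcoef U).
Proof.
move=> k kn; have cc := cubic_cont_on kn; have sc := @sinq_cont_on R h q.
rewrite /Mcoef normrM ger0_norm; last by rewrite divr_ge0 ?mulr_ge0// ltW.
have : `|integ h (fun z => cubic U k z * S z)| <= cb ^+ 2 * rate ^+ k * sqi k * h.
  apply: norm_integ_le => //; first by int_tac.
  move=> z /andP[z1 z2]; rewrite normrM -[leRHS]mulr1.
  apply: ler_pM => //; last exact: sinq_norm.
  by apply: cubic_bd => //; rewrite !ltW.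
move=> H; apply: le_trans (ler_wpM2l _ H) _.
  by rewrite divr_ge0 ?mulr_ge0// ltW.
by rewrite /Mbound le_eqVlt; apply/orP; left; apply/eqP; field; rewrite gt_eqF.
Qed.

Lemma Ncoef_bd z : 0 <= z <= h -> bd n Nbound rate (Ncoef U ^~ z).
Proof.
move=> zI k kn; have b := Ubd zI.
have b1 := cprod_bd Mbound_ge0 ler01 r0 Mcoef_bd b kn.
have b2 := cubic_bd zI kn.
rewrite /Ncoef; apply: le_trans (ler_normB _ _) _.
have -> : Nbound * rate ^+ k * sqi k = cb * (Mbound * 1) * rate ^+ k * sqi k
  + nu * (cb ^+ 2 * rate ^+ k * sqi k) by rewrite /Nbound; ring.
apply: lerD => //; rewrite normrM gtr0_norm//; apply: ler_wpM2l => //; exact: ltW.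
Qed.

Lemma Ncoef_cont_on k : (k <= n)%N -> cont_on h (Ncoef U k).
Proof.
move=> kn; apply: cont_onB; last by apply: cont_onZ; exact: cubic_cont_on.
apply: (@cprod_cont_on (fun i z => Mcoef U i) U) => i ik.
split; first exact: cst_cont_on.
by have [] := Ug (leq_trans ik kn).
Qed.

Lemma Ncoef_odd k : (k <= n)%N -> odd_on h (Ncoef U k).
Proof.
move=> kn z zI; rewrite /Ncoef (cubic_odd kn zI).
rewrite (@eq_cprod _ n _ _ (Mcoef U) (fun i => - U i z))//; last first.
  by move=> i /Ug[_ o _ _]; exact: o.
rewrite /cprod opprB mulrN opprK addrC; congr (_ + _).
by rewrite -sumrN; apply: eq_bigr => i _; rewrite mulrN.
Qed.

(** Every [U i] but the first is orthogonal to the sine, so one term of the Cauchy product survives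
    and [Mcoef] was chosen to cancel it. The cosine is handled by oddness. *)
Lemma Ncoef_orth : orth h q (Ncoef U n).
Proof.
have Nn := Ncoef_cont_on (leqnn n); have No := Ncoef_odd (leqnn n).
split; last exact: odd_cos.
have cc := cubic_cont_on (leqnn n); have sc := @sinq_cont_on R h q.
have Uc_ k : (k <= n)%N -> cont_on h (U k) by move=> /Ug[].
(* The index map is generalised so that the induction on the number of terms leaves the reversed
   index [n - i] untouched. *)
have term m (F : 'I_m -> nat) : (forall i, (F i <= n)%N) ->
    integrable_on h (fun z => \sum_(i < m) Mcoef U i * (U (F i) z * S z)) /\
    integ h (fun z => \sum_(i < m) Mcoef U i * (U (F i) z * S z)) =
    \sum_(i < m) Mcoef U i * (if F i is 0 then h / 2 else 0).
  elim: m F => [|m IH] F Fn.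
    have e : (fun z => \sum_(i < 0) Mcoef U i * (U (F i) z * S z)) = fun=> 0.
      by apply/funext => z; rewrite big_ord0.
    by rewrite e big_ord0 integ0; split => //; int_tac.
  have e : (fun z => \sum_(i < m.+1) Mcoef U i * (U (F i) z * S z)) =
      fun z => \sum_(i < m) Mcoef U i * (U (F (widen_ord (leqnSn m) i)) z * S z)
        + Mcoef U m * (U (F ord_max) z * S z).
    by apply/funext => z; rewrite big_ord_recr.
  have [I1 I2] := IH (fun i => F (widen_ord (leqnSn m) i)) (fun i => Fn _).
  have Um : cont_on h (U (F ord_max)) by exact: Uc_.
  have i1 : integrable_on h (fun z => U (F ord_max) z * S z) by int_tac.
  have i2 := integrableZ_on (Mcoef U m) i1.
  rewrite e; split; first exact: integrableD_on.
  rewrite integD// I2 (integZ (Mcoef U m))// big_ord_recr/=; congr (_ + _ * _).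
  by have [_ _ -> _] := Ug (Fn ord_max).
have [I1 I2] := term n.+1 (fun i => (n - i)%N) (fun i => leq_subr i n).
have i3 : integrable_on h (fun z => cubic U n z * S z) by int_tac.
transitivity (integ h (fun z =>
    \sum_(i < n.+1) Mcoef U i * (U (n - i)%N z * S z) - nu * (cubic U n z * S z))).
  apply: eq_integ => z _; rewrite /Ncoef mulrBl mulrA; congr (_ - _).
  by rewrite /cprod mulr_suml; apply: eq_bigr => i _; rewrite mulrA.
rewrite integB//; last exact: integrableZ_on.
rewrite I2 (integZ nu)// big_ord_recr/= subnn big1 => [|i _]; last first.
  by have := ltn_ord i; rewrite -subn_gt0; case: (n - i)%N => // k _; rewrite mulr0.
by rewrite add0r /Mcoef; field; rewrite gt_eqF.
Qed.

End Good.

Lemma rate_step k : green_const * (Nbound * rate ^+ k * sqi k) <=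
  1 * rate ^+ k.+1 * sqi k.+1.
Proof.
have s4 : sqi k <= 4 * sqi k.+1 :> R.
  rewrite /sqi -[k.+2%:R]natr1; set x : R := k.+1%:R.
  have x1 : 1 <= x by rewrite ler1n.
  have x0 : 0 < x by exact: lt_le_trans x1.
  have y0 : 0 < x + 1 by rewrite addr_gt0.
  clearbody x; rewrite -subr_ge0.
  have -> : 4 * (x + 1) ^- 2 - x ^- 2 =
      ((x - 1) * (3 * x + 1)) * (x ^- 2 * (x + 1) ^- 2).
    by field; rewrite !gt_eqF.
  apply: mulr_ge0; apply: mulr_ge0; rewrite ?subr_ge0// ?invr_ge0 ?exprn_ge0//; lra.
rewrite mul1r exprS.
apply: (@le_trans _ _ (green_const * Nbound * rate ^+ k * (4 * sqi k.+1))).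
  rewrite [leLHS](_ : _ = green_const * Nbound * rate ^+ k * sqi k); last by ring.
  apply: ler_wpM2l => //; apply: mulr_ge0; last exact: exprn_ge0.
  by apply: mulr_ge0; [exact: ltW green_const_gt0|exact: Nbound_ge0].
rewrite [leLHS](_ : _ = (4 * green_const * Nbound) * rate ^+ k * sqi k.+1);
  last by ring.
apply: ler_wpM2r; first exact: ltW (sqi_gt0 _).
apply: ler_wpM2r; first exact: exprn_ge0.
by rewrite /rate lerDl.
Qed.

Lemma Uc_good n : good n Uc.
Proof.
elim: n => [|n IH].
  move=> i; rewrite leqn0 => /eqP ->; rewrite Uc0; split.
  - exact: sinq_cont_on.
  - by move=> z _; exact: sinq_rev.
  - rewrite -(integ_sin2 h0 q0 sin_qh).
    by apply: eq_integ => z _; rewrite expr2.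
  - by move=> z _; rewrite expr0 /sqi expr1n invr1 !mulr1; exact: sinq_norm.
move=> i; rewrite leq_eqVlt => /predU1P[->|]; last exact: IH.
have Nn := Ncoef_cont_on IH (leqnn n).
have No := Ncoef_odd IH (leqnn n).
have Nr := Ncoef_orth IH.
rewrite UcS; split.
- exact: green2_cont_on.
- by move=> z zI; exact: green2_odd.
- by have [] := green2_orth Nn.
- move=> z zI; apply: le_trans (rate_step n).
  have [] // := @green2_bound (Nc n) (Nbound * rate ^+ n * sqi n) z Nn.
    by apply: mulr_ge0; [apply: mulr_ge0; [exact: Nbound_ge0|exact: exprn_ge0]|exact: ltW (sqi_gt0 _)].
  by move=> y yI; exact: (Ncoef_bd IH yI (leqnn n)).
Qed.

End Coefficients.
End Branch.

#[global] Opaque green2 dgreen2 ddgreen2 Uc.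

(** * The smectic branch *)

Section MonomialSeries.
Context {R : realType} (rate rho : R) (j : nat).
Hypotheses (rate0 : 0 <= rate) (rho0 : 0 < rho) (rr : rate * rho ^+ 2 < 1).
Implicit Types (t s r B : R) (n k : nat) (c : nat -> R).

Local Notation th := (rate * rho ^+ 2).

(** The constant of [mono_bound] with outer radius [rho]: all derivatives of the series have ratio
    [rate * rho ^+ 2], uniformly for [|t| <= r < rho]. *)
Definition cauchy_const n r : R := n`!%:R / (rho - r) ^+ n * rho ^+ j.

Lemma cauchy_const_ge0 n r : r < rho -> 0 <= cauchy_const n r.
Proof.
move=> rrho; rewrite mulr_ge0 ?divr_ge0 ?exprn_ge0 ?ler0n ?(ltW rho0)//.
by rewrite subr_ge0 ltW.
Qed.

Lemma ratio_ge0 : 0 <= th.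
Proof. by rewrite mulr_ge0// exprn_ge0// ltW. Qed.

Lemma mono_geo_le n r B c k x y : 0 <= r -> r < rho -> 0 <= y ->
  `|x| <= y * mono n (2 * k + j) r -> `|c k| <= B * rate ^+ k ->
  `|x * c k| <= y * cauchy_const n r * B * th ^+ k.
Proof.
move=> r0 rrho y0 Hx Hc.
rewrite normrM; apply: (@le_trans _ _
    (y * (cauchy_const n r * rho ^+ (2 * k)) * (B * rate ^+ k))).
  apply: ler_pM => //; apply: le_trans Hx _; apply: ler_wpM2l => //.
  apply: le_trans (mono_bound n _ r0 rrho) _.
  by rewrite exprD /cauchy_const le_eqVlt; apply/orP; left; apply/eqP; ring.
by rewrite exprMn -exprM le_eqVlt; apply/orP; left; apply/eqP; ring.
Qed.

Section Series.
Variables (B : R) (c : nat -> R).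
Hypothesis Hc : forall k, `|c k| <= B * rate ^+ k.

(** The termwise [n]-th derivative of the series of [c k] times t^(2k+j); [j] is 1 for w and 2 for
    m. *)
Definition mser n t : R := Sum (fun k => mono n (2 * k + j) t * c k).

Lemma mser_geo n r t : r < rho -> `|t| <= r ->
  geo (cauchy_const n r * B) th (fun k => mono n (2 * k + j) t * c k).
Proof.
move=> rrho tr k.
have r0 : 0 <= r by exact: le_trans tr.
have := @mono_geo_le n r B c k (mono n (2 * k + j) t) 1 r0 rrho ler01 _ (Hc k).
by rewrite !mul1r; apply; exact: mono_norm.
Qed.

Definition taylor n t s k : R :=
  mono n (2 * k + j) (t + s) - mono n (2 * k + j) t
  - s * mono n.+1 (2 * k + j) t.

Lemma taylor_geo n r t s : r < rho -> `|t| <= r -> `|t + s| <= r ->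
  geo (s ^+ 2 * cauchy_const n.+2 r * B) th (fun k => taylor n t s k * c k).
Proof.
move=> rrho tr tsr k.
have r0 : 0 <= r by exact: le_trans tr.
by apply: mono_geo_le => //; [exact: sqr_ge0|exact: mono_taylor].
Qed.

Lemma taylor_sum n r t s : r < rho -> `|t| <= r -> `|t + s| <= r ->
  Sum (fun k => taylor n t s k * c k) =
  mser n (t + s) - mser n t - s * mser n.+1 t.
Proof.
move=> rrho tr tsr; have t0 := ratio_ge0.
have g1 := mser_geo n rrho tsr; have g2 := mser_geo n rrho tr.
have g3 := mser_geo n.+1 rrho tr.
have g12 : geo (cauchy_const n r * B + cauchy_const n r * B) th
   (fun k => mono n (2 * k + j) (t + s) * c k + -1 * (mono n (2 * k + j) t * c k)).
  move=> k; apply: le_trans (ler_normD _ _) _; rewrite mulN1r normrN mulrDl.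
  by apply: lerD; [exact: g1|exact: g2].
transitivity (Sum (fun k => mono n (2 * k + j) (t + s) * c k) +
  -1 * Sum (fun k => mono n (2 * k + j) t * c k) +
  - s * Sum (fun k => mono n.+1 (2 * k + j) t * c k)).
  rewrite -(Sum_linear _ t0 rr g1 g2) -(Sum_linear _ t0 rr g12 g3).
  by apply: eq_Sum => k; rewrite /taylor; ring.
by rewrite /mser mulN1r mulNr.
Qed.

(** The second-order remainders of the terms are summable with a factor [(y - t) ^+ 2], so the sum
    has a quadratic remainder; [r], halfway between [|t|] and [rho], leaves room for the
    increment. *)
Lemma mser_derive n t : `|t| < rho -> is_derive t (1 : R) (mser n) (mser n.+1 t).
Proof.
move=> tr; pose r := (`|t| + rho) / 2.
have tr1 : `|t| < r by rewrite /r; lra.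
have rrho : r < rho by rewrite /r; lra.
have B0 : 0 <= B.
  by have := Hc 0; rewrite expr0 mulr1; exact: le_trans.
set M := cauchy_const n.+2 r * B / (1 - th).
have M0 : 0 <= M.
  apply: mulr_ge0; last by rewrite invr_ge0 subr_ge0 ltW.
  by apply: mulr_ge0 => //; exact: cauchy_const_ge0.
apply/is_deriveP => e e0.
exists (Num.min (r - `|t|) (e / (M + 1))); split.
  by rewrite lt_min subr_gt0 tr1/= divr_gt0// ltr_wpDl.
move=> y; rewrite lt_min => /andP[y1 y2].
have yr : `|t + (y - t)| <= r.
  by apply: le_trans (ler_normD _ _) _; lra.
have := taylor_sum n rrho (ltW tr1) yr; rewrite subrKC => E.
have := Sum_norm ratio_ge0 rr (taylor_geo n rrho (ltW tr1) yr).
rewrite E [mser n.+1 t * _]mulrC => /le_trans; apply.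
have -> : (y - t) ^+ 2 * cauchy_const n.+2 r * B / (1 - th) =
    (M * `|y - t|) * `|y - t|.
  by rewrite -(real_normK (num_real (y - t))) /M; ring.
apply: ler_wpM2r => //.
have : `|y - t| * (M + 1) <= e by rewrite -ler_pdivlMr ?ltW// ltr_wpDl.
have := normr_ge0 (y - t); nra.
Qed.

End Series.
End MonomialSeries.

(** * Smooth dependence on the amplitude *)

Section Evaluation.
Context {R : realType} (h q nu : R).
Hypotheses (h0 : 0 < h) (q0 : 0 < q) (nu0 : 0 < nu).
Hypotheses (sin_qh : sin (q * h) = 0) (cos_qh : cos (q * h) = 1).
Implicit Types (t s r z : R) (n k : nat).

Local Notation S z := (sin (q * z)).
Local Notation rt := (rate h q nu).
Local Notation Uf := (Uc h q nu).
Local Notation Nf := (Nc h q nu).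
Local Notation Mf := (Mc h q nu).
Local Notation Nb := (Nbound nu).
Local Notation Mb := (Mbound nu).

Let r0 : 0 < rt. Proof. exact: rate_gt0. Qed.
Let gd n : good h q nu n Uf. Proof. exact: Uc_good. Qed.

Lemma sqi_le1 k : sqi k <= 1 :> R.
Proof. by rewrite /sqi invf_le1 ?exprn_gt0// exprn_ege1// ler1n. Qed.

Lemma drop_sqi A k (x : R) : 0 <= A -> x <= A * rt ^+ k * sqi k -> x <= A * rt ^+ k.
Proof.
move=> A0 H; apply: le_trans H _; rewrite ler_piMr ?sqi_le1//.
by rewrite mulr_ge0// exprn_ge0// ltW.
Qed.

Lemma Nf_bound z k : 0 <= z <= h -> `|Nf k z| <= Nb * rt ^+ k.
Proof.
move=> zI; apply: drop_sqi; first exact: Nbound_ge0.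
exact: (Ncoef_bd h0 q0 nu0 (@gd k) zI (leqnn k)).
Qed.

Lemma Mf_bound k : `|Mf k| <= Mb * rt ^+ k.
Proof.
apply: drop_sqi; first exact: Mbound_ge0.
exact: (Mcoef_bd h0 q0 nu0 (@gd k) (leqnn k)).
Qed.

Lemma Nf_cont k : cont_on h (Nf k).
Proof. exact: (Ncoef_cont_on (@gd k) (leqnn k)). Qed.

Lemma Nf_odd k : odd_on h (Nf k).
Proof. exact: (Ncoef_odd (@gd k) (leqnn k)). Qed.

Lemma Nf_orth k : orth h q (Nf k).
Proof. exact: (Ncoef_orth h0 sin_qh cos_qh (@gd k)). Qed.

Section Odd.
Variables (b : nat -> R) (A th : R).
Hypotheses (th0 : 0 <= th) (th1 : th < 1).
Hypothesis H : forall z, 0 <= z <= h -> geo A th (fun k => b k * Nf k z).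

Lemma fsum_Nf_cont : cont_on h (fsum Nf b).
Proof. by apply: (fsum_cont_on _ th0 th1 H) => k; exact: Nf_cont. Qed.

Lemma fsum_Nf_odd : odd_on h (fsum Nf b).
Proof.
move=> z zI; rewrite /fsum -[RHS]mulN1r -(SumZ (-1) th0 th1 (H zI)).
by apply: eq_Sum => k; rewrite Nf_odd//; ring.
Qed.

Lemma fsum_Nf_orth : orth h q (fsum Nf b).
Proof.
split; last by apply: odd_cos => //; [exact: fsum_Nf_cont|exact: fsum_Nf_odd].
have Nc' k : cont_on h (Nf k) by exact: Nf_cont.
rewrite (integ_fsum h0 Nc' th0 th1 H (@sinq_cont_on R h q) (@sinq_norm R q)).
have Z : geo 0 th (fun i => b i * integ h (fun z => Nf i z * S z)).
  by move=> i; have [-> _] := Nf_orth i; rewrite mulr0 normr0 mul0r.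
have := Sum_norm th0 th1 Z; rewrite mul0r => Z0.
by apply/eqP; rewrite -normr_eq0; apply/eqP/le_anti; rewrite Z0 normr_ge0.
Qed.

End Odd.

Section Rho.
Variable rho : R.
Hypotheses (rho0 : 0 < rho) (rr2 : rt * rho ^+ 2 <= 2^-1).

Let rr : rt * rho ^+ 2 < 1.
Proof. by apply: le_lt_trans rr2 _; lra. Qed.

Local Notation th := (rt * rho ^+ 2).
Let th0 : 0 <= th. Proof. exact: ratio_ge0 (ltW r0) rho0. Qed.

(** In u = t sin (q z) + t^2 w_t the correction w_t is the sum of t^(2k+1) U_(k+1), and U_(k+1) is
    [green2] of [Nc k]. Differentiating in t thus takes place in the numerical series of the source,
    before [green2] is applied. *)
Definition gser n t z : R := fsum Nf (fun k => mono n (2 * k + 1) t) z.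
Definition wser n t : R -> R := green2 h q (gser n t).
Definition mcurve t : R := mser 2 Mf 0 t.

Lemma gser_geo n r t : r < rho -> `|t| <= r -> forall z, 0 <= z <= h ->
  geo (cauchy_const rho 1 n r * Nb) th (fun k => mono n (2 * k + 1) t * Nf k z).
Proof.
move=> rrho tr z zI.
have Nk k : `|(Nf ^~ z) k| <= Nb * rt ^+ k by exact: Nf_bound.
by have := @mser_geo _ rt rho 1 Nb (Nf ^~ z) Nk n r t rrho tr; exact.
Qed.

Lemma gser_props n t : `|t| < rho ->
  [/\ cont_on h (gser n t), odd_on h (gser n t) & orth h q (gser n t)].
Proof.
move=> tr; have H := gser_geo n tr (lexx _).
split; [exact: (fsum_Nf_cont th0 rr H)|exact: (fsum_Nf_odd th0 rr H)|].
exact: (fsum_Nf_orth th0 rr H).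
Qed.

Lemma wser_V n t : `|t| < rho -> V h (wser n t).
Proof. by move=> /(gser_props n)[gc go gr]; exact: green2_V. Qed.

(** By linearity the deviation of the quotient is [green2] of that of the source, whose supremum is
    of order [|s|]; [green2] turns this supremum bound into a W^{2,2} bound. *)
Lemma wser_quotient n r t s : r < rho -> `|t| <= r -> `|t + s| <= r -> s != 0 ->
  normW22 h (fun z => s^-1 * (wser n (t + s) z - wser n t z) - wser n.+1 t z) <=
  `|s| * (green_const h q * (cauchy_const rho 1 n.+2 r * Nb / (1 - th))
    * Num.sqrt (3 * h)).
Proof.
move=> rrho tr tsr sn0.
have lt1 : `|t| < rho by exact: le_lt_trans rrho.
have lt2 : `|t + s| < rho by exact: le_lt_trans rrho.
have [c1 _ _] := gser_props n lt2; have [c2 _ _] := gser_props n lt1.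
have [c3 _ _] := gser_props n.+1 lt1.
pose G z := s^-1 * (gser n (t + s) z - gser n t z - s * gser n.+1 t z).
have Gc0 : cont_on h (fun z => gser n (t + s) z - gser n t z - s * gser n.+1 t z).
  by apply: cont_onB; [exact: cont_onB|exact: cont_onZ].
have Gc : cont_on h G by exact: cont_onZ.
have -> : (fun z => s^-1 * (wser n (t + s) z - wser n t z) - wser n.+1 t z) =
    green2 h q G.
  apply/funext => z; rewrite /G (green2Z h0 q0 _ _ Gc0).
  have c12 : cont_on h (fun z => gser n (t + s) z + -1 * gser n t z).
    by apply: cont_onD; [exact: c1|exact: cont_onZ].
  rewrite (@eq_green2 _ h q h0 _ (fun z => (gser n (t + s) z + -1 * gser n t z)
      + - s * gser n.+1 t z)); last by move=> y _; ring.
  rewrite (green2_linear h0 q0 (- s) z c12 c3) (green2_linear h0 q0 (-1) z c1 c2).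
  rewrite /wser; move: (green2 _ _ _ _) (green2 _ _ _ _) (green2 _ _ _ _).
  by move=> x y w; field.
have Gb z : 0 <= z <= h -> `|G z| <= `|s| * (cauchy_const rho 1 n.+2 r * Nb / (1 - th)).
  move=> zI; have Nk k : `|(Nf ^~ z) k| <= Nb * rt ^+ k by exact: Nf_bound.
  have E := taylor_sum 1 (ltW r0) rho0 rr Nk n rrho tr tsr.
  have := Sum_norm th0 rr (@taylor_geo _ rt rho 1 Nb (Nf ^~ z) Nk n r t s rrho tr tsr).
  rewrite E => Hn; rewrite /G normrM normfV ler_pdivrMl ?normr_gt0//.
  apply: le_trans Hn _; rewrite -(real_normK (num_real s)) le_eqVlt.
  by apply/orP; left; apply/eqP; ring.
have B0 : 0 <= `|s| * (cauchy_const rho 1 n.+2 r * Nb / (1 - th)).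
  apply: mulr_ge0 => //; apply: mulr_ge0; last by rewrite invr_ge0 subr_ge0 ltW.
  by apply: mulr_ge0; [exact: cauchy_const_ge0|exact: Nbound_ge0].
apply: le_trans (green2_norm h0 q0 Gc B0 Gb) _.
by rewrite le_eqVlt; apply/orP; left; apply/eqP; ring.
Qed.

Lemma wser_smooth n t : `|t| < rho ->
  normW22 h (fun z => s^-1 * (wser n (t + s) z - wser n t z) - wser n.+1 t z)
    @[s --> 0^'] --> (0 : R).
Proof.
move=> tr; pose r := (`|t| + rho) / 2.
have tr1 : `|t| < r by rewrite /r; lra.
have rrho : r < rho by rewrite /r; lra.
set M := green_const h q * (cauchy_const rho 1 n.+2 r * Nb / (1 - th))
    * Num.sqrt (3 * h).
have M0 : 0 <= M.
  apply: mulr_ge0; last exact: sqrtr_ge0.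
  apply: mulr_ge0; first exact: ltW (green_const_gt0 h0 q0).
  apply: mulr_ge0; last by rewrite invr_ge0 subr_ge0 ltW.
  by apply: mulr_ge0; [exact: cauchy_const_ge0|exact: Nbound_ge0].
apply/cvgrPdist_le => e e0; rewrite near_withinE; apply/nbhs_ballP.
exists (Num.min (r - `|t|) (e / (M + 1))) => /=.
  by rewrite lt_min subr_gt0 tr1/= divr_gt0// ltr_wpDl.
move=> s; rewrite /ball/= sub0r normrN lt_min => /andP[s1 s2] sn0.
rewrite sub0r normrN ger0_norm ?sqrtr_ge0//.
apply: le_trans (wser_quotient n rrho (ltW tr1) _ sn0) _.
  by apply: le_trans (ler_normD _ _) _; lra.
rewrite -/M; have : `|s| * (M + 1) <= e by rewrite -ler_pdivlMr ?ltW// ltr_wpDl.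
have := normr_ge0 s; nra.
Qed.

Lemma mcurve_derive n t : `|t| < rho ->
  is_derive t (1 : R) (mser 2 Mf n) (mser 2 Mf n.+1 t).
Proof. by move=> tr; exact: (mser_derive 2 (ltW r0) rho0 rr Mf_bound). Qed.

End Rho.
End Evaluation.

(** * The equation along the branch, and monotonicity of the parameter *)

Section Curve.
Context {R : realType} (h q nu : R).
Hypotheses (h0 : 0 < h) (q0 : 0 < q) (nu0 : 0 < nu).
Hypotheses (sin_qh : sin (q * h) = 0) (cos_qh : cos (q * h) = 1).
Implicit Types (t s r z : R) (n k : nat).

Local Notation S z := (sin (q * z)).
Local Notation rt := (rate h q nu).
Local Notation Uf := (Uc h q nu).
Local Notation Nf := (Nc h q nu).
Local Notation Mf := (Mc h q nu).
Local Notation Nb := (Nbound nu).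
Local Notation Mb := (Mbound nu).
Local Notation wser := (wser h q nu).
Local Notation gser := (gser h q nu).
Local Notation mcurve := (mcurve h q nu).

Let r0 : 0 < rt. Proof. exact: rate_gt0. Qed.
Let gd n : good h q nu n Uf. Proof. exact: Uc_good. Qed.
Let Mb0 : 0 <= Mb. Proof. exact: Mbound_ge0. Qed.
Let Nb0 : 0 <= Nb. Proof. exact: Nbound_ge0. Qed.
Let cb0 : 0 <= @cprod_const R.
Proof. by apply: (@le_trans _ _ 1) => //; exact: cprod_const_ge1. Qed.

Definition branch t z : R := t * S z + t ^+ 2 * wser 0 t z.

Variable rho : R.
Hypotheses (rho0 : 0 < rho) (rr2 : rt * rho ^+ 2 <= 2^-1).
Local Notation th := (rt * rho ^+ 2).

Let half0 : 0 <= 2^-1 :> R. Proof. by rewrite invr_ge0. Qed.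
Let half1 : 2^-1 < 1 :> R. Proof. lra. Qed.
Let half0' : 0 < 2^-1 :> R. Proof. lra. Qed.
Let th0 : 0 <= th. Proof. by apply: mulr_ge0; [exact: ltW|exact: sqr_ge0]. Qed.
Let th1 : th < 1. Proof. exact: le_lt_trans rr2 half1. Qed.

Section AtT.
Variable t : R.
Hypothesis tr : `|t| < rho.
Local Notation s := (t ^+ 2).

Let s0 : 0 <= s. Proof. exact: sqr_ge0. Qed.
Let s_half : rt * s <= 2^-1.
Proof.
apply: le_trans rr2; apply: ler_wpM2l; first exact: ltW.
by rewrite -(real_normK (num_real t)); apply: lerXn2r; rewrite ?nnegrE//; exact: ltW.
Qed.

Let bdgeo A (a : nat -> R) : 0 <= A -> (forall n, bd n A rt a) ->
  geo A 2^-1 (fun k => s ^+ k * a k).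
Proof.
move=> A0 H; apply: (le_geo (bd_geo A0 (ltW r0) s0 H)) => //.
by apply: mulr_ge0 => //; exact: ltW.
Qed.

Let Ubd z n : 0 <= z <= h -> bd n 1 rt (Uf ^~ z).
Proof. by move=> zI i i_n; have [_ _ _] := @gd n i i_n; exact. Qed.

(** Both series are in [t ^+ 2]; [rr2] makes their ratio at most one half, whence the factors 2 in
    the bounds below. *)
Definition Uev z : R := Sum (fun k => s ^+ k * Uf k z).
Definition Mev : R := Sum (fun k => s ^+ k * Mf k).

Let Ugeo z : 0 <= z <= h -> geo 1 2^-1 (fun k => s ^+ k * Uf k z).
Proof. by move=> zI; apply: bdgeo => // n; exact: Ubd. Qed.

Let Mgeo : geo Mb 2^-1 (fun k => s ^+ k * Mf k).
Proof. by apply: bdgeo => // n; exact: (Mcoef_bd h0 q0 nu0 (@gd n)). Qed.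

Let mono0 k (j : nat) : mono 0 (2 * k + j) t = s ^+ k * t ^+ j.
Proof. by rewrite /mono ffactn0 mul1r subn0 exprD exprM. Qed.

Lemma Uev_norm z : 0 <= z <= h -> `|Uev z| <= 2.
Proof.
move=> zI; have := Sum_norm half0 half1 (Ugeo zI).
by rewrite (_ : 1 / (1 - 2^-1) = 2 :> R)//; field.
Qed.

Lemma Mev_norm : `|Mev| <= 2 * Mb.
Proof.
have := Sum_norm half0 half1 Mgeo.
by rewrite (_ : Mb / (1 - 2^-1) = 2 * Mb)//; field.
Qed.

Lemma mcurveE : mcurve t = s * Mev.
Proof.
rewrite /mcurve /mser /Mev -(SumZ s half0 half1 Mgeo); apply: eq_Sum => k.
by rewrite mono0; ring.
Qed.

Let Nb_k z k : 0 <= z <= h -> `|Nf k z| <= Nb * rt ^+ k.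
Proof. by move=> zI; exact: Nf_bound. Qed.

Lemma branchE z : 0 <= z <= h -> branch t z = t * Uev z.
Proof.
move=> zI; rewrite /branch /Uev (Sum_shift half0 half1 (Ugeo zI)).
rewrite [RHS]mulrDr expr0 mul1r Uc0; congr (_ + _).
have gb k : `|green2 h q (Nf k) z| <= (green_const h q * Nb) * rt ^+ k.
  rewrite -mulrA; have [] // := @green2_bound _ h q h0 q0 (Nf k) (Nb * rt ^+ k) z.
  - exact: Nf_cont.
  - by apply: mulr_ge0 => //; apply: exprn_ge0; exact: ltW.
  - by move=> y yI; exact: Nb_k.
have ga := @mser_geo _ rt rho 1 (green_const h q * Nb)
  (fun k => green2 h q (Nf k) z) gb 0 `|t| t tr (lexx _).
have Nc' k : cont_on h (Nf k) by exact: Nf_cont.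
have -> : wser 0 t z = Sum (fun k => mono 0 (2 * k + 1) t * green2 h q (Nf k) z).
  apply: (green2_fsum h0 q0 Nc' th0 th1 _ zI).
  by move=> y yI; exact: (gser_geo h0 q0 nu0 sin_qh cos_qh 0 tr (lexx _) yI).
rewrite -(SumZ s th0 th1 ga).
have gs : geo 2^-1 2^-1 (fun k => s ^+ k.+1 * Uf k.+1 z).
  by move=> k; rewrite -exprS; have := Ugeo zI k.+1; rewrite mul1r.
rewrite -(SumZ t half0 half1 gs); apply: eq_Sum => k.
rewrite mono0 UcS [s ^+ k.+1]exprS expr1 -/(Nf k); move: (green2 _ _ _ _) (s ^+ k) => x y.
by ring.
Qed.

Let cubicE z k : s ^+ k * cubic Uf k z =
  cprod (fun i => s ^+ i * Uf i z)
    (cprod (fun i => s ^+ i * Uf i z) (fun i => s ^+ i * Uf i z)) k.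
Proof.
rewrite /cubic -cprod_scale; congr cprod; apply/funext => i.
by rewrite cprod_scale.
Qed.

(** The formal recursion is stated with Cauchy products, and [Sum_cprod] turns these into genuine
    products. *)
Lemma Nev z : 0 <= z <= h ->
  Sum (fun k => s ^+ k * Nf k z) = Mev * Uev z - nu * Uev z ^+ 3.
Proof.
move=> zI; have U := Ugeo zI; have M := Mgeo.
have ub n : bd n 1 rt (Uf ^~ z) by exact: Ubd.
have u2 n := cprod_bd ler01 ler01 (ltW r0) (ub n) (ub n).
have c2 : 0 <= @cprod_const R * (1 * 1) by rewrite !mulr1.
have u3 n := cprod_bd ler01 c2 (ltW r0) (ub n) (u2 n).
have c3 : 0 <= @cprod_const R * (1 * (@cprod_const R * (1 * 1))).
  by rewrite !mulr1 mul1r; apply: mulr_ge0.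
have mb n : bd n Mb rt Mf by exact: (Mcoef_bd h0 q0 nu0 (@gd n)).
have mu n := cprod_bd Mb0 ler01 (ltW r0) (mb n) (ub n).
have c4 : 0 <= @cprod_const R * (Mb * 1) by rewrite mulr1; apply: mulr_ge0.
have g2 : geo (cprod_const * (1 * 1)) 2^-1
    (cprod (fun i => s ^+ i * Uf i z) (fun i => s ^+ i * Uf i z)).
  by move=> k; rewrite cprod_scale; exact: (bdgeo c2 u2 k).
have g3 : geo (cprod_const * (1 * (cprod_const * (1 * 1)))) 2^-1
    (cprod (fun i => s ^+ i * Uf i z)
      (cprod (fun i => s ^+ i * Uf i z) (fun i => s ^+ i * Uf i z))).
  by move=> k; rewrite -cubicE; exact: (bdgeo c3 u3 k).
have g4 : geo (cprod_const * (Mb * 1)) 2^-1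
    (cprod (fun i => s ^+ i * Mf i) (fun i => s ^+ i * Uf i z)).
  by move=> k; rewrite cprod_scale; exact: (bdgeo c4 mu k).
transitivity (Sum (fun k =>
   cprod (fun i => s ^+ i * Mf i) (fun i => s ^+ i * Uf i z) k + - nu *
   cprod (fun i => s ^+ i * Uf i z)
     (cprod (fun i => s ^+ i * Uf i z) (fun i => s ^+ i * Uf i z)) k)).
  apply: eq_Sum => k; rewrite -cubicE cprod_scale /Nc /Ncoef -/(Mc h q nu).
  by move: (cprod _ _ _) (cubic _ _ _) => x y; ring.
rewrite (Sum_linear _ half0 half1 g4 g3).
rewrite (Sum_cprod half0' half1 M U g4) (Sum_cprod half0' half1 U g2 g3).
rewrite (Sum_cprod half0' half1 U U g2) -/Mev -/(Uev z).
by move: Mev (Uev z) => a b; ring.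
Qed.

(** With u = t U and m = t^2 M, the source m u - nu u^3 equals t^3 (M U - nu U^3), where t (M U - nu
    U^3) is [gser 0 t]. *)
Lemma gserE z : 0 <= z <= h ->
  s * gser 0 t z = mcurve t * branch t z - nu * branch t z ^+ 3.
Proof.
move=> zI; rewrite (branchE zI) mcurveE.
have -> : gser 0 t z = t * Sum (fun k => s ^+ k * Nf k z).
  have nb n : bd n Nb rt (Nf ^~ z) by exact: (Ncoef_bd h0 q0 nu0 (@gd n) zI).
  have ng := bdgeo Nb0 nb.
  rewrite -(SumZ t half0 half1 ng); apply: eq_Sum => k.
  by rewrite mono0 expr1; ring.
by rewrite (Nev zI); move: Mev (Uev z) => a b; ring.
Qed.

Lemma branch_norm z : 0 <= z <= h -> `|branch t z| <= 2 * `|t|.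
Proof.
move=> zI; rewrite (branchE zI) normrM mulrC; apply: ler_wpM2r => //.
exact: Uev_norm.
Qed.

Lemma mcurve_norm : `|mcurve t| <= 2 * Mb * s.
Proof.
rewrite mcurveE normrM ger0_norm// mulrC; apply: ler_wpM2r => //.
exact: Mev_norm.
Qed.

Lemma branch_cont_on : cont_on h (branch t).
Proof.
have [gc _ _] := gser_props h0 q0 nu0 sin_qh cos_qh rho0 rr2 0 tr.
apply: cont_onD; first by apply: cont_onZ; exact: sinq_cont_on.
by apply: cont_onZ; exact: green2_cont_on.
Qed.

Lemma branch_green z :
  branch t z = t * S z
    + green2 h q (fun x => mcurve t * branch t x - nu * branch t x ^+ 3) z.
Proof.
have [gc _ _] := gser_props h0 q0 nu0 sin_qh cos_qh rho0 rr2 0 tr.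
rewrite [LHS]/branch; congr (_ + _).
rewrite -(green2Z h0 q0 _ _ gc); apply: (congr1 (fun F : R -> R => F z)).
by apply: eq_green2 => // x xI; exact: gserE.
Qed.

Lemma branch_orth : orth h q (fun x => mcurve t * branch t x - nu * branch t x ^+ 3).
Proof.
have [gc _ [gS gC]] := gser_props h0 q0 nu0 sin_qh cos_qh rho0 rr2 0 tr.
have sc := @sinq_cont_on R h q; have kc := @cosq_cont_on R h q.
have e (k : R -> R) : cont_on h k ->
    integ h (fun z => (mcurve t * branch t z - nu * branch t z ^+ 3) * k z) =
    s * integ h (fun z => gser 0 t z * k z).
  move=> kc'; rewrite -integZ; last by int_tac.
  apply: eq_integ => z /andP[z0 zh]; rewrite -gserE ?mulrA//.
  by rewrite !ltW.
by split; rewrite e// ?gS ?gC mulr0.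
Qed.

Lemma branch0 : branch t 0 = 0 /\ branch t h = 0.
Proof.
have [gc go gr] := gser_props h0 q0 nu0 sin_qh cos_qh rho0 rr2 0 tr.
have [e0 eh] : wser 0 t 0 = 0 /\ wser 0 t h = 0.
  exact: (green2_odd0 h0 q0 sin_qh cos_qh gc go gr).
by rewrite /branch mulr0 sin0 sin_qh e0 eh; split; ring.
Qed.

End AtT.

(** A lower bound suffices: S^4 >= S^2 - 1/4 integrates to [h / 4], which avoids computing the exact
    integral 3 h / 8. *)
Lemma Mc0_ge : nu / 2 <= Mf 0.
Proof.
have sc := @sinq_cont_on R h q.
have -> : Mf 0 = 2 * nu / h * integ h (fun z => S z ^+ 4).
  rewrite /Mc /Mcoef; congr (_ * _); apply: eq_integ => z _.
  by rewrite /cubic /cprod !big_ord1 Uc0; ring.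
have H : h / 4 <= integ h (fun z => S z ^+ 4).
  have i2 : integrable_on h (fun z => S z ^+ 2) by int_tac.
  have i1 : integrable_on h (fun=> - 4^-1 : R) by int_tac.
  have -> : h / 4 = integ h (fun z => S z ^+ 2 + - 4^-1).
    by rewrite integD// (integ_sin2 h0 q0 sin_qh) integ_cst//; field.
  apply: le_integ; [exact: integrableD_on|by int_tac|] => z _.
  have := sqr_ge0 (S z ^+ 2 - 2^-1); lra.
have -> : nu / 2 = 2 * nu / h * (h / 4) by field; rewrite gt_eqF.
by apply: ler_wpM2l => //; rewrite divr_ge0 ?mulr_ge0// ltW.
Qed.

Hypotheses (rr4 : th <= 4^-1) (rr5 : 8 * Mb * th < nu).

(** The difference is a series in x^(k+1) - y^(k+1) for x = t^2 and y = t'^2. Its first term is at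
    least [nu / 2 * (x - y)]; the mean value bound makes the others total at most
    [4 * Mb * th * (x - y)], which is smaller by [rr5]. *)
Lemma mcurve_increasing t t' : `|t'| < `|t| -> `|t| < rho -> mcurve t' < mcurve t.
Proof.
move=> tt tr; have tr' : `|t'| < rho by exact: lt_trans tr.
pose x := t ^+ 2; pose y := t' ^+ 2; pose X := rho ^+ 2.
have y0 : 0 <= y by exact: sqr_ge0.
have yx : y < x.
  rewrite /x /y -(real_normK (num_real t)) -(real_normK (num_real t')).
  by rewrite ltr_pXn2r// nnegrE.
have xX : x <= X.
  by rewrite /x /X -(real_normK (num_real t)); apply: lerXn2r; rewrite ?nnegrE//; exact: ltW.
have X0 : 0 <= X by exact: sqr_ge0.
pose d k := x ^+ k.+1 - y ^+ k.+1.
have db k : `|d k| <= k.+1%:R * X ^+ k * (x - y).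
  apply: (derive_norm_le (F := fun z => z ^+ k.+1) (f := fun z => k.+1%:R * z ^+ k)).
  - by move=> z; exact: is_derive_pow.
  - exact: ltW.
  - move=> z /andP[z1 z2]; have z0 : 0 <= z by exact: le_trans z1.
    rewrite ger0_norm; last by apply: mulr_ge0 => //; exact: exprn_ge0.
    by apply: ler_wpM2l => //; apply: lerXn2r; rewrite ?nnegrE// (le_trans z2).
(* The factor [k.+1] of the mean value bound is absorbed by doubling the ratio; [rr4] keeps [2 * th]
   at most one half. *)
have two k : k.+1%:R <= 2 ^+ k :> R.
  by rewrite -natrX ler_nat; elim: k => // k IH; rewrite expnS mul2n -addnn;
    apply: leq_ltn_trans IH _; rewrite -addn1 leq_add2l expn_gt0.
have Mk k : `|Mf k| <= Mb * rt ^+ k by exact: Mf_bound.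
have term k : `|Mf k * d k| <= Mb * (x - y) * (2 * th) ^+ k.
  rewrite normrM; apply: (@le_trans _ _ ((Mb * rt ^+ k) * (2 ^+ k * X ^+ k * (x - y)))).
    apply: ler_pM => //; apply: le_trans (db k) _.
    apply: ler_wpM2r; first by rewrite subr_ge0 ltW.
    by apply: ler_wpM2r => //; exact: exprn_ge0.
  by rewrite !exprMn le_eqVlt; apply/orP; left; apply/eqP; ring.
have t20 : 0 <= 2 * th by apply: mulr_ge0.
have t21 : 2 * th < 1 by move: (rr4) => ?; lra.
have geod : geo (Mb * (x - y)) (2 * th) (fun k => Mf k * d k) by [].
have E : mcurve t - mcurve t' = Sum (fun k => Mf k * d k).
  have g1 := @mser_geo _ rt rho 2 Mb Mf Mk 0 `|t| t tr (lexx _).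
  have g2 := @mser_geo _ rt rho 2 Mb Mf Mk 0 `|t'| t' tr' (lexx _).
  rewrite -[X in _ - X]mul1r -mulNr -(Sum_linear _ th0 th1 g1 g2).
  apply: eq_Sum => k; rewrite /d /x /y /mono ffactn0 subn0 -!exprM.
  by rewrite (_ : (2 * k.+1 = 2 * k + 2)%N) ?mulnS 1?addnC//; ring.
rewrite -subr_gt0 E (Sum_shift t20 t21 geod).
have g1 : geo (Mb * (x - y) * (2 * th)) (2 * th) (fun k => Mf k.+1 * d k.+1).
  by move=> k; rewrite -mulrA -exprS.
have S1 := Sum_norm t20 t21 g1.
have S2 : Mb * (x - y) * (2 * th) / (1 - 2 * th) <= 4 * Mb * th * (x - y).
  rewrite ler_pdivrMr ?subr_gt0//.
  have p : 0 <= Mb * (x - y) * th.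
    by apply: mulr_ge0 => //; apply: mulr_ge0 => //; rewrite subr_ge0 ltW.
  have := ler_wpM2l p rr4; lra.
have S3 : nu / 2 * (x - y) <= Mf 0 * d 0.
  rewrite /d !expr1; apply: ler_wpM2r; first by rewrite subr_ge0 ltW.
  exact: Mc0_ge.
have S4 : 8 * Mb * th * (x - y) < nu * (x - y) by rewrite ltr_pM2r ?subr_gt0.
move: S1 S2 S3 S4; rewrite ler_norml => /andP[S1 _].
move: (Sum _) (Mf 0 * d 0) (Mb * (x - y) * (2 * th) / (1 - 2 * th)) S1 => a b c; lra.
Qed.

End Curve.

(** * Weak solutions *)

Section Continuous.
Context {R : realType} (h : R).
Hypothesis h0 : 0 < h.
Implicit Types (u w g : R -> R).

(** A primitive of the clamped square is nondecreasing with equal values at 0 and [h], hence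
    constant on [[0, h]]. The derivative at [x] is then read off from a nearby point of the
    interval, on the left when [x = h]. *)
Lemma integ_sqr_eq0 w : cont_on h w -> integ h (fun z => w z ^+ 2) = 0 ->
  forall x, 0 <= x <= h -> w x = 0.
Proof.
move=> wc w0 x xI.
pose k z := w (clamp h z) ^+ 2.
have kc : continuous k.
  move=> z; apply: (@cvg_comp _ _ _ (fun z => w (clamp h z)) (fun y => y ^+ 2)).
    exact: (cont_on_clamp h0 wc).
  exact: exprn_continuous.
have dP := prim_derive kc; set P := prim k in dP.
have Ph : P h = P 0.
  apply/eqP; rewrite -subr_eq0 -(integ_derive h0 dP); last exact: continuous_cont_on.
  rewrite -[X in _ == X]w0; apply/eqP; apply: eq_integ => z /andP[z0 zh].
  by rewrite /k clamp_id// !ltW.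
have mono a b : a <= b -> P a <= P b.
  move=> ab; have [c _ e] := MVT_segment ab (fun z _ => dP z)
    (continuous_subspaceT (derive_continuous dP)).
  by rewrite -subr_ge0 e mulr_ge0 ?sqr_ge0// subr_ge0.
have Pc y : 0 <= y <= h -> P y = P 0.
  move=> /andP[y0 yh]; apply/le_anti/andP; split; last exact: mono.
  by rewrite -Ph; exact: mono.
apply/eqP; rewrite -sqrf_eq0; apply/eqP/le_anti; rewrite sqr_ge0 andbT.
apply/ler_addgt0Pr => e e0; rewrite add0r.
have /is_deriveP/(_ e e0)[d [d0 dH]] := dP x.
have [y [yI yx yd]] : exists y, [/\ 0 <= y <= h, y != x & `|y - x| < d].
  case/andP: xI => x0 xh; move: xh; rewrite le_eqVlt => /predU1P[->|xh].
    pose m := Num.min d h / 2.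
    have m0 : 0 < m by rewrite divr_gt0// lt_min d0.
    have md : m < d by rewrite ltr_pdivrMr// gt_min ltr_pMr// ltr1n.
    have mh : m < h by rewrite ltr_pdivrMr// gt_min ltr_pMr ?ltr1n// orbT.
    exists (h - m); split; first by rewrite subr_ge0 ltW//= gerBl ltW.
      by rewrite -subr_eq0 addrAC subrr sub0r oppr_eq0 gt_eqF.
    by rewrite addrAC subrr sub0r normrN gtr0_norm.
  pose m := Num.min d (h - x) / 2.
  have hx : 0 < h - x by rewrite subr_gt0.
  have m0 : 0 < m by rewrite divr_gt0// lt_min d0.
  have md : m < d by rewrite ltr_pdivrMr// gt_min ltr_pMr// ltr1n.
  have mh : m < h - x by rewrite ltr_pdivrMr// gt_min ltr_pMr ?ltr1n// orbT.
  exists (x + m); split; first by apply/andP; split; [exact: addr_ge0 (ltW _)|rewrite -lerBrDl ltW].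
    by rewrite -subr_eq0 addrAC subrr add0r gt_eqF.
  by rewrite addrAC subrr add0r gtr0_norm.
have := dH y yd; rewrite (Pc y yI) (Pc x xI) subrr sub0r normrN normrM.
rewrite ler_pM2r ?normr_gt0 ?subr_eq0// /k clamp_id// => H.
exact: le_trans (ler_norm _) H.
Qed.

Lemma cont_on_max w : cont_on h w -> exists X,
  [/\ 0 <= X, forall z, 0 <= z <= h -> `|w z| <= X &
      exists2 c, 0 <= c <= h & `|w c| = X].
Proof.
move=> wc; have nc : {within `[0, h], continuous (fun z => `|w z|)}.
  by move=> z; apply: cvg_norm; exact: wc.
have [c cI H] := EVT_max (ltW h0) nc.
by exists `|w c|; split => //; exists c.
Qed.

End Continuous.

(** * Representation of weak solutions by the Green operator *)

Section Representation.
Context {R : realType} (h q : R).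
Hypotheses (h0 : 0 < h) (q0 : 0 < q).
Hypotheses (sin_qh : sin (q * h) = 0) (cos_qh : cos (q * h) = 1).
Implicit Types (u g : R -> R) (z : R).

Local Notation S z := (sin (q * z)).
Local Notation C z := (cos (q * z)).

(** Green's second identity: the boundary terms y w' - y' w cancel by periodicity. *)
Lemma green_sym g k : cont_on h g -> cont_on h k -> orth h q g -> orth h q k ->
  integ h (fun z => green h q g z * k z) = integ h (fun z => g z * green h q k z).
Proof.
move=> gc kc go ko; have yc := green_cont_on h0 q0 gc; have wc := green_cont_on h0 q0 kc.
have dy := green_derive h0 q0 gc; have dy1 := dgreen_derive h0 q0 gc.
have dw := green_derive h0 q0 kc; have dw1 := dgreen_derive h0 q0 kc.
set y := green h q g in yc dy dy1 *; set w := green h q k in wc dw dw1 *.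
have gC : cont_on h (fun z => g (clamp h z)).
  by apply: continuous_cont_on; exact: cont_on_clamp.
have kC : cont_on h (fun z => k (clamp h z)).
  by apply: continuous_cont_on; exact: cont_on_clamp.
have d : deriv_of (fun z => y z * dgreen h q k z - dgreen h q g z * w z)
    (fun z => y z * k (clamp h z) - g (clamp h z) * w z).
  move=> z; apply: (is_derive_eq (is_derive1B (is_derive1M (dy z) (dw1 z))
    (is_derive1M (dy1 z) (dw z)))); rewrite -/y -/w.
  by move: (dgreen h q g z) (dgreen h q k z) => a b; ring.
have dc : cont_on h (fun z => y z * k (clamp h z) - g (clamp h z) * w z).
  by apply: cont_onB; apply: cont_onM.
have := integ_derive h0 d dc.
have p1 : y 0 = y h by exact: green_per.
have p2 : w 0 = w h by exact: green_per.
rewrite -p1 -p2 -(dgreen_per h0 sin_qh cos_qh gc go) -(dgreen_per h0 sin_qh cos_qh kc ko).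
have i1 : integrable_on h (fun z => y z * k (clamp h z)).
  by apply: cont_on_integrable; exact: (cont_onM yc kC).
have i2 : integrable_on h (fun z => g (clamp h z) * w z).
  by apply: cont_on_integrable; exact: (cont_onM gC wc).
rewrite subrr (integB i1 i2) => /eqP; rewrite subr_eq0 => /eqP e.
transitivity (integ h (fun z => y z * k (clamp h z))).
  by apply: eq_integ => z /andP[z1 z2]; rewrite clamp_id// !ltW.
rewrite e; apply: eq_integ => z /andP[z1 z2]; rewrite clamp_id// !ltW//.
Qed.

Lemma green2_sym g k : cont_on h g -> cont_on h k -> orth h q g -> orth h q k ->
  integ h (fun z => green2 h q g z * k z) = integ h (fun z => g z * green2 h q k z).
Proof.
move=> gc kc go ko; have yc := green_cont_on h0 q0 gc; have wc := green_cont_on h0 q0 kc.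
have yo := green_orth h0 q0 sin_qh gc; have wo := green_orth h0 q0 sin_qh kc.
transitivity (integ h (fun z => green h q g z * green h q k z)).
  exact: green_sym.
exact: green_sym.
Qed.

Variables (lam mu f : R) (u : R -> R).
Hypotheses (lam0 : 0 < lam) (uW : Wrho h u).
Hypothesis weak : weak_smectic h lam q mu f u.

Let m := mu / (2 * lam).
Let nu := f / (2 * lam).
Let g z := m * u z - nu * u z ^+ 3.

Let uc : cont_on h u. Proof. by case: uW => [[[]]]. Qed.
Let gc : cont_on h g. Proof. by rewrite /g; cont_tac. Qed.

(* [zt] is an everywhere smooth function extending the restriction of [eta2] to
   [0, h]; [eta2] itself need not be differentiable beyond the endpoints. *)
Lemma weak_test eta eta1 eta2 zt zt1 zt2 :
  deriv_of eta eta1 -> deriv_of eta1 eta2 -> continuous eta2 ->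
  deriv_of zt zt1 -> deriv_of zt1 zt2 -> continuous zt2 ->
  (forall z, 0 <= z <= h -> eta2 z = zt z) ->
  eta 0 = eta h -> eta1 0 = eta1 h -> zt 0 = zt h -> zt1 0 = zt1 h ->
  integ h (fun z => u z * (zt2 z + 2 * q ^+ 2 * zt z + q ^+ 4 * eta z)) =
  integ h (fun z => g z * eta z).
Proof.
move=> d1 d2 c2 e1 e2 ec ext p0 p1 r0 r1.
have c2' := continuous_cont_on (h := h) c2.
have etaW : Wrho h eta.
  by apply: (C2_Wrho h0 d1 d2 c2' p0 p1); rewrite !ext ?lexx ?ltW.
have uL : L2 h (wD h (wD h u)) by apply: W22_wD2_L2; case: uW.
have etac : cont_on h eta by exact: (continuous_cont_on (derive_continuous d1)).
have ztc : cont_on h zt by exact: (continuous_cont_on (derive_continuous e1)).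
have zt2c : cont_on h zt2 by exact: continuous_cont_on.
have := weak etaW.
set w := wD h (wD h u) in uL *.
have A1 : integ h (fun z => 2 * lam * w z * wD h (wD h eta) z) =
    2 * lam * integ h (fun z => u z * zt2 z).
  transitivity (integ h (fun z => wD h (wD h eta) z * (2 * lam * w z))).
    by apply: eq_integ => z _; ring.
  rewrite (C2_wD2_integ h0 d1 d2 c2'); last exact: L2Z.
  transitivity (integ h (fun z => 2 * lam * (w z * zt z))).
    apply: eq_integ => z /andP[z0 zh]; rewrite ext ?ltW//.
    by ring.
  rewrite (integZ (2 * lam)); last by apply: L2M => //; exact: cont_on_L2.
  by congr (_ * _); exact: (Wrho_ibp h0 uW e1 e2 ec r0 r1).
have B1 : integ h (fun z => w z * eta z) = integ h (fun z => u z * zt z).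
  rewrite (Wrho_ibp h0 uW d1 d2 c2 p0 p1); apply: eq_integ => z /andP[z0 zh].
  by rewrite ext// !ltW.
have iw : integrable_on h (fun z => w z * eta z).
  by apply: L2M => //; exact: cont_on_L2.
have iu : integrable_on h (fun z => u z * eta z) by int_tac.
have A2 : integ h (fun z => (4 * lam * q ^+ 2 * w z + 2 * lam * q ^+ 4 * u z) * eta z) =
    4 * lam * q ^+ 2 * integ h (fun z => u z * zt z)
    + 2 * lam * q ^+ 4 * integ h (fun z => u z * eta z).
  rewrite -B1 -(integZ _ iw) -(integZ _ iu) -integD; [|exact: integrableZ_on..].
  by apply: eq_integ => z _; ring.
have A3 : integ h (fun z => (mu * u z - f * u z ^+ 3) * eta z) =
    2 * lam * integ h (fun z => g z * eta z).
  rewrite -integZ; last by int_tac.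
  apply: eq_integ => z _; rewrite /g /m /nu; field; exact: lt0r_neq0.
rewrite A1 A2 A3 => E.
have i2 : integrable_on h (fun z => u z * zt2 z) by int_tac.
have i1 : integrable_on h (fun z => u z * zt z) by int_tac.
transitivity (integ h (fun z => u z * zt2 z + 2 * q ^+ 2 * (u z * zt z)
    + q ^+ 4 * (u z * eta z))).
  by apply: eq_integ => z _; ring.
rewrite integD; [|by apply: integrableD_on => //; exact: integrableZ_on
  |exact: integrableZ_on].
rewrite integD//; last exact: integrableZ_on.
rewrite (integZ _ i1) (integZ _ iu).
have l2 : 2 * lam != 0 by rewrite mulf_neq0// gt_eqF.
apply: (mulfI l2); rewrite -E; ring.
Qed.

(** The test functions sin (q z) and cos (q z) are annihilated by L^2, as q^4 - 2 q^4 + q^4 = 0, so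
    only the source remains. *)
Lemma weak_orth : orth h q g.
Proof.
have dS := @is_derive1_sin R q; have dC := @is_derive1_cos R q.
have dZ (k : R) F F1 : deriv_of F F1 -> deriv_of (fun z => k * F z) (fun z => k * F1 z).
  by move=> d z; exact: is_derive1Z.
have cS c : continuous (fun z => c * S z).
  by move=> z; apply: cvgM; [exact: cvg_cst|exact: (derive_continuous dS)].
have cC c : continuous (fun z => c * C z).
  by move=> z; apply: cvgM; [exact: cvg_cst|exact: (derive_continuous dC)].
have dC' : deriv_of (fun z => C z) (fun z => - q * S z).
  by move=> z; apply: (is_derive_eq (dC z)); rewrite mulNr.
have zero (F : R -> R) (k : R) : k = 0 -> integ h (fun z => u z * (k * F z)) = 0.
  by move=> ->; apply: etrans (integ0 h); apply: eq_integ => z _; ring.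
have d2S (c : R) : deriv_of (fun z => c * C z) (fun z => - (c * q) * S z).
  by move=> z; apply: (is_derive_eq (dZ c _ _ dC' z)); ring.
have d2C (c : R) : deriv_of (fun z => c * S z) (fun z => (c * q) * C z).
  by move=> z; apply: (is_derive_eq (dZ c _ _ dS z)); ring.
split.
- have := @weak_test (fun z => S z) (fun z => q * C z) (fun z => - (q * q) * S z)
    (fun z => - (q * q) * S z) (fun z => (- (q * q) * q) * C z)
    (fun z => - (- (q * q) * q * q) * S z) dS (d2S q) (cS _) (d2C _) (d2S _) (cS _).
  rewrite sin_qh cos_qh mulr0 sin0 cos0 !mulr0 => /(_ _ erefl erefl erefl erefl) <-//.
  transitivity (integ h (fun z => u z * ((q ^+ 4 - 2 * q ^+ 2 * q ^+ 2 + q ^+ 4) * S z))).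
    by apply: eq_integ => z _; ring.
  by apply: (zero (fun z => S z)); ring.
- have := @weak_test (fun z => C z) (fun z => - q * S z) (fun z => (- q * q) * C z)
    (fun z => (- q * q) * C z) (fun z => - (- q * q * q) * S z)
    (fun z => (- (- q * q * q) * q) * C z) dC' (d2C _) (cC _) (d2S _) (d2C _) (cC _).
  rewrite sin_qh cos_qh mulr0 sin0 cos0 !mulr0 => /(_ _ erefl erefl erefl erefl) <-//.
  transitivity (integ h (fun z => u z * ((q ^+ 4 - 2 * q ^+ 2 * q ^+ 2 + q ^+ 4) * C z))).
    by apply: eq_integ => z _; ring.
  by apply: (zero (fun z => C z)); ring.
Qed.

(** The test function is eta = [green2 h q k], for which L^2 eta = k on [[0, h]]; all derivatives
    fall on eta, and [zt] extends its second derivative. *)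
Lemma weak_green2 k : cont_on h k -> orth h q k ->
  integ h (fun z => u z * k z) = integ h (fun z => g z * green2 h q k z).
Proof.
move=> kc ko.
have wc := green_cont_on h0 q0 kc.
have d1 := green2_derive h0 q0 kc; have d2 := dgreen2_derive h0 q0 kc.
have e1 := green_derive h0 q0 kc; have e2 := dgreen_derive h0 q0 kc.
pose zt z := green h q k z - q ^+ 2 * green2 h q k z.
pose zt1 z := dgreen h q k z - q ^+ 2 * dgreen2 h q k z.
pose zt2 z := (k (clamp h z) - q ^+ 2 * green h q k z) - q ^+ 2 * ddgreen2 h q k z.
have ddE z : ddgreen2 h q k z = green h q k (clamp h z) - q ^+ 2 * green2 h q k z.
  by [].
have f1 : deriv_of zt zt1 by move=> z; exact: is_derive1B (e1 z) (is_derive1Z _ (d1 z)).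
have f2 : deriv_of zt1 zt2 by move=> z; exact: is_derive1B (e2 z) (is_derive1Z _ (d2 z)).
have c2 : continuous (ddgreen2 h q k).
  have -> : ddgreen2 h q k = fun z => green h q k (clamp h z) - q ^+ 2 * green2 h q k z.
    exact/funext.
  move=> z; apply: cvgB; first exact: (cont_on_clamp h0 wc).
  by apply: cvgM; [exact: cvg_cst|exact: (derive_continuous d1)].
have c3 : continuous zt2.
  move=> z; apply: cvgB; last by apply: cvgM; [exact: cvg_cst|exact: c2].
  apply: cvgB; first exact: (cont_on_clamp h0 kc).
  by apply: cvgM; [exact: cvg_cst|exact: (derive_continuous e1)].
have ext z : 0 <= z <= h -> ddgreen2 h q k z = zt z.
  by move=> zI; rewrite ddE clamp_id.
have p0 := green2_per h0 q0 sin_qh cos_qh kc.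
have p1 := dgreen2_per h0 q0 sin_qh cos_qh kc.
have r0 : zt 0 = zt h by rewrite /zt p0 (green_per h0 sin_qh cos_qh kc ko).
have r1 : zt1 0 = zt1 h by rewrite /zt1 p1 (dgreen_per h0 sin_qh cos_qh kc ko).
rewrite -(weak_test d1 d2 c2 f1 f2 c3 ext p0 p1 r0 r1).
apply: eq_integ => z /andP[z0 zh]; congr (_ * _).
rewrite /zt2 /zt ddE !clamp_id ?ltW//.
by move: (green h q k z) (green2 h q k z) => x y; ring.
Qed.

(** Let y be the difference of both sides, which is orthogonal to the kernel. Then the integral of
    y^2 reduces to that of u y minus that of [green2 g] times y, and both equal the integral of g
    times [green2 y], by duality and by symmetry. *)
Lemma weak_representation z : 0 <= z <= h ->
  u z = coefS h q u * S z + coefC h q u * C z + green2 h q g z.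
Proof.
move=> zI; have go := weak_orth.
have Tc := green2_cont_on h0 q0 gc; have To := green2_orth h0 q0 sin_qh gc.
have sc := @sinq_cont_on R h q; have kc := @cosq_cont_on R h q.
pose p x := u x - coefS h q u * S x - coefC h q u * C x.
have po : orth h q p by exact: orth_proj.
have pc : cont_on h p by rewrite /p; cont_tac.
pose y x := p x - green2 h q g x.
have yc : cont_on h y by apply: cont_onB.
have yo : orth h q y.
  have [p1 p2] := po; have [t1 t2] := To.
  have e (k : R -> R) : cont_on h k -> integ h (fun x => y x * k x) =
      integ h (fun x => p x * k x) - integ h (fun x => green2 h q g x * k x).
    move=> kc'; rewrite -integB; [|by int_tac|by int_tac].
    by apply: eq_integ => x _; rewrite /y mulrBl.
  by split; rewrite e// ?p1 ?t1 ?p2 ?t2 subrr.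
suff : y z = 0 by rewrite /y /p; lra.
apply: (integ_sqr_eq0 h0 yc) => //.
have [y1 y2] := yo.
transitivity (integ h (fun x => u x * y x - coefS h q u * (y x * S x)
   - coefC h q u * (y x * C x) - green2 h q g x * y x)).
  by apply: eq_integ => x _; rewrite expr2 {1}/y /p; move: (y x) (green2 _ _ _ _) => v v'; ring.
have i1 : integrable_on h (fun x => u x * y x) by int_tac.
have i2 : integrable_on h (fun x => y x * S x) by int_tac.
have i3 : integrable_on h (fun x => y x * C x) by int_tac.
have i4 : integrable_on h (fun x => green2 h q g x * y x) by int_tac.
have j2 := integrableZ_on (coefS h q u) i2.
have j3 := integrableZ_on (coefC h q u) i3.
have k2 := integrableB_on i1 j2; have k3 := integrableB_on k2 j3.
rewrite (integB k3 i4) (integB k2 j3) (integB i1 j2) (integZ _ i2) (integZ _ i3) y1 y2.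
by rewrite (weak_green2 yc yo) (green2_sym gc yc go yo) !mulr0 !subr0 subrr.
Qed.

End Representation.

(** * Uniqueness *)

Section Reduced.
Context {R : realType} (h q nu : R).
Hypotheses (h0 : 0 < h) (q0 : 0 < q) (nu0 : 0 < nu).
Hypotheses (sin_qh : sin (q * h) = 0) (cos_qh : cos (q * h) = 1).
Implicit Types (u g : R -> R) (z a b m : R).

Local Notation S z := (sin (q * z)).
Local Notation C z := (cos (q * z)).
Local Notation Gc := (green_const h q).

Definition source m u z := m * u z - nu * u z ^+ 3.

(** The Lyapunov-Schmidt form, with amplitude [a]. The cosine coefficient is left existential:
    [u 0 = 0] expresses it through the value of [green2] at 0. *)
Definition reduced a m u := [/\ cont_on h u, orth h q (source m u), u 0 = 0 &
  exists b, forall z, 0 <= z <= h -> u z = a * S z + b * C z + green2 h q (source m u) z].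

Lemma source_cont_on m u : cont_on h u -> cont_on h (source m u).
Proof. by move=> uc; rewrite /source; cont_tac. Qed.

Lemma reduced_coef a m u : reduced a m u -> integ h (fun z => u z * S z) = a * (h / 2).
Proof.
move=> [uc go u0 [b ub]]; have gc : cont_on h (source m u) by exact: source_cont_on.
have Tc := green2_cont_on h0 q0 gc; have [T1 _] := green2_orth h0 q0 sin_qh gc.
have sc := @sinq_cont_on R h q; have kc := @cosq_cont_on R h q.
have i1 : integrable_on h (fun z => S z ^+ 2) by int_tac.
have i2 : integrable_on h (fun z => S z * C z) by int_tac.
have i3 : integrable_on h (fun z => green2 h q (source m u) z * S z).
  exact: cont_on_integrable (cont_onM Tc sc).
have j1 := integrableZ_on a i1; have j2 := integrableZ_on b i2.
transitivity (integ h (fun z => a * (S z ^+ 2) + b * (S z * C z)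
    + green2 h q (source m u) z * S z)).
  apply: eq_integ => z /andP[z1 z2]; rewrite ub ?ltW//.
  by move: (green2 _ _ _ _) => x; ring.
rewrite (integD (integrableD_on j1 j2) i3) (integD j1 j2) (integZ _ i1) (integZ _ i2) T1.
by rewrite (integ_sin2 h0 q0 sin_qh) (integ_sin_cos h0 q0 sin_qh) mulr0 !addr0.
Qed.

(** The solvability condition against the sine. For [a != 0] it recovers [m] from [u], so that
    differences of [m] are controlled by differences of [u]. *)
Lemma reduced_eigen a m u : reduced a m u ->
  m * a = nu * (2 / h * integ h (fun z => u z ^+ 3 * S z)).
Proof.
move=> ur; have [uc [go _] _ _] := ur.
have sc := @sinq_cont_on R h q.
have i1 : integrable_on h (fun z => u z * S z) by int_tac.
have i2 : integrable_on h (fun z => u z ^+ 3 * S z) by int_tac.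
have : m * integ h (fun z => u z * S z) - nu * integ h (fun z => u z ^+ 3 * S z) = 0.
  rewrite -(integZ _ i1) -(integZ _ i2) -integB; [|exact: integrableZ_on..].
  by rewrite -[RHS]go; apply: eq_integ => z _; rewrite /source; ring.
rewrite (reduced_coef ur) => /subr0_eq e.
have -> : m * a = 2 / h * (m * (a * (h / 2))) by field; rewrite gt_eqF.
by rewrite e mulrCA.
Qed.

(** With X the maximum of [|u|], the Green term and the cosine coefficient are each at most X / 8,
    so X <= |a| + X / 4. The constant 16 is [2 * 2 ^+ 3]: the bound [2 * |a|] cubed in the
    solvability condition, with the factor 2 of [norm_coef]. *)
Lemma reduced_small a m u k : reduced a m u ->
  (forall z, 0 <= z <= h -> `|u z| <= k) -> Gc * (`|m| + nu * k ^+ 2) <= 8^-1 ->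
  (forall z, 0 <= z <= h -> `|u z| <= 2 * `|a|) /\ (a != 0 -> `|m| <= 16 * nu * a ^+ 2).
Proof.
move=> ur uk Gk; have [uc go u0 [b ub]] := ur; have gc : cont_on h (source m u) by exact: source_cont_on.
have [X [X0 uX [c cI cX]]] := cont_on_max h0 uc.
have Xk : X <= k by rewrite -cX uk.
have G0 := green_const_gt0 h0 q0.
have gX z : 0 <= z <= h -> `|source m u z| <= (`|m| + nu * k ^+ 2) * X.
  move=> zI; rewrite /source (le_trans (ler_normB _ _))// (normrM m) (normrM nu) normrX (gtr0_norm nu0).
  rewrite mulrDl lerD//; first by rewrite ler_wpM2l// uX.
  rewrite -mulrA ler_wpM2l ?(ltW nu0)// exprSr ler_pM ?exprn_ge0//; last exact: uX.
  by rewrite lerXn2r ?nnegrE ?(le_trans (normr_ge0 _) (uk _ zI)) ?uk.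
have B0 : 0 <= (`|m| + nu * k ^+ 2) * X by rewrite mulr_ge0// addr_ge0// mulr_ge0 ?sqr_ge0// ltW.
have TX z : 0 <= z <= h -> `|green2 h q (source m u) z| <= 8^-1 * X.
  move=> zI; have [T _ _] := green2_bound h0 q0 gc B0 gX zI.
  by rewrite (le_trans T)// mulrA ler_wpM2r.
have hI : 0 <= (0 : R) <= h by rewrite lexx ltW.
have bX : `|b| <= 8^-1 * X.
  have := ub 0 hI; rewrite u0 mulr0 sin0 cos0 mulr0 add0r mulr1 => e.
  have -> : b = - green2 h q (source m u) 0 by apply/eqP; rewrite -addr_eq0 -e.
  by rewrite normrN TX.
have Xa : X <= 2 * `|a|.
  have X1 : X <= `|a| + 8^-1 * X + 8^-1 * X.
    rewrite -{1}cX ub// (le_trans (ler_normD _ _))// lerD ?TX//.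
    rewrite (le_trans (ler_normD _ _))// lerD// normrM.
      by rewrite ler_piMr// sinq_norm.
    by rewrite (le_trans _ bX)// ler_piMr// cosq_norm.
  by have := normr_ge0 a; lra.
split=> [z zI|a0]; first exact: le_trans (uX z zI) Xa.
have a1 : 0 < `|a| by rewrite normr_gt0.
have B1 z : 0 <= z <= h -> `|u z ^+ 3| <= 8 * `|a| ^+ 3.
  move=> zI; have -> : 8 * `|a| ^+ 3 = (2 * `|a|) ^+ 3 by ring.
  rewrite normrX lerXn2r ?nnegrE ?mulr_ge0// (le_trans (uX z zI))//.
have sc := @sinq_cont_on R h q.
have u3c : cont_on h (fun z => u z ^+ 3) by cont_tac.
have := norm_coef h0 sc u3c (@sinq_norm R q) B1.
have := congr1 Num.norm (reduced_eigen ur).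
rewrite [X in X = _]normrM [X in _ = X]normrM (gtr0_norm nu0).
set J := `|2 / h * _| => e J1.
rewrite -(ler_pM2r a1) e -real_normK ?num_real//.
have -> : 16 * nu * `|a| ^+ 2 * `|a| = nu * (2 * (8 * `|a| ^+ 3)) by ring.
by rewrite ler_wpM2l// ltW.
Qed.

(** With E the maximum of [|u1 - u2|], the cubes differ by at most 12 A^2 E, hence m1 and m2 by 24
    nu A E. The sources differ by (16 + 48 + 12) nu A^2 E, whence 76, and the contraction reads E <=
    E / 4 + E / 4. *)
Lemma reduced_unique a m1 m2 u1 u2 : reduced a m1 u1 -> reduced a m2 u2 -> a != 0 ->
  (forall z, 0 <= z <= h -> `|u1 z| <= 2 * `|a|) ->
  (forall z, 0 <= z <= h -> `|u2 z| <= 2 * `|a|) ->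
  `|m1| <= 16 * nu * a ^+ 2 -> Gc * (76 * nu * a ^+ 2) <= 4^-1 ->
  m1 = m2 /\ (forall z, 0 <= z <= h -> u1 z = u2 z).
Proof.
move=> r1 r2 a0 B1 B2 M1 Ga.
have [c1 go1 u10 [b1 ub1]] := r1; have [c2 go2 u20 [b2 ub2]] := r2.
have gc1 : cont_on h (source m1 u1) by exact: source_cont_on.
have gc2 : cont_on h (source m2 u2) by exact: source_cont_on.
have a1 : 0 < `|a| by rewrite normr_gt0.
rewrite -real_normK ?num_real// in M1 Ga; set A := `|a| in B1 B2 M1 Ga a1.
pose e z := u1 z - u2 z; have ec : cont_on h e by exact: cont_onB.
have [E [E0 eE [x0 xI ex]]] := cont_on_max h0 ec.
have cub z : 0 <= z <= h -> `|u1 z ^+ 3 - u2 z ^+ 3| <= 12 * A ^+ 2 * E.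
  move=> zI; have := B1 z zI; have := B2 z zI; have := eE z zI; rewrite /e.
  move: (u1 z) (u2 z) => x y.
  have -> : x ^+ 3 - y ^+ 3 = (x ^+ 2 + x * y + y ^+ 2) * (x - y) by ring.
  move=> H Hy Hx; rewrite normrM ler_pM//.
  rewrite (le_trans (ler_normD _ _))//.
  have -> : 12 * A ^+ 2 = (2 * A * (2 * A) + 2 * A * (2 * A)) + 2 * A * (2 * A) by ring.
  rewrite lerD//; last by rewrite expr2 normrM ler_pM.
  by rewrite (le_trans (ler_normD _ _))// lerD// ?expr2 normrM ler_pM.
have dm : `|m1 - m2| <= 24 * nu * A * E.
  have sc := @sinq_cont_on R h q.
  have cc : cont_on h (fun z => u1 z ^+ 3 - u2 z ^+ 3) by cont_tac.
  have := norm_coef h0 sc cc (@sinq_norm R q) cub.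
  have i1 : integrable_on h (fun z => u1 z ^+ 3 * S z) by int_tac.
  have i2 : integrable_on h (fun z => u2 z ^+ 3 * S z) by int_tac.
  have e1 := reduced_eigen r1; have e2 := reduced_eigen r2.
  have -> : 2 / h * integ h (fun z => (u1 z ^+ 3 - u2 z ^+ 3) * S z) =
      2 / h * integ h (fun z => u1 z ^+ 3 * S z) - 2 / h * integ h (fun z => u2 z ^+ 3 * S z).
    by rewrite -mulrBr -(integB i1 i2); congr (_ * _); apply: eq_integ => z _; ring.
  move: e1 e2; set J1 := 2 / h * _; set J2 := 2 / h * _ => e1 e2 J12.
  have e3 : (m1 - m2) * a = nu * (J1 - J2) by rewrite mulrBl e1 e2 mulrBr.
  have := congr1 Num.norm e3.
  rewrite [X in X = _]normrM [X in _ = X]normrM (gtr0_norm nu0) -/A => e4.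
  rewrite -(ler_pM2r a1) e4.
  have -> : 24 * nu * A * E * A = nu * (2 * (12 * A ^+ 2 * E)) by ring.
  by rewrite ler_wpM2l// ltW.
pose g z := source m1 u1 z - source m2 u2 z.
have gc : cont_on h g by exact: cont_onB.
have gE z : 0 <= z <= h -> `|g z| <= 76 * nu * A ^+ 2 * E.
  move=> zI.
  have -> : g z = m1 * e z + (m1 - m2) * u2 z - nu * (u1 z ^+ 3 - u2 z ^+ 3).
    by rewrite /g /source /e; ring.
  have -> : 76 * nu * A ^+ 2 * E =
    16 * nu * A ^+ 2 * E + 24 * nu * A * E * (2 * A) + nu * (12 * A ^+ 2 * E) by ring.
  rewrite (le_trans (ler_normB _ _))// lerD//; last first.
    by rewrite normrM (gtr0_norm nu0) ler_wpM2l ?cub// ltW.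
  rewrite (le_trans (ler_normD _ _))// lerD// normrM ler_pM//.
  - exact: eE.
  - exact: B2.
have K0 : 0 <= 76 * nu * A ^+ 2 * E by rewrite !mulr_ge0// ltW.
have TE z : 0 <= z <= h -> `|green2 h q g z| <= 4^-1 * E.
  move=> zI; have [T _ _] := green2_bound h0 q0 gc K0 gE zI.
  by rewrite (le_trans T)// mulrA ler_wpM2r.
have eT z : 0 <= z <= h -> e z = (b1 - b2) * C z + green2 h q g z.
  move=> zI; rewrite /e ub1// ub2//.
  have := @green2_linear R h q h0 q0 _ _ (-1) z gc1 gc2.
  have -> : green2 h q (fun y => source m1 u1 y + -1 * source m2 u2 y) = green2 h q g.
    by apply: eq_green2 => // y _; rewrite mulN1r.
  move=> ->; move: (green2 _ _ _ _) (green2 _ _ _ _) => v w; ring.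
have hI : 0 <= (0 : R) <= h by rewrite lexx ltW.
have bE : `|b1 - b2| <= 4^-1 * E.
  have := eT 0 hI; rewrite /e u10 u20 subrr mulr0 cos0 mulr1 => e0.
  have -> : b1 - b2 = - green2 h q g 0 by apply/eqP; rewrite -addr_eq0 -e0.
  by rewrite normrN TE.
have EE : E = 0.
  have : E <= 4^-1 * E + 4^-1 * E.
    rewrite -{1}ex eT// (le_trans (ler_normD _ _))// lerD ?TE//.
    by rewrite normrM (le_trans _ bE)// ler_piMr// cosq_norm.
  by lra.
split.
  by apply/eqP; rewrite -subr_eq0 -normr_le0 (le_trans dm)// EE mulr0.
by move=> z zI; apply/eqP; rewrite -subr_eq0 -normr_le0 (le_trans (eE z zI))// EE.
Qed.

Lemma reduced_zero m u k : reduced 0 m u ->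
  (forall z, 0 <= z <= h -> `|u z| <= k) -> Gc * (`|m| + nu * k ^+ 2) <= 8^-1 ->
  vanishes h u.
Proof.
move=> ur uk Gk z zI; have [H _] := reduced_small ur uk Gk.
by apply/eqP; rewrite -normr_le0 (le_trans (H z zI))// normr0 mulr0.
Qed.

Lemma weak_reduced lam mu f u : 0 < lam -> Wrho h u -> u 0 = 0 ->
  f / (2 * lam) = nu -> weak_smectic h lam q mu f u ->
  reduced (coefS h q u) (mu / (2 * lam)) u.
Proof.
move=> l0 uW u0 fnu weak.
have go := weak_orth h0 sin_qh cos_qh l0 uW weak.
have ub := weak_representation h0 q0 sin_qh cos_qh l0 uW weak.
rewrite fnu in go ub; split => //; first by case: uW => [[[]]].
by exists (coefC h q u).
Qed.

End Reduced.

(** * Solutions of the integral equation are weak solutions *)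

Section Converse.
Context {R : realType} (h q nu : R).
Hypotheses (h0 : 0 < h) (q0 : 0 < q) (nu0 : 0 < nu).
Hypotheses (sin_qh : sin (q * h) = 0) (cos_qh : cos (q * h) = 1).
Implicit Types (u g : R -> R) (z a b m : R).

Local Notation S z := (sin (q * z)).
Local Notation C z := (cos (q * z)).

(** The mirror image of [weak_test]: [u] is explicit and the test function only W^{2,2}, so the
    derivatives are moved onto [u], with [zt] the C^2 extension of its second derivative from
    [[0, h]]. *)
Lemma green2_weak lam m t u : 0 < lam ->
  cont_on h u -> orth h q (source nu m u) ->
  (forall z, u z = t * S z + green2 h q (source nu m u) z) ->
  Wrho h u /\ weak_smectic h lam q (2 * lam * m) (2 * lam * nu) u.
Proof.
move=> l0 uc go uE; have gc : cont_on h (source nu m u) by exact: source_cont_on.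
set g := source nu m u in go uE gc.
have d1 := green2_derive h0 q0 gc; have d2 := dgreen2_derive h0 q0 gc.
have e1 := green_derive h0 q0 gc; have e2 := dgreen_derive h0 q0 gc.
have dc := ddgreen2_cont_on h0 q0 gc; have Gcc := green_cont_on h0 q0 gc.
have dS := @is_derive1_sin R q; have dC := @is_derive1_cos R q.
have sc := @sinq_cont_on R h q.
pose u1 z := t * (q * C z) + dgreen2 h q g z.
pose u2 z := t * (q * - (q * S z)) + ddgreen2 h q g z.
pose zt z := t * (q * (- q * S z)) + (green h q g z - q ^+ 2 * green2 h q g z).
pose zt1 z := t * (q * (- q * (q * C z))) + (dgreen h q g z - q ^+ 2 * dgreen2 h q g z).
pose zt2 z := t * (q * (- q * (q * - (q * S z)))) +
  ((g (clamp h z) - q ^+ 2 * green h q g z) - q ^+ 2 * ddgreen2 h q g z).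
have ddE z : ddgreen2 h q g z = green h q g (clamp h z) - q ^+ 2 * green2 h q g z by [].
have du : deriv_of u u1.
  have -> : u = fun z => t * S z + green2 h q g z by exact/funext.
  by move=> z; exact: is_derive1D (is_derive1Z t (dS z)) (d1 z).
have du1 : deriv_of u1 u2.
  by move=> z; exact: is_derive1D (is_derive1Z t (is_derive1Z q (dC z))) (d2 z).
have u2c : cont_on h u2.
  by apply: cont_onD => //; cont_tac.
have f1 : deriv_of zt zt1.
  by move=> z; exact: is_derive1D (is_derive1Z t (is_derive1Z q (is_derive1Z (- q) (dS z))))
    (is_derive1B (e1 z) (is_derive1Z _ (d1 z))).
have f2 : deriv_of zt1 zt2.
  by move=> z; exact: is_derive1D
    (is_derive1Z t (is_derive1Z q (is_derive1Z (- q) (is_derive1Z q (dC z)))))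
    (is_derive1B (e2 z) (is_derive1Z _ (d2 z))).
have cs : continuous (fun z => S z) by exact: derive_continuous dS.
have c2 : continuous (ddgreen2 h q g).
  have -> : ddgreen2 h q g = fun z => green h q g (clamp h z) - q ^+ 2 * green2 h q g z.
    exact/funext.
  move=> z; apply: cvgB; first exact: (cont_on_clamp h0 Gcc).
  by apply: cvgM; [exact: cvg_cst|exact: (derive_continuous d1)].
have cq : continuous (fun z => t * (q * (- q * (q * - (q * S z))))).
  have -> : (fun z => t * (q * (- q * (q * - (q * S z))))) = (fun z => (t * q ^+ 4) * S z).
    by apply/funext => x; ring.
  by move=> z; apply: cvgM; [exact: cvg_cst|exact: cs].
have c3 : continuous zt2.
  move=> z; apply: cvgD; first exact: cq.
  apply: cvgB; last by apply: cvgM; [exact: cvg_cst|exact: c2].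
  apply: cvgB; first exact: (cont_on_clamp h0 gc).
  by apply: cvgM; [exact: cvg_cst|exact: (derive_continuous e1)].
have ext z : 0 <= z <= h -> u2 z = zt z.
  by move=> zI; rewrite /u2 /zt ddE clamp_id// mulNr.
have p0 := green2_per h0 q0 sin_qh cos_qh gc.
have p1 := dgreen2_per h0 q0 sin_qh cos_qh gc.
have w0 := green_per h0 sin_qh cos_qh gc go.
have w1 := dgreen_per h0 sin_qh cos_qh gc go.
have r0 : u 0 = u h by rewrite !uE p0 sin_qh mulr0 sin0.
have r1 : u1 0 = u1 h by rewrite /u1 p1 cos_qh mulr0 cos0.
have s0 : zt 0 = zt h by rewrite /zt w0 p0 sin_qh mulr0 sin0.
have s1 : zt1 0 = zt1 h by rewrite /zt1 w1 p1 cos_qh mulr0 cos0.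
have h0h : 0 <= h <= h by rewrite lexx ltW.
have h00 : 0 <= (0 : R) <= h by rewrite lexx ltW.
have r2 : u2 0 = u2 h by rewrite !ext.
split; first exact: C2_Wrho du du1 u2c r0 r1 r2.
move=> eta etaW.
have etac : cont_on h eta by case: etaW => [[[]]].
have etaL : L2 h (wD h (wD h eta)) by apply: W22_wD2_L2; case: etaW.
have A1 : integ h (fun z => wD h (wD h u) z * wD h (wD h eta) z) =
    integ h (fun z => eta z * zt2 z).
  rewrite (C2_wD2_integ h0 du du1 u2c etaL) -(Wrho_ibp h0 etaW f1 f2 c3 s0 s1).
  by apply: eq_integ => z /andP[z0 zh]; rewrite ext ?ltW// mulrC.
have A2 : integ h (fun z => wD h (wD h u) z * eta z) = integ h (fun z => u2 z * eta z).
  by apply: (C2_wD2_integ h0 du du1 u2c); exact: cont_on_L2.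
have uL : L2 h (wD h (wD h u)).
  by apply: W22_wD2_L2; exact: C2_W22 du du1 u2c.
have zc : cont_on h zt2 by exact: continuous_cont_on.
have i1 : integrable_on h (fun z => wD h (wD h u) z * wD h (wD h eta) z) by exact: L2M.
have i2 : integrable_on h (fun z => wD h (wD h u) z * eta z).
  by apply: L2M => //; exact: cont_on_L2.
have i3 : integrable_on h (fun z => u z * eta z) by exact: cont_on_integrable (cont_onM uc etac).
have i4 : integrable_on h (fun z => eta z * zt2 z) by exact: cont_on_integrable (cont_onM etac zc).
have i5 : integrable_on h (fun z => u2 z * eta z) by exact: cont_on_integrable (cont_onM u2c etac).
transitivity (2 * lam * integ h (fun z => wD h (wD h u) z * wD h (wD h eta) z)
  + (4 * lam * q ^+ 2 * integ h (fun z => wD h (wD h u) z * eta z)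
     + 2 * lam * q ^+ 4 * integ h (fun z => u z * eta z))).
  have j2 := integrableZ_on (4 * lam * q ^+ 2) i2.
  have j3 := integrableZ_on (2 * lam * q ^+ 4) i3.
  rewrite -(integZ _ i1) -(integZ _ i2) -(integZ _ i3) -(integD j2 j3).
  apply: (congr2 +%R); apply: eq_integ => z _; first by rewrite -mulrA.
  by rewrite mulrDl -!mulrA.
rewrite A1 A2.
have P z : 0 <= z <= h -> 2 * lam * zt2 z + 4 * lam * q ^+ 2 * u2 z + 2 * lam * q ^+ 4 * u z
    = 2 * lam * g z.
  move=> zI; rewrite (ext _ zI) /zt2 /zt ddE clamp_id// [u z]uE.
  by move: (green _ _ _ _) (green2 _ _ _ _) (g z) => x y w; ring.
clear A1 A2 i1 i2; clearbody zt2 u2.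
have j4 := integrableZ_on (2 * lam) i4.
have j5 := integrableZ_on (4 * lam * q ^+ 2) i5.
have j3 := integrableZ_on (2 * lam * q ^+ 4) i3.
have := integD j4 (integrableD_on j5 j3).
rewrite (integD j5 j3) (integZ _ i4) (integZ _ i5) (integZ _ i3) => <-.
apply: eq_integ => z /andP[z1 z2].
have zI : 0 <= z <= h by rewrite !ltW.
transitivity (2 * lam * g z * eta z); last by rewrite /g /source; ring.
rewrite -P//; ring.
Qed.

End Converse.

(** * The angle vanishes *)

Section Theta.
Context {R : realType}.
Implicit Types (x : R).

(** The cosine is within 1/2 of 1 on the interval, so the sine is within x / 2 of x. *)
Lemma sin_mul_bounds x : `|x| <= 2^-1 -> 2^-1 * x ^+ 2 <= sin x * x <= x ^+ 2.
Proof.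
wlog x0 : x / 0 <= x => [H|].
  case: (leP 0 x) => [|/ltW] x0; first exact: H.
  have := H (- x); rewrite oppr_ge0 normrN sinN sqrrN mulrNN; exact.
rewrite ger0_norm// => x1.
have dsin : deriv_of sin (@cos R) by move=> z; exact: is_derive_sin.
have dcos : deriv_of cos (fun z : R => - sin z) by move=> z; exact: is_derive_cos.
have s1 : sin x <= x.
  have := @derive_norm_le _ _ _ 1 _ _ dsin x0 (fun z _ => ltac:(by rewrite ler_norml cos_geN1 cos_le1)).
  by rewrite sin0 !subr0 mul1r; exact: le_trans (ler_norm _).
have c1 z : 0 <= z <= x -> `|cos z - 1| <= 2^-1.
  move=> /andP[z0 zx].
  have := @derive_norm_le _ _ _ 1 _ _ dcos z0 (fun z _ => ltac:(by rewrite normrN ler_norml sin_geN1 sin_le1)).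
  by rewrite cos0 subr0 mul1r => /le_trans; apply; exact: le_trans x1.
have dF : deriv_of (fun z => sin z - z) (fun z : R => cos z - 1).
  by move=> z; exact: is_derive1B (dsin z) (is_derive_id z 1).
have := derive_norm_le dF x0 c1.
rewrite sin0 !subr0 ler_norml => /andP[s2 _].
by apply/andP; split; rewrite expr2 ?mulrA ler_wpM2r//; lra.
Qed.

Variable h : R.
Hypothesis h0 : 0 < h.
Implicit Types (theta u : R -> R).

(** [16 * K * e ^+ 2 <= 1] forces [|2 * theta| <= 1/2], where [sin_mul_bounds] applies. The coupling
    term quadratic in the second derivative w of u has the good sign; the mixed one is bounded by
    u^2 + w^2 times the supremum of theta^2, that is by [P * e ^+ 2] times the squared norm of theta
    after integration, which [kap] dominates. *)
Lemma weak_theta_vanishes (k1 sigma lam2 q theta0 kap e : R) theta u :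
  let K := sup_const h in
  let P := 2 * lam2 * q ^+ 2 * cos theta0 ^+ 2 * K in
  0 < k1 -> 0 < lam2 -> kap <= 2 * k1 -> kap <= k1 * sigma ^+ 2 ->
  16 * K * e ^+ 2 <= 1 -> P * e ^+ 2 < kap ->
  W12 h theta -> W22 h u -> normW12 h theta <= e -> normW22 h u <= e ->
  weak_eq_theta h k1 sigma lam2 q theta0 theta u theta ->
  vanishes h theta.
Proof.
have fin (a b c d e' f : R) : a - b <= - c -> b <= f -> d <= a -> e' <= c -> d + e' - f <= 0.
  by lra.
move=> K P k10 l0 kap1 kap2 Ke Pe tW uW tN uN.
rewrite /weak_eq_theta; set w := wD h (wD h u) => H.
set c2 := cos theta0 ^+ 2 in P Pe H *.
have K0 : 0 < K by exact: sup_const_gt0.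
have c20 : 0 <= c2 by exact: sqr_ge0.
have P0 : 0 <= P.
  apply: mulr_ge0 (ltW K0); apply: mulr_ge0 c20; apply: mulr_ge0 (sqr_ge0 _).
  by rewrite mulr_ge0// ltW.
set N := normW12 h theta in tN.
have N0 : 0 <= N by exact: sqrtr_ge0.
have NE := normW12_sqr h theta; rewrite -/N in NE.
have e0 : 0 <= e by exact: le_trans N0 tN.
have Ne : N ^+ 2 <= e ^+ 2 by rewrite lerXn2r ?nnegrE.
have tsup z : 0 <= z <= h -> theta z ^+ 2 <= K * N ^+ 2 by exact: W12_sup.
have tc : cont_on h theta by case: tW.
have uc : cont_on h u by case: uW => [[]].
have tL : L2 h (wD h theta) by exact: W12_wD_L2.
have wL : L2 h w by exact: W22_wD2_L2.
have sc : cont_on h (fun z => sin (2 * theta z)).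
  by apply: (@cont_on_comp _ _ (fun z => 2 * theta z)); [exact: cont_onZ|exact: continuous_sin].
have s1c : cont_on h (fun z => sin (theta z)).
  by apply: cont_on_comp => //; exact: continuous_sin.
pose c1 z := k1 * sigma ^+ 2 * sin (2 * theta z) * theta z.
pose d1 z := 2 * lam2 * (sin (theta z) ^+ 2 * (sin (2 * theta z) * theta z)).
pose d2 z := 2 * lam2 * (q ^+ 2 * u z * c2 * (sin (2 * theta z) * theta z)).
have c1c : cont_on h c1 by rewrite /c1; cont_tac.
have d1c : cont_on h d1 by rewrite /d1; cont_tac.
have d2c : cont_on h d2 by rewrite /d2; cont_tac.
have i1 : integrable_on h c1 by exact: cont_on_integrable.
have i2 : integrable_on h (fun z => (w z * d1 z) * w z) by apply: L2M => //; exact: L2_cont.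
have i3 : integrable_on h (fun z => w z * d2 z) by apply: L2M => //; exact: cont_on_L2.
have iu : integrable_on h (fun z => u z ^+ 2) by exact: L2_sqr (cont_on_L2 uc).
have iw : integrable_on h (fun z => w z ^+ 2) by exact: L2_sqr.
have it : integrable_on h (fun z => theta z ^+ 2) by exact: L2_sqr (cont_on_L2 tc).
have itD : integrable_on h (fun z => wD h theta z ^+ 2) by exact: L2_sqr.
have iR := integrableD_on (integrableD_on i1 i2) i3.
have iL := integrableB_on (integrableZ_on (k1 * sigma ^+ 2) it)
  (integrableZ_on (P * N ^+ 2) (integrableD_on iu iw)).
have pt z : 0 < z < h ->
   k1 * sigma ^+ 2 * theta z ^+ 2 - P * N ^+ 2 * (u z ^+ 2 + w z ^+ 2) <=
   c1 z + w z * d1 z * w z + w z * d2 z.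
  move=> /andP[z1 z2]; have zI : 0 <= z <= h by rewrite !ltW.
  have tz := tsup z zI; rewrite /c1 /d1 /d2.
  have /sin_mul_bounds : `|2 * theta z| <= 2^-1.
    rewrite -[leRHS]gtr0_norm ?invr_gt0// -ler_sqr ?nnegrE//.
    rewrite !real_normK ?num_real//.
    have : K * N ^+ 2 <= K * e ^+ 2 by rewrite ler_pM2l.
    by move: tz Ke; rewrite exprMn; lra.
  set sg := sin (2 * theta z); have := sqr_ge0 (sin (theta z)).
  move: (sin (theta z) ^+ 2) => s s0 /andP[s1 s2].
  have g1 : theta z ^+ 2 <= sg * theta z by move: s1; rewrite exprMn; lra.
  have g2 : sg * theta z <= 2 * (K * N ^+ 2) by move: s2; rewrite exprMn; lra.
  have g0 : 0 <= sg * theta z by rewrite (le_trans _ g1)// sqr_ge0.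
  move: g0 g1 g2; rewrite -[_ * sg * _]mulrA; move: (sg * theta z) => y y0 y1 y2.
  have t1 : k1 * sigma ^+ 2 * theta z ^+ 2 <= k1 * sigma ^+ 2 * y.
    by rewrite ler_wpM2l// (mulr_ge0 (ltW k10) (sqr_ge0 _)).
  have t2 : 0 <= w z * (2 * lam2 * (s * y)) * w z.
    have -> : w z * (2 * lam2 * (s * y)) * w z = 2 * lam2 * (s * y) * w z ^+ 2 by ring.
    by rewrite (mulr_ge0 _ (sqr_ge0 _))// (mulr_ge0 (mulr_ge0 _ (ltW l0)))// mulr_ge0.
  have t3 : - (P * N ^+ 2 * (u z ^+ 2 + w z ^+ 2)) <= w z * (2 * lam2 * (q ^+ 2 * u z * c2 * y)).
    have -> : w z * (2 * lam2 * (q ^+ 2 * u z * c2 * y)) =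
        lam2 * q ^+ 2 * c2 * (y * (2 * (u z * w z))) by ring.
    have -> : - (P * N ^+ 2 * (u z ^+ 2 + w z ^+ 2)) =
        lam2 * q ^+ 2 * c2 * - (2 * (K * N ^+ 2) * (u z ^+ 2 + w z ^+ 2)).
      by rewrite /P; ring.
    apply: ler_wpM2l.
      by apply: mulr_ge0 c20; exact: mulr_ge0 (ltW l0) (sqr_ge0 _).
    rewrite lerNl -mulrN.
    apply: (@le_trans _ _ (y * (u z ^+ 2 + w z ^+ 2))).
      rewrite ler_wpM2l// -subr_ge0.
      have -> : u z ^+ 2 + w z ^+ 2 - - (2 * (u z * w z)) = (u z + w z) ^+ 2 by ring.
      exact: sqr_ge0.
    by rewrite ler_wpM2r// addr_ge0 ?sqr_ge0.
  by have := lerD (lerD t1 t2) t3; rewrite addr0.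
have I := le_integ iL iR pt.
have E : integ h (fun z => c1 z + w z * d1 z * w z + w z * d2 z) =
    - (2 * k1 * integ h (fun z => wD h theta z ^+ 2)).
  rewrite -(integZ _ itD); apply: etrans (etrans (esym H) _).
    by apply: eq_integ => z _; rewrite /c1 /d1 /d2; ring.
  by congr (- _); apply: eq_integ => z _; rewrite expr2 mulrA.
move: I; rewrite (integB (integrableZ_on (k1 * sigma ^+ 2) it)
  (integrableZ_on (P * N ^+ 2) (integrableD_on iu iw))).
rewrite (integZ _ it) (integZ _ (integrableD_on iu iw)) (integD iu iw).
rewrite E.
have n0 : 0 <= normW22 h u by exact: sqrtr_ge0.
have sqr_le (x y : R) : 0 <= x -> x <= y -> x ^+ 2 <= y ^+ 2.
  by move=> x0 xy; rewrite lerXn2r// nnegrE (le_trans x0 xy).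
have {}uN := sqr_le _ _ n0 uN.
rewrite normW22_sqr -/w in uN.
have UW : integ h (fun z => u z ^+ 2) + integ h (fun z => w z ^+ 2) <= e ^+ 2.
  move: uN; have : 0 <= integ h (fun z => wD h u z ^+ 2) by exact: integ_ge0 (fun z _ => sqr_ge0 _).
  move: (integ h _) (integ h _) (integ h _) => x y z; lra.
set A := integ h (fun z => theta z ^+ 2) in NE *.
set B := integ h (fun z => wD h theta z ^+ 2) in NE *.
have A0 : 0 <= A by apply: integ_ge0 => z _; exact: sqr_ge0.
have B0 : 0 <= B by apply: integ_ge0 => z _; exact: sqr_ge0.
move: UW; set J := integ h _ + integ h _ => UW I.
have N2 : 0 <= N ^+ 2 by exact: sqr_ge0.
have J1 : P * N ^+ 2 * J <= P * e ^+ 2 * N ^+ 2.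
  by rewrite mulrAC ler_wpM2r// ler_wpM2l.
have a1 : kap * A <= k1 * sigma ^+ 2 * A by rewrite ler_wpM2r.
have b1 : kap * B <= 2 * k1 * B by rewrite ler_wpM2r.
have : (kap - P * e ^+ 2) * N ^+ 2 <= 0.
  by rewrite mulrBl {1}NE mulrDr; exact: fin I J1 a1 b1.
rewrite pmulr_rle0 ?subr_gt0// => N20 z zI.
have NN : N ^+ 2 = 0 by apply/le_anti; rewrite N20 N2.
by apply/eqP; rewrite -sqrf_eq0; apply/eqP/le_anti; rewrite sqr_ge0 (le_trans (tsup z zI))// NN mulr0.
Qed.
End Theta.

(** * The bifurcation *)

Lemma sin_cos_2pin {R : realType} (n : nat) :
  sin (2 * pi * n%:R : R) = 0 /\ cos (2 * pi * n%:R : R) = 1.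
Proof.
elim: n => [|n [s c]]; first by rewrite mulr0 sin0 cos0.
have -> : 2 * pi * n.+1%:R = 2 * pi * n%:R + pi *+ 2 :> R.
  by rewrite mulr2n -natr1; ring.
by rewrite sinD2pi cosD2pi s c.
Qed.

(** The candidates are derivatives only for [|t| < delta]. As this set is open, agreement near each
    point is enough to pass from one order to the next. *)
Lemma smooth_on_iter {R : realType} (delta : R) (F : nat -> R -> R) :
  (forall n t, `|t| < delta -> is_derive t (1 : R) (F n) (F n.+1 t)) ->
  smooth_on delta (F 0%N).
Proof.
move=> dF.
have near_in (t : R) : `|t| < delta -> \forall s \near t, `|s| < delta.
  move=> td; have d0 : 0 < delta - `|t| by rewrite subr_gt0.
  near=> s; have : `|t - s| < delta - `|t| by near: s; exact: (@cvgr_dist_lt _ _ _ (nbhs t) _ id).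
  move=> H; rewrite -[s](addrNK t) (le_lt_trans (ler_normD _ _))// -ltrBrDr distrC//.
have dn n t : `|t| < delta -> derive1n n (F 0%N) t = F n t.
  elim: n t => [//|n IH] t td; rewrite derive1nS derive1E.
  have := dF n t td => Ft.
  rewrite (@near_eq_derive _ _ _ _ (F n))//; first exact: derive_val.
  by near=> s; apply: IH; near: s; exact: near_in.
move=> n t td; have Ft := dF n t td.
have nd : derivable (F n) t 1 by case: Ft.
apply: (near_eq_derivable _ nd).
by near=> s; apply/esym/dn; near: s; exact: near_in.
Unshelve. all: by end_near.
Qed.

(** Taking for [T] the sum of finitely many nonnegative constants meets all the conditions
    [c * e <= 1] at once. *)
Lemma exists_small {R : realType} (T : R) : 0 <= T -> exists e : R,
  [/\ 0 < e, e <= 1 & forall c, 0 <= c <= T -> c * e <= 1].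
Proof.
move=> T0; have T1 : 0 < T + 1 by rewrite ltr_wpDl.
exists (T + 1)^-1; split; first by rewrite invr_gt0.
  by rewrite invf_le1// lerDr.
move=> c /andP[c0 cT]; rewrite ler_pdivrMr// mul1r (le_trans cT)// lerDl//.
Qed.

Section Bifurcation.
Context {R : realType} (h q nu rho lam : R).
Hypotheses (h0 : 0 < h) (q0 : 0 < q) (nu0 : 0 < nu) (lam0 : 0 < lam).
Hypotheses (sin_qh : sin (q * h) = 0) (cos_qh : cos (q * h) = 1).
Hypotheses (rho0 : 0 < rho) (rr2 : rate h q nu * rho ^+ 2 <= 2^-1).

Local Notation br := (branch h q nu).
Local Notation mc := (mcurve h q nu).

Lemma branch_weak t : `|t| < rho ->
  Wrho h (br t) /\ weak_smectic h lam q (2 * lam * mc t) (2 * lam * nu) (br t).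
Proof.
move=> tr; apply: (@green2_weak _ _ _ _ h0 q0 sin_qh cos_qh _ _ t) => //.
- exact: branch_cont_on tr.
- exact: branch_orth tr.
- exact: branch_green tr.
Qed.

(** The source is odd in [u], so the opposite function solves the same equation with amplitude
    [- t]. *)
Lemma branchN_weak t : `|t| < rho ->
  Wrho h (fun z => - br t z) /\
  weak_smectic h lam q (2 * lam * mc t) (2 * lam * nu) (fun z => - br t z).
Proof.
move=> tr; have bc : cont_on h (br t) by exact: branch_cont_on tr.
have gc : cont_on h (source nu (mc t) (br t)) by exact: source_cont_on.
have sN z : source nu (mc t) (fun x => - br t x) z = -1 * source nu (mc t) (br t) z.
  by rewrite /source; ring.
apply: (@green2_weak _ _ _ _ h0 q0 sin_qh cos_qh _ _ (- t)) => //.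
- exact: cont_onN.
- have [p1 p2] : orth h q (source nu (mc t) (br t)) by exact: branch_orth tr.
  have sc := @sinq_cont_on R h q; have kc := @cosq_cont_on R h q.
  split; [move: p1|move: p2] => /(congr1 -%R); rewrite oppr0; apply: etrans.
    rewrite -integN; last exact: cont_on_integrable (cont_onM gc sc).
    by apply: eq_integ => z _; rewrite sN mulN1r mulNr.
  rewrite -integN; last exact: cont_on_integrable (cont_onM gc kc).
  by apply: eq_integ => z _; rewrite sN mulN1r mulNr.
- move=> z; rewrite (branch_green h0 q0 nu0 sin_qh cos_qh rho0 rr2 tr z).
  have -> : source nu (mc t) (fun x => - br t x) = fun z => -1 * source nu (mc t) (br t) z.
    exact/funext.
  by rewrite (green2Z _ _ _ _ gc)// /source mulN1r mulNr opprD.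
Qed.

Lemma branch_reduced t : `|t| < rho -> reduced h q nu t (mc t) (br t).
Proof.
move=> tr; split.
- exact: branch_cont_on tr.
- exact: branch_orth tr.
- by have [] := branch0 h0 q0 nu0 sin_qh cos_qh rho0 rr2 tr.
- exists 0 => z _; rewrite mul0r addr0; exact: branch_green tr z.
Qed.

(** The zero function is the integral equation with amplitude 0 and zero source. *)
Lemma zero_weak mu : weak_smectic h lam q mu (2 * lam * nu) (fun=> 0).
Proof.
have e0 : source nu (mu / (2 * lam)) (fun=> 0) = fun=> 0.
  by apply/funext => z; rewrite /source mulr0 expr0n/= mulr0 subrr.
have -> : mu = 2 * lam * (mu / (2 * lam)) by field; rewrite gt_eqF.
have zc : cont_on h (fun=> 0 : R) by exact: cst_cont_on.
have zo : orth h q (source nu (mu / (2 * lam)) (fun=> 0)).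
  by rewrite e0; split; apply: etrans (integ0 h); apply: eq_integ => z _; rewrite mul0r.
have zE (z : R) : 0 = 0 * sin (q * z) + green2 h q (source nu (mu / (2 * lam)) (fun=> 0)) z.
  by rewrite e0 green2_zero// mul0r addr0.
by have [] := green2_weak h0 q0 sin_qh cos_qh lam0 zc zo zE.
Qed.

Hypothesis Grho : green_const h q * (76 * nu * rho ^+ 2) <= 4^-1.

(** The parameter is the sine coefficient of [u]: the branch at that parameter has the same
    amplitude, and [reduced_unique] identifies both the function and [mu]. *)
Lemma weak_unique mu u k : Wrho h u -> u 0 = 0 ->
  weak_smectic h lam q mu (2 * lam * nu) u ->
  (forall z, 0 <= z <= h -> `|u z| <= k) -> 2 * k < rho ->
  green_const h q * (`|mu / (2 * lam)| + nu * k ^+ 2) <= 8^-1 ->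
  vanishes h u \/ exists t, [/\ `|t| < rho, `|t| <= 2 * k, mu = 2 * lam * mc t &
    forall z, 0 <= z <= h -> u z = br t z].
Proof.
move=> uW u0 weak uk kr Gk.
have fnu : 2 * lam * nu / (2 * lam) = nu by field; rewrite gt_eqF.
have ur := weak_reduced h0 q0 sin_qh cos_qh lam0 uW u0 fnu weak.
have uc : cont_on h u by case: uW => [[[]]].
set a := coefS h q u in ur.
have ak : `|a| <= 2 * k.
  exact: (norm_coef h0 (@sinq_cont_on R h q) uc (@sinq_norm R q) uk).
have [a0|a0] := eqVneq a 0.
  by left; rewrite a0 in ur; exact: reduced_zero ur uk Gk.
right; exists a; have ar := le_lt_trans ak kr.
have [u2 m16] := reduced_small h0 q0 nu0 sin_qh ur uk Gk.
have Ga : green_const h q * (76 * nu * a ^+ 2) <= 4^-1.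
  apply: le_trans Grho; rewrite ler_pM2l ?green_const_gt0// ler_pM2l ?mulr_gt0//.
  by rewrite -real_normK ?num_real// lerXn2r ?nnegrE ?(ltW rho0)// ltW.
have b2 := branch_norm h0 q0 nu0 sin_qh cos_qh rho0 rr2 ar.
have [e ue] := reduced_unique h0 q0 nu0 sin_qh ur (branch_reduced ar) a0 u2 b2 (m16 a0) Ga.
split => //; rewrite -e; field; rewrite gt_eqF//.
Qed.

End Bifurcation.

(** Here 304 = 4 * 76, and 16 = 2 * 8 where the extra factor 2 buys the strict inequality. *)
Lemma exists_rho {R : realType} (a b c nu : R) : 0 <= a -> 0 <= b -> 0 <= c -> 0 < nu ->
  exists rho : R, [/\ 0 < rho, a * rho ^+ 2 <= 4^-1,
    8 * b * (a * rho ^+ 2) < nu & c * (76 * nu * rho ^+ 2) <= 4^-1].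
Proof.
move=> a0 b0 c0 nu0.
have x1 : 0 <= 4 * a by rewrite mulr_ge0.
have x2 : 0 <= 16 * b * a / nu by rewrite divr_ge0 ?(ltW nu0)// !mulr_ge0.
have x3 : 0 <= 304 * c * nu by exact: mulr_ge0 (mulr_ge0 (ler0n _ _) c0) (ltW nu0).
have [r [r0 r1 H]] := exists_small (addr_ge0 (addr_ge0 x1 x2) x3).
have rr : r ^+ 2 <= r by rewrite expr2 ler_piMr// ltW.
have x12 := addr_ge0 x1 x2.
exists r; split => //.
- have : 4 * a * r <= 1 by apply: H; rewrite x1 -addrA lerDl addr_ge0.
  have : a * r ^+ 2 <= a * r by rewrite ler_wpM2l.
  by clear; lra.
- have Hr : 16 * b * a / nu * r <= 1 by apply: H; rewrite x2 addrAC lerDr addr_ge0.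
  have e : 16 * b * a * r = nu * (16 * b * a / nu * r) by field; rewrite gt_eqF.
  have : 16 * b * a * r <= nu by rewrite e -[leRHS]mulr1 ler_wpM2l// ltW.
  have : b * a * r ^+ 2 <= b * a * r by rewrite ler_wpM2l// mulr_ge0.
  by move: nu0; clear; lra.
- have : 304 * c * nu * r <= 1 by apply: H; rewrite x3 lerDr.
  have : c * nu * r ^+ 2 <= c * nu * r by rewrite ler_wpM2l// mulr_ge0// ltW.
  by clear; lra.
Qed.

Lemma normW12_le_normW22 {R : realType} (h : R) u e : normW22 h u <= e -> normW12 h u ^+ 2 <= e ^+ 2.
Proof.
have n0 : 0 <= normW22 h u by exact: sqrtr_ge0.
have le3 (a b A B C : R) : a = A + B -> b = A + B + C -> 0 <= C -> a <= b.
  by move=> -> -> ?; rewrite lerDl.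
move=> ue; apply: (@le_trans _ _ (normW22 h u ^+ 2)).
  exact: le3 (normW12_sqr h u) (normW22_sqr h u) (integ_ge0 (fun z _ => sqr_ge0 _)).
move: (normW22 h u) n0 ue => x x0 xe.
by rewrite lerXn2r// nnegrE (le_trans x0 xe).
Qed.

(** The [+ 1] added to [P / kap] and the factor 2 in front of [M] provide the two strict
    inequalities. *)
Lemma exists_eps {R : realType} (K P kap a b L rho M : R) :
  0 <= K -> 0 <= P -> 0 < kap -> 0 <= a -> 0 <= b -> 0 <= L -> 0 < rho -> 0 <= M ->
  exists e : R, [/\ 0 < e, 16 * K * e ^+ 2 <= 1, P * e ^+ 2 < kap,
    a * e + b * e ^+ 2 <= 8^-1 & L * e <= rho /\ M * e ^+ 2 < e].
Proof.
move=> K0 P0 k0 a0 b0 L0 r0 M0.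
have x1 : 0 <= 16 * K by rewrite mulr_ge0.
have x2 : 0 <= P / kap + 1 by rewrite addr_ge0// divr_ge0// ltW.
have x3 : 0 <= 8 * (a + b) by rewrite mulr_ge0// addr_ge0.
have x4 : 0 <= L / rho by rewrite divr_ge0// ltW.
have x5 : 0 <= 2 * M by rewrite mulr_ge0.
set T := 16 * K + (P / kap + 1) + 8 * (a + b) + L / rho + 2 * M.
have T0 : 0 <= T by exact: addr_ge0 (addr_ge0 (addr_ge0 (addr_ge0 x1 x2) x3) x4) x5.
have [e [e0 e1 H]] := exists_small T0.
have ee : e ^+ 2 <= e by rewrite expr2 ler_piMr// ltW.
have H1 : 16 * K * e <= 1 by apply: H; rewrite x1 /T; lra.
have H2 : (P / kap + 1) * e <= 1 by apply: H; rewrite x2 /T; lra.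
have H3 : 8 * (a + b) * e <= 1 by apply: H; rewrite x3 /T; lra.
have H4 : L / rho * e <= 1 by apply: H; rewrite x4 /T; lra.
have H5 : 2 * M * e <= 1 by apply: H; rewrite x5 /T; lra.
have up c : 0 <= c -> c * e ^+ 2 <= c * e by move=> c0; rewrite ler_wpM2l.
exists e; split => //; first exact: le_trans (up _ x1) H1.
- apply: le_lt_trans (up _ P0) _.
  have -> : P * e = kap * ((P / kap + 1) * e) - kap * e by field; rewrite gt_eqF.
  rewrite ltrBlDr (@le_lt_trans _ _ (kap * 1))//; first by rewrite ler_wpM2l// ltW.
  by rewrite mulr1 ltrDl mulr_gt0.
- have := up _ b0; move: H3; clear; lra.
split.
  have -> : L * e = rho * (L / rho * e) by field; rewrite gt_eqF.
  by rewrite -[leRHS]mulr1 ler_wpM2l// ltW.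
have : 2 * M * e * e <= 1 * e by rewrite ler_wpM2r// ltW.
by rewrite expr2; move: e0; clear; lra.
Qed.

Theorem proposition9 (R : realType) (h p k1 k2 k3 lam1 lam2 f theta0 : R)
    (n0 : nat) :
  0 < h -> 0 < p -> 0 < k1 -> k1 = k2 -> k2 = k3 ->
  0 < lam1 -> 0 < lam2 -> 0 < f ->
  0 < theta0 < pi / 2 -> (0 < n0)%N ->
  let sigma := 2 * pi / p in
  let q := 2 * pi * n0%:R / h in
  let dstar := - (2 * lam2 * q ^+ 4 * cos theta0 ^+ 4) in
  exists (eps delta : R) (dt : R -> R) (w : R -> R -> R),
    [/\ 0 < eps /\ 0 < delta,
        smooth_on delta dt /\ smooth_to_V h delta w,
        (forall t : R, `|t| < delta -> `|dt t - dstar| < eps) /\ dt 0 = dstar,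
        forall s t : R, `|s| < `|t| -> `|t| < delta -> dt t < dt s &
        (forall t : R, `|t| < delta ->
           EL h k1 sigma lam1 lam2 f q theta0 (dt t)
             (fun=> 0) (smectic q w t) /\
           EL h k1 sigma lam1 lam2 f q theta0 (dt t)
             (fun=> 0) (fun z => - smectic q w t z))
        /\
        (forall (d : R) (theta rho : R -> R),
           Wtheta h theta -> V h rho ->
           `|d - dstar| < eps ->
           normW12 h theta <= eps -> normW22 h rho <= eps ->
           (EL h k1 sigma lam1 lam2 f q theta0 d theta rho <->
            vanishes h theta /\
            (vanishes h rho \/
             exists t : R, [/\ `|t| < delta, d = dt t &
               (forall z : R, 0 <= z <= h -> rho z = smectic q w t z) \/
               (forall z : R, 0 <= z <= h -> rho z = - smectic q w t z)])))].
Proof.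
move=> h0 p0 k10 _ _ l10 l20 f0 _ n00 sigma q dstar.
have pi0 : 0 < pi :> R by exact: pi_gt0.
have q0 : 0 < q by rewrite divr_gt0// !mulr_gt0// ltr0n.
have qh : q * h = 2 * pi * n0%:R by rewrite /q mulfVK// gt_eqF.
have [sin_qh cos_qh] : sin (q * h) = 0 /\ cos (q * h) = 1.
  by rewrite qh; exact: sin_cos_2pin.
have sig0 : 0 < sigma by rewrite divr_gt0// mulr_gt0.
clearbody q sigma; pose nu := f / (2 * lam1).
have nu0 : 0 < nu by rewrite divr_gt0// mulr_gt0.
have fnu : 2 * lam1 * nu = f by rewrite /nu; field; rewrite gt_eqF.
have G0 := green_const_gt0 h0 q0.
have rt0 := rate_gt0 h0 q0 nu0.
have Mb0 := Mbound_ge0 nu0.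
have [rho [rho0 rr4 rr5 rr6]] := exists_rho (ltW rt0) Mb0 (ltW G0) nu0.
have rr2 : rate h q nu * rho ^+ 2 <= 2^-1.
  by apply: le_trans rr4 _; rewrite lef_pV2 ?posrE// ler_nat.
have K0 := sup_const_gt0 h0; set K := sup_const h in K0.
pose s := Num.sqrt K; have s0 : 0 <= s by exact: sqrtr_ge0.
have sK : s ^+ 2 = K by rewrite sqr_sqrtr// ltW.
(* Coercivity constant of the theta energy in the full W^{1,2} norm: the smaller of the coefficients
   of the gradient and of the function. *)
pose kap := Num.min (2 * k1) (k1 * sigma ^+ 2).
have kap0 : 0 < kap by rewrite lt_min !mulr_gt0// exprn_gt0.
pose P := 2 * lam2 * q ^+ 2 * cos theta0 ^+ 2 * K.
have P0 : 0 <= P.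
  apply: mulr_ge0 (ltW K0); apply: mulr_ge0 (sqr_ge0 _); apply: mulr_ge0 (sqr_ge0 _).
  by rewrite mulr_ge0// ltW.
(* A solution of norm at most e has supremum at most [s * e] and amplitude at most [2 * s * e]; the
   [+ 1] puts this strictly inside the parameter range delta = [L * e]. *)
pose L := 2 * s + 1; have L0 : 0 < L by rewrite ltr_wpDl// mulr_ge0.
(* [a * e + b * e ^+ 2] bounds the smallness quantity of [weak_unique], since
   [|m| <= e / (2 * lam1)] and [u] is at most [s * e]. *)
pose a := green_const h q / (2 * lam1).
have a0 : 0 <= a by rewrite divr_ge0 ?mulr_ge0// ltW.
pose b := green_const h q * (nu * K); have b0 : 0 <= b := mulr_ge0 (ltW G0) (mulr_ge0 (ltW nu0) (ltW K0)).
(* For [|t| < L * e] the curve stays within [M * e ^+ 2] of [dstar]; asking this to be below [e]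
   lets the same number serve as eps. *)
pose M := 2 * lam1 * (2 * Mbound nu) * L ^+ 2.
have M0 : 0 <= M by by apply: mulr_ge0 (sqr_ge0 _); apply: mulr_ge0; apply: mulr_ge0 => //; exact: ltW.
have [e [e0 Ke Pe abe [Le Me]]] := exists_eps (ltW K0) P0 kap0 a0 b0 (ltW L0) rho0 M0.
have de0 : 0 < L * e by rewrite mulr_gt0.
pose mc := mcurve h q nu; pose dt t := dstar - 2 * lam1 * mc t.
have in_rho (t : R) : `|t| < L * e -> `|t| < rho by move=> H; exact: lt_le_trans Le.
have mcE t : - (2 * lam2 * q ^+ 4 * cos theta0 ^+ 4) - dt t = 2 * lam1 * mc t.
  by rewrite /dt -/dstar opprB addrC subrK.
have pos t : `|t| < L * e ->
    EL h k1 sigma lam1 lam2 f q theta0 (dt t) (fun=> 0) (smectic q (wser h q nu 0) t).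
  move=> /in_rho tr; apply/EL_theta0 => //; rewrite mcE -fnu.
  exact: (branch_weak h0 q0 nu0 l10 sin_qh cos_qh rho0 rr2 tr).
have neg t : `|t| < L * e ->
    EL h k1 sigma lam1 lam2 f q theta0 (dt t) (fun=> 0)
      (fun z => - smectic q (wser h q nu 0) t z).
  move=> /in_rho tr; apply/EL_theta0 => //; rewrite mcE -fnu.
  exact: (branchN_weak h0 q0 nu0 l10 sin_qh cos_qh rho0 rr2 tr).
exists e, (L * e), dt, (wser h q nu 0); split => //.
- split.
    (* The boolean factor keeps the constant [dstar] at order 0 only, so a single formula covers all
       derivatives. *)
    pose F n t := (n == 0%N)%:R * dstar - 2 * lam1 * mser 2 (Mc h q nu) n t.
    have -> : dt = F 0%N by apply/funext => t; rewrite /F mul1r.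
    apply: smooth_on_iter => n t /in_rho tr.
    have d := mcurve_derive h0 q0 nu0 sin_qh cos_qh rho0 rr2 n tr.
    have := is_derive1B (is_derive_cst ((n == 0%N)%:R * dstar) t 1) (is_derive1Z (2 * lam1) d).
    by rewrite /F mul0r.
  exists (wser h q nu); split => // n t /in_rho tr.
    exact: (wser_V h0 q0 nu0 sin_qh cos_qh rho0 rr2 n tr).
  exact: (wser_smooth h0 q0 nu0 sin_qh cos_qh rho0 rr2 n tr).
- have mb t : `|t| < L * e -> `|dt t - dstar| <= 2 * lam1 * (2 * Mbound nu * t ^+ 2).
    move=> /in_rho tr; rewrite /dt addrAC subrr sub0r normrN normrM gtr0_norm ?mulr_gt0//.
    by rewrite ler_pM2l ?mulr_gt0// (mcurve_norm h0 q0 nu0 sin_qh cos_qh rho0 rr2 tr).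
  split=> [t td|].
    apply: le_lt_trans (mb t td) (le_lt_trans _ Me).
    have -> : M * e ^+ 2 = 2 * lam1 * (2 * Mbound nu * (L * e) ^+ 2) by rewrite /M; ring.
    have t2 : t ^+ 2 <= (L * e) ^+ 2.
      by rewrite -real_normK ?num_real// lerXn2r ?nnegrE ?(ltW de0)// ltW.
    by rewrite ler_pM2l ?mulr_gt0//; apply: ler_wpM2l t2; exact: mulr_ge0.
  have := mb 0; rewrite normr0 expr0n/= !mulr0 normr_le0 subr_eq0 => H.
  by apply/eqP/H.
- move=> t' t tt td; rewrite /dt ltrD2l ltrN2 ltr_pM2l ?mulr_gt0//.
  exact: (mcurve_increasing h0 q0 nu0 sin_qh cos_qh rho0 rr2 rr4 rr5 tt (in_rho _ td)).
split=> [t td|d theta u tW uV de tN uN]; first by split; [exact: pos|exact: neg].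
split; last first.
  move=> [t0 [u0|[t [td -> [ut|ut]]]]].
  - apply: (@eq_EL _ h h0 _ _ _ _ _ _ _ _ (fun=> 0) theta (fun=> 0) u).
    + by move=> z zI; rewrite t0.
    + by move=> z zI; rewrite u0.
    apply/EL_theta0 => //; split.
      by apply: (@eq_Wrho _ h h0 u) => //; case: uV.
    by rewrite -fnu; exact: zero_weak.
  - apply: (@eq_EL _ h h0 _ _ _ _ _ _ _ _ (fun=> 0) theta _ u) (pos t td).
    + by move=> z zI; rewrite t0.
    + by move=> z zI; rewrite ut.
  - apply: (@eq_EL _ h h0 _ _ _ _ _ _ _ _ (fun=> 0) theta _ u) (neg t td).
    + by move=> z zI; rewrite t0.
    + by move=> z zI; rewrite ut.
move=> EL0; have [_ uW weq _] := EL0; have [tW1 _ _ _] := tW.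
have u22 : W22 h u by case: uW.
have tv : vanishes h theta.
  apply: (weak_theta_vanishes h0 k10 l20 _ _ Ke Pe tW1 u22 tN uN (weq _ tW1)).
    by rewrite ge_min lexx.
  by rewrite ge_min lexx orbT.
split => //.
have [_ weak] : Wrho h u /\ weak_smectic h lam1 q (dstar - d) (2 * lam1 * nu) u.
  rewrite fnu; apply/(EL_theta0 h0 k1 sigma lam1 lam2 f q theta0 d).
  by apply: (@eq_EL _ h h0 _ _ _ _ _ _ _ _ theta (fun=> 0) u u) EL0.
have [_ [u12 u0 _]] := uV.
have uk z : 0 <= z <= h -> `|u z| <= s * e.
  move=> zI; have se0 : 0 <= s * e by rewrite mulr_ge0// ltW.
  have u2 : u z ^+ 2 <= (s * e) ^+ 2.
    rewrite exprMn sK; apply: le_trans (W12_sup h0 u12 zI) _.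
    by apply: (ler_wpM2l (ltW K0)); exact: normW12_le_normW22.
  move: u2; rewrite -real_normK ?num_real// ler_sqr ?nnegrE//.
have sL : 2 * (s * e) < L * e.
  have -> : L * e = 2 * (s * e) + e by rewrite /L; ring.
  by rewrite ltrDl.
have sr : 2 * (s * e) < rho.
  by apply: lt_le_trans sL Le.
have small : green_const h q * (`|(dstar - d) / (2 * lam1)| + nu * (s * e) ^+ 2) <= 8^-1.
  apply: le_trans abe; rewrite exprMn sK mulrDr.
  have -> : b * e ^+ 2 = green_const h q * (nu * (K * e ^+ 2)) by rewrite /b; ring.
  apply: lerD => //.
  have l2 : 0 < 2 * lam1 by rewrite mulr_gt0.
  rewrite normrM normfV (gtr0_norm l2) distrC /a -mulrA ler_pM2l// [leRHS]mulrC.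
  by rewrite ler_pM2r ?invr_gt0// ltW.
have := weak_unique h0 q0 nu0 l10 sin_qh cos_qh rho0 rr2 rr6 uW u0 weak uk sr small.
case=> [|[t [tr tk mt ut]]]; first by left.
right; exists t; split.
- exact: le_lt_trans tk sL.
- by rewrite /dt -[2 * lam1 * _]mt opprB addrC subrK.
- by left.
Qed.
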